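(* Let $D\neq 1$ be a fundamental discriminant and $l\ge 1$ an integer. Then for every $x>0$ the theta series $\vartheta_{Dl^2}$ satisfies $$\vartheta_{Dl^2}(x)=\frac{1}{(|D|l^2x)^{\delta_D+\frac12}}\sum_{n=1}^\infty v_{n,l}\;\chi_D\!\left(\frac{n}{v_{n,l}^2}\right)n^{\delta_D}\,e^{-\frac{\pi n^2}{D^2l^4x}},$$ where, for each $n\ge 1$, $v_{n,l}$ is the unique positive integer $v$ with $v\mid l$, $v^2\mid n$ and $\gcd\left(\frac lv,\frac n{v^2}\right)=1$ if such a $v$ exists, and $v_{n,l}=0$ otherwise (in which case the $n$-th term of the sum is $0$).
   Context: $\chi_D=\left(\frac D\cdot\right)$ is the primitive quadratic Dirichlet character attached to $D$, and $\delta_D\in\{0,1\}$ is defined by $\chi_D(-1)=(-1)^{\delta_D}$. For $x>0$, $$\theta_D(x)=\sum_{n=1}^\infty\chi_D(n)n^{\delta_D}e^{-\pi n^2x},$$ and, for $\Delta=Dl^2$, with $\mu$ the Möbius function, $$\vartheta_\Delta(x)=\sum_{r\mid l}\left(\frac lr\right)^{2\delta_D+1}\sum_{u\mid r}\mu(u)u^{\delta_D}\chi_D(u)\,\theta_D\!\left(\frac{u^2l^4x}{r^4}\right).$$ *)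

(* Defs.v *)
From mathcomp Require Import all_boot all_order all_algebra.
From mathcomp Require Import all_classical all_reals all_analysis.
Set Implicit Arguments.
Unset Strict Implicit.
Unset Printing Implicit Defensive.
Import Order.TTheory GRing.Theory Num.Theory.
Import numFieldNormedType.Exports.
Local Open Scope ring_scope.

Definition squarefree (n : nat) : bool :=
  (0 < n)%N && all (fun p => ~~ (p ^ 2 %| n)%N) (primes n).

Definition moebius (n : nat) : int :=
  if squarefree n then (-1) ^+ size (primes n) else 0.

(* The convention under which 1 is a fundamental discriminant. *)
Definition fundamental_discriminant (D : int) : bool :=
  ((D == 1 %[mod 4])%Z && squarefree `|D|%N)
  || [&& (4 %| D)%Z,
         ((D %/ 4)%Z == 2 %[mod 4])%Z || ((D %/ 4)%Z == 3 %[mod 4])%Z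
       & squarefree `|(D %/ 4)%Z|%N].

Definition legendre (a : int) (p : nat) : int :=
  if (p%:Z %| a)%Z then 0
  else if [exists y : 'I_p, (a == (y : nat)%:Z ^+ 2 %[mod p%:Z])%Z] then 1
  else -1.

Definition kronecker_prime (a : int) (p : nat) : int :=
  if p == 2%N then
    if (2 %| a)%Z then 0
    else if (a == 1 %[mod 8])%Z || (a == 7 %[mod 8])%Z then 1 else -1
  else legendre a p.

(* The Kronecker symbol (a/n), with (a/-1) = -1 iff a < 0, and (a/0) = 1 if
   a is a unit, 0 otherwise. *)
Definition kronecker (a n : int) : int :=
  if n == 0 then (`|a|%N == 1%N)%:R
  else (if (n < 0) && (a < 0) then -1 else 1)
       * \prod_(p <- primes `|n|%N) kronecker_prime a p ^+ logn p `|n|%N.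

Definition delta (D : int) : nat := kronecker D (-1) == -1.

Lemma deltaP (D : int) : kronecker D (-1) = (-1) ^+ delta D.
Proof.
rewrite /delta /kronecker /= big_nil mulr1.
by case: (D < 0).
Qed.

Section Theta.
Context {R : realType}.

Definition theta (D : int) (x : R) : R :=
  limn (fun N : nat => \sum_(1 <= n < N)
    (kronecker D n%:Z)%:~R * n%:R ^+ delta D * expR (- (pi * n%:R ^+ 2 * x))).

(* This is the function attached to Delta = D * l ^ 2. *)
Definition vartheta (D : int) (l : nat) (x : R) : R :=
  \sum_(r <- divisors l) (l%:R / r%:R) ^+ (2 * delta D + 1) *
    \sum_(u <- divisors r)
      (moebius u)%:~R * u%:R ^+ delta D * (kronecker D u%:Z)%:~R *
      theta D (u%:R ^+ 2 * l%:R ^+ 4 * x / r%:R ^+ 4).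

End Theta.

Definition vcond (n l v : nat) : bool :=
  [&& v %| l, v ^ 2 %| n & coprime (l %/ v) (n %/ v ^ 2)]%N.

(* For n, l > 0 at most one v satisfies vcond n l, see vnl_uniq. *)
Definition vnl (n l : nat) : nat :=
  head 0%N [seq v <- divisors l | vcond n l v].

Lemma vcond_uniq (n l v w : nat) : (0 < n)%N -> (0 < l)%N ->
  vcond n l v -> vcond n l w -> v = w.
Proof.
move=> n0 l0 Hv Hw.
have gt0 u : vcond n l u -> (0 < u)%N by case/and3P=> /dvdn_gt0 ->.
have key u p : prime p -> vcond n l u ->
    logn p u = minn (logn p l) (logn p n)./2.
  move=> pp Hu; have u0 := gt0 u Hu; case/and3P: Hu => ul un cop.
  have u20 : (0 < u ^ 2)%N by rewrite expn_gt0 u0.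
  have a0 : (0 < l %/ u)%N by rewrite divn_gt0 // dvdn_leq.
  have b0 : (0 < n %/ u ^ 2)%N by rewrite divn_gt0 // dvdn_leq.
  have el : logn p l = (logn p (l %/ u) + logn p u)%N.
    by rewrite -lognM // divnK.
  have en : logn p n = (logn p (n %/ u ^ 2) + 2 * logn p u)%N.
    by rewrite -lognX -lognM // divnK.
  have : (logn p (l %/ u) == 0)%N || (logn p (n %/ u ^ 2) == 0)%N.
    rewrite -[_ || _]negbK negb_or -!lt0n !logn_gt0 !mem_primes pp a0 b0 /=.
    apply/negP => /andP[d1 d2].
    have := dvdn_gcd p (l %/ u) (n %/ u ^ 2).
    by rewrite (eqP cop) d1 d2 dvdn1 => /eqP p1; rewrite p1 in pp.
  case/orP => /eqP e.
    rewrite el e add0n; apply/esym/minn_idPl; rewrite en.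
    by rewrite -[X in (X <= _)%N]doubleK half_leq // -mul2n leq_addl.
  rewrite en e add0n mul2n doubleK; apply/esym/minn_idPr.
  by rewrite el leq_addl.
apply: eqn_from_log; [exact: gt0 v Hv | exact: gt0 w Hw | move=> p].
have [pp|pp] := boolP (prime p); first by rewrite (key v) // (key w).
by rewrite /logn (negbTE pp).
Qed.

Lemma vnl_uniq (n l v : nat) : (0 < n)%N -> (0 < l)%N ->
  vcond n l v -> vnl n l = v.
Proof.
move=> n0 l0 Hv; rewrite /vnl.
have : v \in [seq v <- divisors l | vcond n l v].
  by rewrite mem_filter Hv -dvdn_divisors //; case/and3P: Hv.
case E : [seq _ <- _ | _] => [//|w s] _ /=.
apply: (vcond_uniq n0 l0) => //.
have : w \in [seq v <- divisors l | vcond n l v] by rewrite E mem_head.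
by rewrite mem_filter => /andP[].
Qed.

Lemma vnl_none (n l : nat) : (forall v, ~~ vcond n l v) -> vnl n l = 0%N.
Proof.
move=> H; rewrite /vnl (eq_filter (a2 := pred0)) ?filter_pred0 // => v.
exact/negbTE/H.
Qed.

Lemma kronecker_prime_le1 (a : int) (p : nat) : `|kronecker_prime a p| <= 1.
Proof. by rewrite /kronecker_prime /legendre; do 3?case: ifP. Qed.

Lemma kronecker_le1 (a n : int) : `|kronecker a n| <= 1.
Proof.
rewrite /kronecker; case: ifP => _; first by case: (_ == _).
rewrite normrM -[1]mulr1 ler_pM //; first by case: ifP.
rewrite normr_prod; apply: prodr_ile1 => p _ /=; rewrite ?normr_ge0 //=.
by rewrite normrX exprn_ile1 // kronecker_prime_le1.
Qed.

Lemma vnl_le (n l : nat) : (0 < l)%N -> (vnl n l <= l)%N.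
Proof.
move=> l0; rewrite /vnl; case E : [seq _ <- _ | _] => [//|w s] /=.
have : w \in [seq v <- divisors l | vcond n l v] by rewrite E mem_head.
by rewrite mem_filter -dvdn_divisors // => /andP[_ /dvdn_leq->].
Qed.

Section Convergence.
Context {R : realType}.

Lemma gauss_cvg (a : nat -> R) (M c : R) (k : nat) :
  (k <= 1)%N -> 0 < c -> (forall n, `|a n| <= M) ->
  cvgn (fun N : nat =>
    \sum_(1 <= n < N) a n * n%:R ^+ k * expR (- (c * n%:R ^+ 2))).
Proof.
move=> k1 c0 aM; have M0 : 0 <= M := le_trans (normr_ge0 _) (aM 0%N).
pose f n : R := if n is 0%N then 0 else a n * n%:R ^+ k * expR (- (c * n%:R ^+ 2)).
have -> : (fun N : nat =>
    \sum_(1 <= n < N) a n * n%:R ^+ k * expR (- (c * n%:R ^+ 2))) = series f.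
  apply/funext => -[|N]; rewrite /series /=; first by rewrite !big_geq.
  rewrite [RHS]big_ltn // add0r; apply: eq_big_nat => n /andP[n1 _].
  by case: n n1.
apply: normed_cvg.
pose h := c / 2; have h0 : 0 < h by rewrite divr_gt0.
have z1 : `|expR (- h)| < 1 by rewrite ger0_norm ?expR_ge0 // expR_lt1 oppr_lt0.
apply: (@series_le_cvg _ _ (geometric (M / h) (expR (- h))));
  last exact: is_cvg_geometric_series; move=> n //=.
  by rewrite mulr_ge0 ?exprn_ge0 ?expR_ge0 ?divr_ge0 // ltW.
case: n => [|n]; rewrite /f.
  by rewrite normr0 mulr_ge0 ?divr_ge0 ?exprn_ge0 ?expR_ge0 // ltW.
set m := n.+1; have m1 : 1 <= m%:R :> R by rewrite ler1n.
rewrite normrM normrM -!mulrA ler_pM ?mulr_ge0 //.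
rewrite normrX ger0_norm ?ler0n // ger0_norm ?expR_ge0 //.
have mk : m%:R ^+ k <= m%:R :> R.
  by rewrite -[leRHS]expr1 ler_weXn2l.
have mh : m%:R <= h^-1 * expR (h * m%:R).
  rewrite ler_pdivlMl //; apply: le_trans (expR_ge1Dx _).
  by rewrite lerDr.
apply: (@le_trans _ _ (h^-1 * expR (h * m%:R) * expR (- (c * m%:R)))).
  apply: ler_pM; rewrite ?exprn_ge0 ?expR_ge0 //; first exact: le_trans mk mh.
  by rewrite ler_expR lerN2 ler_pM2l // expr2 ler_peMr // ler0n.
rewrite -mulrA -expRD ler_pM2l ?invr_gt0 //.
rewrite -expRM_natr ler_expR le_eqVlt; apply/orP; left; apply/eqP.
by rewrite [c in LHS](splitr c) -/h mulrDl opprD addrA subrr add0r mulNr.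
Qed.

Lemma delta_le1 (D : int) : (delta D <= 1)%N.
Proof. by rewrite /delta; case: (_ == _). Qed.

Lemma theta_cvg (D : int) (x : R) : 0 < x ->
  cvgn (fun N : nat => \sum_(1 <= n < N)
    (kronecker D n%:Z)%:~R * n%:R ^+ delta D * expR (- (pi * n%:R ^+ 2 * x))).
Proof.
move=> x0; under eq_fun do under eq_bigr do rewrite (mulrAC pi).
apply: (gauss_cvg (a := fun n => (kronecker D n%:Z)%:~R) (M := 1)); rewrite ?delta_le1 ?mulr_gt0 ?pi_gt0 // => n.
by rewrite -intr_norm lerz1 kronecker_le1.
Qed.

Lemma dual_theta_cvg (D : int) (l : nat) (x : R) :
  D != 0 -> (0 < l)%N -> 0 < x ->
  cvgn (fun N : nat => \sum_(1 <= n < N)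
    (vnl n l)%:R * (kronecker D (n %/ vnl n l ^ 2)%N%:Z)%:~R *
    n%:R ^+ delta D *
    expR (- (pi * n%:R ^+ 2 / (D%:~R ^+ 2 * l%:R ^+ 4 * x)))).
Proof.
move=> D0 l0 x0; under eq_fun do under eq_bigr do rewrite (mulrAC pi).
apply: (gauss_cvg (a := fun n => (vnl n l)%:R *
  (kronecker D (n %/ vnl n l ^ 2)%N%:Z)%:~R) (M := l%:R)).
- exact: delta_le1.
- have D2 : 0 < D%:~R ^+ 2 :> R by rewrite exprn_even_gt0 //= intr_eq0.
  have l4 : 0 < l%:R ^+ 4 :> R by rewrite exprn_gt0 // ltr0n.
  exact: divr_gt0 (pi_gt0 R) (mulr_gt0 (mulr_gt0 D2 l4) x0).
move=> n; rewrite normrM -[leRHS]mulr1 ler_pM //.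
  by rewrite normr_nat ler_nat vnl_le.
by rewrite -intr_norm lerz1 kronecker_le1.
Qed.

End Convergence.

(* Main.v *)
(** Collecting the terms n = m r^2 / u in the definition of vartheta and summing
    mu over the common divisors of l / v and n / v^2 (where v = r / u) reduces
    the statement to the functional equation
      theta_D(x) = (|D| x)^-(delta + 1/2) theta_D(1 / (D^2 x)).

    The functional equation is the limit of a finite Poisson formula (Polya).
    With q = |D|, expand sum_h chi(h) (2 cos (pi h / (q L)))^(2 m), over
    h mod q L, by the binomial theorem: only the coefficients C(2m, m + L j)
    survive, weighted by the Gauss sums of chi. Let L tend to infinity with
    m ~ s L^2; both sides converge to theta series by dominated convergence. For
    D < 0 one uses sin (pi h / (q L)) times an odd power of the cosine.

    The Gauss sums are handled as follows. Write D as a product of prime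
    discriminants, and let psi be the corresponding product of Legendre symbols
    (./p) and a character mod 4 or 8. Its Gauss sum tau satisfies tau^2 = D in
    any field, and in characteristic l the Frobenius maps tau to psi(l) tau;
    hence psi(l) = D^((l-1)/2) = (D/l) in F_l, which identifies psi with the
    Kronecker symbol and contains quadratic reciprocity. By reciprocity the sign
    of the complex Gauss sum is multiplicative in D. For a prime p the sign comes
    from the comparison of sum_j (j/p) X^j with the product over k <= (p-1)/2 of
    X^(k(p-1)/2) (X^k - 1): up to sign they agree modulo the cyclotomic
    polynomial Phi_p, and the sign is read off at X = 1 modulo p. *)

Require Import Defs.
From mathcomp Require Import all_boot all_order all_algebra all_field all_solvable.
From mathcomp Require Import all_classical all_reals all_analysis.
From mathcomp Require Import complex ring lra zify.
Set Implicit Arguments.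
Unset Strict Implicit.
Unset Printing Implicit Defensive.
Import Order.TTheory GRing.Theory Num.Theory.
Import numFieldNormedType.Exports.
Local Open Scope ring_scope.

(** * Gauss sums of quadratic characters *)

(** The asymptotics of binomial coefficients enter only through the limit [beta] of m C(2m, m)^2 /
    16^m. Monotonicity yields its existence and positivity; it stays a parameter of both Poisson
    limits, and its value 1/pi is extracted from the cosine formula itself, for the trivial
    character. The choice s = 1/(pi x) then produces e^(-pi n^2 x) on one side and e^(-pi n^2 / (D^2
    x)) on the other. The sine formula is the cosine formula differentiated in the angle.
    Differentiation brings down the weight n that theta_D carries for D < 0, and raises the exponent
    from 1/2 to 3/2. Gauss sums are taken over an arbitrary field because the same identities serve
    twice: in C for the sign, in a finite field for Frobenius. The sign itself requires a passage
    through integer polynomials: the equality up to sign is known at a complex root of unity, while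
    the sign is visible only modulo p. The condition D != 1 enters through chi_D(0) = 0, which
    removes the constant terms of the cosine formula. *)

Lemma sum_mulmod (V : nmodType) (q h : nat) (F : nat -> V) :
  (0 < q)%N -> coprime q h -> (forall n, F (n %% q)%N = F n) ->
  \sum_(j < q) F (h * j)%N = \sum_(j < q) F j.
Proof.
move=> q0 qh Fq.
pose f (j : 'I_q) : 'I_q := Ordinal (ltn_pmod (h * j) q0).
have f_inj : injective f.
  move=> i j [] /eqP e; apply/val_inj/eqP => /=.
  wlog ij : i j e / (i <= j)%N.
    by move=> H; case/orP: (leq_total i j) => ij; [|rewrite eq_sym]; apply: H => //; rewrite eq_sym.
  move: e; rewrite eq_sym eqn_mod_dvd ?leq_mul2l ?ij ?orbT // -mulnBr Gauss_dvdr //.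
  move=> d; rewrite eqn_leq ij /= -subn_eq0; apply: contraTT d => d0.
  by rewrite gtnNdvd ?lt0n // (leq_ltn_trans (leq_subr _ _)).
rewrite [RHS](reindex_inj f_inj) /=; apply: eq_bigr => j _.
by rewrite Fq.
Qed.

(** The residues are written [a * q2 + b * q1], without Bezout idempotents, so that z^j splits as
    (z^q2)^a (z^q1)^b with primitive roots of orders q1 and q2. The price is the factor
    [psi1 q2 * psi2 q1] in [gaussM], and this is where reciprocity enters. *)
Lemma sum_crt (V : nmodType) (q1 q2 : nat) (F : nat -> V) :
  (0 < q1)%N -> (0 < q2)%N -> coprime q1 q2 ->
  (forall n, F (n %% (q1 * q2))%N = F n) ->
  \sum_(j < q1 * q2) F j = \sum_(a < q1) \sum_(b < q2) F (a * q2 + b * q1)%N.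
Proof.
move=> q10 q20 co Fq.
have q0 : (0 < q1 * q2)%N by rewrite muln_gt0 q10.
pose f (x : 'I_q1 * 'I_q2) : 'I_(q1 * q2) :=
  Ordinal (ltn_pmod (x.1 * q2 + x.2 * q1) q0).
have f_inj : injective f.
  move=> [a b] [c d] [] /= e.
  have e1 : (a * q2 = c * q2 %[mod q1])%N.
    move/(congr1 (modn^~ q1)): e; rewrite !modn_dvdm ?dvdn_mulr //.
    by rewrite ![(_ + _ * q1)%N]addnC !modnMDl.
  have e2 : (b * q1 = d * q1 %[mod q2])%N.
    move/(congr1 (modn^~ q2)): e; rewrite !modn_dvdm ?dvdn_mull //.
    by rewrite !modnMDl.
  have key m n (x y : 'I_m) : coprime m n -> (x * n = y * n %[mod m])%N -> x = y.
    move=> cmn /eqP E; apply/val_inj => /=.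
    rewrite -(modn_small (ltn_ord x)) -(modn_small (ltn_ord y)); apply/eqP.
    wlog xy : x y E / (y <= x)%N.
      by move=> H; case/orP: (leq_total x y) => xy; [rewrite eq_sym|]; apply: H => //; rewrite eq_sym.
    by move: E; rewrite !eqn_mod_dvd ?leq_mul2r ?xy ?orbT // -mulnBl Gauss_dvdl.
  congr (_, _); first exact: key co e1.
  by apply: key e2; rewrite coprime_sym.
have f_bij : bijective f.
  by apply: inj_card_bij f_inj _; rewrite card_prod !card_ord.
rewrite pair_big /= (reindex f) /=; last exact: onW_bij.
by apply: eq_bigr => -[a b] _; rewrite /= Fq.
Qed.

(** Integer values allow one character to be read in every field. The last clause encodes that the
    values are 1 or -1 on the units modulo q and 0 elsewhere. *)
Definition quad_char (q : nat) (psi : nat -> int) : Prop :=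
  [/\ (0 < q)%N, psi 1%N = 1, {morph psi : a b / (a * b)%N >-> a * b},
      forall n, psi (n %% q)%N = psi n & forall n, psi n ^+ 2 = (coprime q n)%:R].

Definition gauss (psi : nat -> int) (q : nat) (F : fieldType) (z : F) (h : nat) : F :=
  \sum_(j < q) (psi j)%:~R * z ^+ (j * h).

(** Equivalent to primitivity of psi. Fields of positive characteristic are
    included because they provide the Frobenius used for reciprocity. *)
Definition separable_char (q : nat) (psi : nat -> int) : Prop :=
  forall (F : fieldType) (z : F), q.-primitive_root z ->
  forall h, gauss psi q z h = (psi h)%:~R * gauss psi q z 1.

Lemma prim_expr_modM (F : fieldType) (q : nat) (z : F) (j h : nat) :
  q.-primitive_root z -> z ^+ (j %% q * h) = z ^+ (j * h).
Proof. by move=> zq; rewrite -(prim_expr_mod zq) modnMml (prim_expr_mod zq). Qed.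

Lemma quad_char_eq0 q psi n : quad_char q psi -> (psi n == 0) = ~~ coprime q n.
Proof.
by case=> _ _ _ _ sq; rewrite -sqrf_eq0 sq; case: coprime.
Qed.

Lemma gauss_unit q psi (F : fieldType) (z : F) h : quad_char q psi ->
  q.-primitive_root z -> coprime q h ->
  gauss psi q z h = (psi h)%:~R * gauss psi q z 1.
Proof.
move=> qc zq qh; case: (qc) => q0 p1 pM pq psq.
rewrite /gauss [X in _ * X](_ : _ = \sum_(j < q) (psi (h * j)%N)%:~R * z ^+ (h * j)%N).
  rewrite mulr_sumr; apply: eq_bigr => j _.
  by rewrite pM rmorphM /= mulrA mulrA -expr2 -rmorphXn /= psq qh mul1r mulnC.
rewrite (sum_mulmod (F := fun n => (psi n)%:~R * z ^+ n)) //.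
  by apply: eq_bigr => j _; rewrite muln1.
by move=> n; rewrite pq (prim_expr_mod zq).
Qed.

Lemma sum_prim_root (F : fieldType) (q : nat) (z : F) (k : nat) :
  q.-primitive_root z -> \sum_(j < q) z ^+ (j * k) = if (q %| k)%N then q%:R else 0.
Proof.
move=> zq; case: ifP => qk.
  rewrite (eq_bigr (fun=> 1)) ?sumr_const ?card_ord // => j _.
  by apply/eqP; rewrite -(prim_order_dvd zq) dvdn_mull.
have z1 : z ^+ k - 1 != 0 by rewrite subr_eq0 -(prim_order_dvd zq) qk.
apply: (mulfI z1); rewrite mulr0.
under eq_bigr do rewrite mulnC exprM.
by rewrite -subrX1 -exprM mulnC exprM (prim_expr_order zq) expr1n subrr.
Qed.

(** Separability turns tau^2 into the sum over j of z^j [gauss psi q z j]. After exchanging the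
    sums, orthogonality of the powers of z keeps only the index k = -1 modulo q. *)
Lemma gauss_sqr q psi (F : fieldType) (z : F) : quad_char q psi ->
  separable_char q psi -> q.-primitive_root z ->
  gauss psi q z 1 ^+ 2 = (psi q.-1 * q%:Z)%:~R.
Proof.
move=> qc sep zq; case: (qc) => q0 p1 pM pq psq.
have -> : gauss psi q z 1 ^+ 2 = \sum_(j < q) z ^+ j * gauss psi q z j.
  rewrite expr2 {1}/gauss mulr_suml; apply: eq_bigr => j _.
  rewrite (sep _ _ zq j) muln1; ring.
under eq_bigr do rewrite /gauss mulr_sumr.
rewrite exchange_big /=.
under eq_bigr => k _ do (under eq_bigr => j _ do
  rewrite mulrCA -exprD -mulSn mulnC).
under eq_bigr => k _ do rewrite -mulr_sumr (sum_prim_root _ zq).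
have q1 : (q.-1 < q)%N by rewrite prednK.
rewrite (bigD1 (Ordinal q1)) //= prednK // dvdnn big1 ?addr0.
  by rewrite rmorphM.
move=> k kq; case: ifP; rewrite ?mulr0 // => /dvdn_leq qk.
case/eqP: kq; apply/val_inj/eqP; rewrite /= eqn_leq -ltnS prednK // ltn_ord /=.
by rewrite -ltnS prednK // qk.
Qed.

Lemma quad_charM q1 q2 psi1 psi2 : coprime q1 q2 -> quad_char q1 psi1 ->
  quad_char q2 psi2 -> quad_char (q1 * q2) (fun n => psi1 n * psi2 n).
Proof.
move=> co [q10 p11 pM1 pq1 sq1] [q20 p21 pM2 pq2 sq2]; split.
- by rewrite muln_gt0 q10.
- by rewrite p11 p21.
- by move=> a b; rewrite pM1 pM2; ring.
- move=> n; rewrite -(pq1 (n %% _)%N) -(pq2 (n %% _)%N).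
  by rewrite modn_dvdm ?dvdn_mulr // modn_dvdm ?dvdn_mull // pq1 pq2.
- by move=> n; rewrite exprMn sq1 sq2 coprimeMl; case: coprime; rewrite ?mul1r ?mul0r.
Qed.

Lemma gaussM q1 q2 psi1 psi2 (F : fieldType) (z : F) h : coprime q1 q2 ->
  quad_char q1 psi1 -> quad_char q2 psi2 -> (q1 * q2).-primitive_root z ->
  gauss (fun n => psi1 n * psi2 n) (q1 * q2) z h =
    (psi1 q2 * psi2 q1)%:~R * gauss psi1 q1 (z ^+ q2) h * gauss psi2 q2 (z ^+ q1) h.
Proof.
move=> co qc1 qc2 zq; have [q0 _ _ pq _] := quad_charM co qc1 qc2.
case: qc1 qc2 => [q10 p11 pM1 pq1 sq1] [q20 p21 pM2 pq2 sq2].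
rewrite {1}/gauss (sum_crt (F := fun j => (psi1 j * psi2 j)%:~R * z ^+ (j * h))) //; last first.
  by move=> n; rewrite (prim_expr_modM _ _ zq) pq.
rewrite /gauss -mulrA mulr_suml mulr_sumr; apply: eq_bigr => a _.
rewrite mulr_sumr mulr_sumr; apply: eq_bigr => b _.
rewrite -(pq1 (_ + _)%N) -(pq2 (_ + _)%N) addnC modnMDl addnC modnMDl pq1 pq2 pM1 pM2.
rewrite -!exprM [in LHS]mulnDl exprD !rmorphM /=.
by rewrite [(q2 * _)%N]mulnA [(q1 * _)%N]mulnA [(q2 * _)%N]mulnC [(q1 * b)%N]mulnC; ring.
Qed.

Lemma separable_charM q1 q2 psi1 psi2 : coprime q1 q2 -> quad_char q1 psi1 ->
  quad_char q2 psi2 -> separable_char q1 psi1 -> separable_char q2 psi2 ->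
  separable_char (q1 * q2) (fun n => psi1 n * psi2 n).
Proof.
move=> co qc1 qc2 s1 s2 F z zq h; rewrite !gaussM //.
have q10 : (0 < q1)%N by case: qc1.
have q20 : (0 < q2)%N by case: qc2.
have z1 : q1.-primitive_root (z ^+ q2).
  by have := dvdn_prim_root zq (dvdn_mulr q2 (dvdnn q1)); rewrite mulKn.
have z2 : q2.-primitive_root (z ^+ q1).
  by have := dvdn_prim_root zq (dvdn_mull q1 (dvdnn q2)); rewrite mulnK.
by rewrite (s1 _ _ z1 h) (s2 _ _ z2 h) !rmorphM /=; ring.
Qed.

(** * Legendre symbols *)

Lemma finField_prim_root (F : finFieldType) : exists z : F, #|F|.-1.-primitive_root z.
Proof.
have c1 := finNzRing_gt1 F.
have c0 : (0 < #|F|.-1)%N by rewrite -subn1 subn_gt0.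
suff /hasP[z _ zp] : has (#|F|.-1).-primitive_root (enum (predC1 (0 : F))) by exists z.
apply: has_prim_root; rewrite ?enum_uniq //.
  apply/allP => x; rewrite mem_enum inE => x0.
  by apply/unity_rootP/(mulfI x0); rewrite -exprS prednK ?mulr1 ?expf_card // ltnW.
by rewrite -cardE cardC1.
Qed.

(** By Euler's theorem q divides l^phi(q) - 1, the order of the cyclic group of units of the field
    with l^phi(q) elements. *)
Lemma prim_root_in_char (l q : nat) : prime l -> (0 < q)%N -> coprime l q ->
  exists (F : finFieldType) (z : F), l \in [pchar F] /\ q.-primitive_root z.
Proof.
move=> pl q0 co.
have t0 : (0 < totient q)%N by rewrite totient_gt0.
have [F Fl cF] := pPrimePowerField pl t0.
have [z zp] := finField_prim_root F.
exists F, (z ^+ (#|F|.-1 %/ q)); split=> //.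
apply: (dvdn_prim_root zp).
rewrite cF -subn1 -eqn_mod_dvd ?expn_gt0 ?prime_gt0 //.
exact/eqP/Euler_exp_totient.
Qed.

Section Legendre.
Variable p : nat.
Hypotheses (p_pr : prime p) (p_odd : odd p).
Let m := p./2.

Lemma half_odd_prime : p = m.*2.+1.
Proof. by rewrite -[LHS]odd_double_half p_odd. Qed.

Lemma half_odd_prime_gt0 : (0 < m)%N.
Proof. by rewrite half_gt0; case: p p_pr => [|[]]. Qed.

Lemma Fp_exp_half (x : 'F_p) : x != 0 -> x ^+ m.*2 = 1.
Proof.
move=> x0; apply: (mulfI x0).
by rewrite -exprS -half_odd_prime mulr1 -[RHS]expf_card card_Fp.
Qed.

Lemma Fp_intr_eq0 (a : int) : (a%:~R == 0 :> 'F_p) = (p %| a)%Z.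
Proof. by rewrite (dvdz_pcharf (pchar_Fp p_pr)). Qed.

Lemma Fp_intr_eq (a b : int) : (a%:~R == b%:~R :> 'F_p) = (a == b %[mod p])%Z.
Proof. by rewrite eqz_mod_dvd -Fp_intr_eq0 rmorphB subr_eq0. Qed.

(** Euler's criterion: a nonsquare is an odd power of a generator g, and g^m = -1. Multiplicativity,
    periodicity and the value at -1 are all derived from it. *)
Lemma legendre_euler (a : int) : (legendre a p)%:~R = a%:~R ^+ m :> 'F_p.
Proof.
rewrite /legendre -Fp_intr_eq0; have [a0|a0] := eqVneq; first by rewrite a0 expr0n gtn_eqF ?half_odd_prime_gt0.
case: ifP => [/existsP[y]|/negbT/existsP nsq].
  rewrite -Fp_intr_eq rmorphXn => /eqP ay.
  rewrite ay -exprM mul2n Fp_exp_half //.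
  by apply: contraNneq a0 => y0; rewrite ay y0 expr0n.
have [g gp] := finField_prim_root 'F_p.
have {gp} gp : m.*2.-primitive_root g by move: gp; rewrite card_Fp // [in p.-1]half_odd_prime.
have [k ak] := prim_rootP gp (Fp_exp_half a0).
have ko : odd k.
  apply/negP => /negP ke; apply: nsq.
  have yp : (g ^+ k./2 < p)%N by rewrite -[X in (_ < X)%N](Fp_cast p_pr) ltn_ord.
  exists (Ordinal yp); rewrite -Fp_intr_eq rmorphXn /= -pmulrn natr_Zp ak -exprM.
  by rewrite muln2 even_halfK.
rewrite ak -exprM mulnC exprM.
have: (g ^+ m) ^+ 2 == 1 by rewrite -exprM muln2 (prim_expr_order gp).
rewrite sqrf_eq1 => /orP[]/eqP gm.
  have := prim_order_dvd gp m; rewrite gm eqxx => /(dvdn_leq half_odd_prime_gt0).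
  by move: half_odd_prime_gt0 => m0 le2m; exfalso; move: m0 le2m; clear; lia.
by rewrite gm -signr_odd ko expr1.
Qed.

Lemma odd_prime_gt2 : (2 < p)%N.
Proof. by rewrite half_odd_prime; move: half_odd_prime_gt0; lia. Qed.

(** Such integers differ by at most 2, which is less than p. This lifts identities between symbols
    from F_p to the integers. *)
Lemma Fp_intr_inj (x y : int) : `|x| <= 1 -> `|y| <= 1 ->
  x%:~R = y%:~R :> 'F_p -> x = y.
Proof.
move=> x1 y1 /eqP; rewrite Fp_intr_eq eqz_mod_dvd => /dvdzP[k e].
have := odd_prime_gt2; have [k0|k0] := eqVneq k 0; first by move: e; rewrite k0 mul0r; lia.
have kp : `|x - y| = `|k| * p%:Z by rewrite e normrM.
have k1 : 1 <= `|k| by rewrite -gtz0_ge1 normr_gt0.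
have : p%:Z <= `|x - y| by rewrite kp ler_peMl.
move=> h; have : p%:Z <= 2%:Z := le_trans h (le_trans (ler_normB x y) (lerD x1 y1)).
rewrite lez_nat leqNgt => /negP nlt /nlt[].
Qed.

Lemma legendre_le1 (a : int) : `|legendre a p| <= 1.
Proof. by rewrite /legendre; do 2?case: ifP. Qed.

Lemma legendreM (a b : int) : legendre (a * b) p = legendre a p * legendre b p.
Proof.
apply: Fp_intr_inj; rewrite ?legendre_le1 //.
  by rewrite normrM mulr_ile1 ?legendre_le1.
by rewrite intrM !legendre_euler intrM exprMn.
Qed.

Lemma legendre_mod (a b : int) : (a = b %[mod p])%Z -> legendre a p = legendre b p.
Proof.
move=> /eqP; rewrite -Fp_intr_eq => /eqP ab.
by apply: Fp_intr_inj; rewrite ?legendre_le1 // !legendre_euler ab.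
Qed.

Lemma legendre1 : legendre 1 p = 1.
Proof. by apply: Fp_intr_inj; rewrite ?legendre_le1 // legendre_euler expr1n. Qed.

Lemma legendreN1 : legendre (-1) p = (-1) ^+ m.
Proof.
apply: Fp_intr_inj; rewrite ?legendre_le1 ?normrX ?normrN1 ?expr1n //.
by rewrite legendre_euler rmorphXn.
Qed.

Lemma legendre_eq0 (a : int) : (legendre a p == 0) = (p %| a)%Z.
Proof. by rewrite /legendre; case: ifP => // _; case: ifP. Qed.

Lemma legendre_sqr (a : int) : legendre a p ^+ 2 = (coprime p `|a|%N)%:R.
Proof.
rewrite prime_coprime // -[(_ %| `|a|)%N]/((p %| a)%Z) -legendre_eq0.
by rewrite /legendre; do 2?case: ifP.
Qed.

Definition legendre_char (n : nat) : int := legendre n%:Z p.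

Lemma legendre_quad_char : quad_char p legendre_char.
Proof.
split; first exact: prime_gt0.
- exact: legendre1.
- by move=> a b; rewrite /legendre_char PoszM legendreM.
- by move=> n; apply: legendre_mod; rewrite -modz_nat modz_mod.
- by move=> n; rewrite legendre_sqr.
Qed.

Lemma legendre_nonresidue : exists a : nat, legendre_char a = -1.
Proof.
have [g gp] := finField_prim_root 'F_p.
have {}gp : m.*2.-primitive_root g by move: gp; rewrite card_Fp // [in p.-1]half_odd_prime.
have m0 := half_odd_prime_gt0.
exists g; apply: Fp_intr_inj; rewrite ?legendre_le1 ?normrN1 //.
rewrite legendre_euler -pmulrn natr_Zp rmorphN1.
have: (g ^+ m) ^+ 2 == 1 by rewrite -exprM muln2 (prim_expr_order gp).
rewrite sqrf_eq1 => /orP[]/eqP // gm.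
have := prim_order_dvd gp m; rewrite gm eqxx => /(dvdn_leq m0) le2m.
by exfalso; move: m0 le2m; clear; lia.
Qed.

(** Only p | h needs an argument beyond [gauss_unit]. There all powers of z are 1, and the sum of
    the character vanishes because multiplication by a nonresidue permutes the residues and changes
    the sign. *)
Lemma legendre_separable : separable_char p legendre_char.
Proof.
move=> F z zp h; have qc := legendre_quad_char.
have [|nco] := boolP (coprime p h); first exact: gauss_unit.
case: (qc) => p0 p1 pM pq _.
have /eqP -> : legendre_char h == 0 by rewrite (quad_char_eq0 _ qc).
have [a a1] := legendre_nonresidue.
have pa : coprime p a by rewrite -[coprime _ _]negbK -(quad_char_eq0 _ qc) a1.
rewrite mul0r /gauss.
under eq_bigr => j _.
  have /eqP -> : z ^+ (j * h) == 1.
    by rewrite -(prim_order_dvd zp) dvdn_mull //; move: nco; rewrite prime_coprime // negbK.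
  rewrite mulr1; over.
suff S0 : \sum_(j < p) legendre_char j = 0 by rewrite -rmorph_sum S0.
have : \sum_(j < p) legendre_char j = - \sum_(j < p) legendre_char j.
  rewrite -{1}(sum_mulmod (h := a)) // -sumrN; apply: eq_bigr => j _.
  by rewrite pM a1 mulN1r.
by lia.
Qed.

End Legendre.

Lemma quad_char_frobenius (D : int) (psi : nat -> int) (l : nat) :
  quad_char `|D|%N psi -> separable_char `|D|%N psi ->
  psi `|D|.-1%N * `|D|%N%:Z = D -> prime l -> odd l -> coprime `|D|%N l ->
  psi l = legendre D l.
Proof.
move=> qc sep sD pl lo co; case: (qc) => q0 _ _ pq psq.
have [F [z [Fl zq]]] := prim_root_in_char pl q0 (etrans (coprime_sym _ _) co).
have tau2 := gauss_sqr qc sep zq; rewrite sD in tau2.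
have D0 : D%:~R != 0 :> F.
  by rewrite -(dvdz_pcharf Fl) dvdzE /= -prime_coprime // coprime_sym.
have t0 : gauss psi `|D|%N z 1 != 0 by rewrite -sqrf_eq0 tau2.
have frob : gauss psi `|D|%N z 1 ^+ l = (psi l)%:~R * gauss psi `|D|%N z 1.
  rewrite -(sep _ _ zq) -(pFrobenius_autE Fl) /gauss rmorph_sum /=.
  apply: eq_bigr => j _; rewrite rmorphM rmorphXn /= rmorph_int.
  by rewrite pFrobenius_autE muln1 -exprM mulnC.
have Dl : D%:~R ^+ l./2 = (psi l)%:~R :> F.
  apply: (mulIf t0); rewrite -frob [in RHS](half_odd_prime lo) -tau2 -exprM.
  by rewrite mul2n -exprSr.
apply: (Fp_intr_inj pl lo); rewrite ?legendre_le1 //.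
  by rewrite -(@expr_le1 _ 2) // ?normr_ge0 // -normrX psq; case: coprime.
(* Both sides come from integers, and F has characteristic l, so the equality in F is a congruence
   modulo l. *)
apply/eqP; rewrite legendre_euler // -rmorphXn /= Fp_intr_eq // eqz_mod_dvd.
by rewrite (dvdz_pcharf Fl) rmorphB rmorphXn /= Dl subrr.
Qed.

(** * Fundamental discriminants *)

(** The last condition says psi(-1) = sgn D, so that the Gauss sum squares to D. *)
Definition disc_char (D : int) (psi : nat -> int) : Prop :=
  [/\ quad_char `|D|%N psi, separable_char `|D|%N psi
    & psi `|D|.-1%N * `|D|%N%:Z = D].

Lemma disc_charM D1 D2 psi1 psi2 : coprime `|D1|%N `|D2|%N ->
  disc_char D1 psi1 -> disc_char D2 psi2 ->
  disc_char (D1 * D2) (fun n => psi1 n * psi2 n).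
Proof.
move=> co [qc1 s1 e1] [qc2 s2 e2]; rewrite /disc_char abszM; split.
- exact: quad_charM.
- exact: separable_charM.
case: qc1 qc2 => [q10 _ _ pq1 _] [q20 _ _ pq2 _].
(* [(a * b).-1] is -1 modulo a and modulo b, so each factor of the product character takes its own
   value at -1 there. *)
have predM a b : (0 < a)%N -> (0 < b)%N -> ((a * b).-1 = a * b.-1 + a.-1)%N.
  by case: a b => [|a] [|b] // _ _; lia.
rewrite -[in RHS]e1 -[in RHS]e2 -[in LHS]pq1 -[X in _ * X * _]pq2 predM // mulnC modnMDl.
by rewrite mulnC -predM // mulnC predM // mulnC modnMDl pq1 pq2 PoszM; ring.
Qed.

(** The prime discriminant attached to an odd prime p: [p./2] is (p - 1)/2, and the sign makes the
    value congruent to 1 modulo 4. *)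
Definition pstar (p : nat) : int := (-1) ^+ p./2 * p%:Z.

Lemma absz_pstar p : `|pstar p|%N = p.
Proof. by rewrite /pstar abszMsign. Qed.

Lemma disc_char_legendre p : prime p -> odd p -> disc_char (pstar p) (legendre_char p).
Proof.
move=> pp po; rewrite /disc_char absz_pstar; split.
- exact: legendre_quad_char.
- exact: legendre_separable.
congr (_ * _); rewrite -legendreN1 //; apply: legendre_mod => //.
by apply/eqP; rewrite eqz_mod_dvd opprK -[1]/(1%:Z) -PoszD addn1 prednK ?prime_gt0.
Qed.

(** These three tables are the characters of the discriminants -4, 8 and -8. *)
Definition chi4 (n : nat) : int := nth 0 [:: 0; 1; 0; -1] (n %% 4).
Definition chi8 (n : nat) : int := nth 0 [:: 0; 1; 0; -1; 0; -1; 0; 1] (n %% 8).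
Definition chi8' (n : nat) : int := nth 0 [:: 0; 1; 0; 1; 0; -1; 0; -1] (n %% 8).

Lemma prim_root_half (F : fieldType) (q : nat) (z : F) :
  (0 < q)%N -> q.*2.-primitive_root z -> z ^+ q = -1.
Proof.
move=> q0 zq; have: (z ^+ q) ^+ 2 == 1 by rewrite -exprM muln2 (prim_expr_order zq).
rewrite sqrf_eq1 => /orP[|/eqP//].
rewrite -(prim_order_dvd zq) => /(dvdn_leq q0); rewrite -addnn -[X in (_ <= X)%N]addn0.
by rewrite leq_add2l leqNgt q0.
Qed.

Lemma gauss_mod q psi (F : fieldType) (z : F) h : q.-primitive_root z ->
  gauss psi q z (h %% q) = gauss psi q z h.
Proof.
move=> zq; apply: eq_bigr => j _; congr (_ * _).
by rewrite -(prim_expr_mod zq) modnMmr (prim_expr_mod zq).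
Qed.

(** Separability is checked for each residue of h: the relation z^(q/2) = -1 alone reduces both
    sides to the same polynomial in z. The moduli 8 below are treated in the same way. *)
Lemma disc_char_chi4 : disc_char (- 4) chi4.
Proof.
rewrite /disc_char; split => //.
  split=> //.
  - move=> a b; rewrite /chi4 -modnMm.
    have: (a %% 4 < 4)%N by rewrite ltn_pmod.
    have: (b %% 4 < 4)%N by rewrite ltn_pmod.
    by case: (a %% 4)%N => [|[|[|[|]]]] //; case: (b %% 4)%N => [|[|[|[|]]]].
  - by move=> n; rewrite /chi4 modn_mod.
  - move=> n; rewrite /chi4 -coprime_modr.
    have: (n %% 4 < 4)%N by rewrite ltn_pmod.
    by case: (n %% 4)%N => [|[|[|[|]]]].
move=> F z zq h; have z2 : z ^+ 2 = -1 by exact: (@prim_root_half _ 2).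
rewrite -gauss_mod // /chi4 -[(h %% 4)%N]modn_mod -/(chi4 (h %% 4)) .
have: (h %% 4 < 4)%N by rewrite ltn_pmod.
rewrite /gauss !big_ord_recl !big_ord0 /chi4 /bump /=.
by case: (h %% 4)%N => [|[|[|[|]]]] //= _; ring: z2.
Qed.

Lemma disc_char_chi8 : disc_char 8 chi8.
Proof.
rewrite /disc_char; split => //.
  split=> //.
  - move=> a b; rewrite /chi8 -modnMm.
    have: (a %% 8 < 8)%N by rewrite ltn_pmod.
    have: (b %% 8 < 8)%N by rewrite ltn_pmod.
    by case: (a %% 8)%N => [|[|[|[|[|[|[|[|]]]]]]]] //;
      case: (b %% 8)%N => [|[|[|[|[|[|[|[|]]]]]]]].
  - by move=> n; rewrite /chi8 modn_mod.
  - move=> n; rewrite /chi8 -coprime_modr.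
    have: (n %% 8 < 8)%N by rewrite ltn_pmod.
    by case: (n %% 8)%N => [|[|[|[|[|[|[|[|]]]]]]]].
move=> F z zq h; have z4 : z ^+ 4 = -1 by exact: (@prim_root_half _ 4).
rewrite -gauss_mod // /chi8 -[(h %% 8)%N]modn_mod -/(chi8 (h %% 8)) .
have: (h %% 8 < 8)%N by rewrite ltn_pmod.
rewrite /gauss !big_ord_recl !big_ord0 /chi8 /bump /=.
by case: (h %% 8)%N => [|[|[|[|[|[|[|[|]]]]]]]] //= _; ring: z4.
Qed.

Lemma disc_char_chi8' : disc_char (- 8) chi8'.
Proof.
rewrite /disc_char; split => //.
  split=> //.
  - move=> a b; rewrite /chi8' -modnMm.
    have: (a %% 8 < 8)%N by rewrite ltn_pmod.
    have: (b %% 8 < 8)%N by rewrite ltn_pmod.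
    by case: (a %% 8)%N => [|[|[|[|[|[|[|[|]]]]]]]] //;
      case: (b %% 8)%N => [|[|[|[|[|[|[|[|]]]]]]]].
  - by move=> n; rewrite /chi8' modn_mod.
  - move=> n; rewrite /chi8' -coprime_modr.
    have: (n %% 8 < 8)%N by rewrite ltn_pmod.
    by case: (n %% 8)%N => [|[|[|[|[|[|[|[|]]]]]]]].
move=> F z zq h; have z4 : z ^+ 4 = -1 by exact: (@prim_root_half _ 4).
rewrite -gauss_mod // /chi8' -[(h %% 8)%N]modn_mod -/(chi8' (h %% 8)) .
have: (h %% 8 < 8)%N by rewrite ltn_pmod.
rewrite /gauss !big_ord_recl !big_ord0 /chi8' /bump /=.
by case: (h %% 8)%N => [|[|[|[|[|[|[|[|]]]]]]]] //= _; ring: z4.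
Qed.

Definition disc (e : int) (s : seq nat) : int := e * \prod_(p <- s) pstar p.
Definition disc_psi (f : nat -> int) (s : seq nat) (n : nat) : int :=
  f n * \prod_(p <- s) legendre_char p n.

Definition odd_primes (s : seq nat) : bool :=
  uniq s && all (fun p => prime p && odd p) s.

Lemma disc_cons e p s : disc e (p :: s) = pstar p * disc e s.
Proof. by rewrite /disc big_cons mulrCA. Qed.

Lemma disc_psi_cons f p s : disc_psi f (p :: s) =1 (fun n => legendre_char p n * disc_psi f s n).
Proof. by move=> n; rewrite /disc_psi big_cons mulrCA. Qed.

Lemma absz_disc e s : `|disc e s|%N = (`|e| * \prod_(p <- s) p)%N.
Proof.
rewrite /disc abszM; congr (_ * _)%N; elim: s => [|p s IHs]; first by rewrite !big_nil.
by rewrite !big_cons abszM absz_pstar IHs.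
Qed.

(** The possible 2-parts e of a fundamental discriminant, with their characters f. *)
Definition even_part (e : int) (f : nat -> int) : Prop :=
  [\/ e = 1 /\ f = (fun=> 1), e = - 4 /\ f = chi4, e = 8 /\ f = chi8 | e = - 8 /\ f = chi8'].

Lemma disc_char_even_part e f : even_part e f -> disc_char e f.
Proof.
case=> -[-> ->]; [| exact: disc_char_chi4 | exact: disc_char_chi8 | exact: disc_char_chi8'].
split=> //; first by split=> // n; rewrite ?expr1n coprime1n.
move=> F z z1 h; have /eqP := prim_expr_order z1; rewrite expr1 => /eqP ->.
by rewrite /gauss !big_ord_recl !big_ord0 !expr1n; ring.
Qed.

Lemma coprime_odd_prime e f p s : even_part e f -> odd_primes (p :: s) ->
  coprime p `|disc e s|%N.
Proof.
move=> ef /andP[/andP[ps us] /andP[/andP[pp po] als]].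
rewrite absz_disc coprimeMr; apply/andP; split.
  have p2 : coprime p 2 by rewrite coprimen2.
  by case: ef => -[-> _]; rewrite ?coprimen1 ?(coprimeXr 2 p2) ?(coprimeXr 3 p2).
rewrite big_seq; elim/big_ind: _ => [|a b ha hb|q qs]; first exact: coprimen1.
  by rewrite coprimeMr ha.
have /andP[qp qo] := allP als _ qs.
by rewrite prime_coprime // dvdn_prime2 //; apply: contraNneq ps => ->.
Qed.

Lemma disc_char_ext D psi phi : psi =1 phi -> disc_char D psi -> disc_char D phi.
Proof.
by move=> e; rewrite (_ : psi = phi) //; apply/boolp.funext.
Qed.

Lemma disc_char_disc e f s : even_part e f -> odd_primes s ->
  disc_char (disc e s) (disc_psi f s).
Proof.
move=> ef; elim: s => [|p s IHs] os.
  rewrite /disc big_nil mulr1; apply: disc_char_ext (disc_char_even_part ef).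
  by move=> n; rewrite /disc_psi big_nil mulr1.
have co := coprime_odd_prime ef os.
case/andP: os => /andP[ps us] /andP[/andP[pp po] als].
rewrite disc_cons; apply: disc_char_ext (fsym (disc_psi_cons f p s)) _.
apply: disc_charM; rewrite ?absz_pstar //; first exact: disc_char_legendre.
by apply: IHs; apply/andP.
Qed.

Lemma pstar_mod4 p : odd p -> (pstar p = 1 %[mod 4])%Z.
Proof.
move=> po; rewrite /pstar -signr_odd.
have := odd_double_half p; rewrite po.
have := odd_double_half p./2; case: odd => /= e1 e2; rewrite ?expr0 ?expr1; lia.
Qed.

Lemma prod_pstar_mod4 s : odd_primes s -> (\prod_(p <- s) pstar p = 1 %[mod 4])%Z.
Proof.
case/andP=> _; elim: s => [|p s IHs]; first by rewrite big_nil.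
rewrite big_cons /= => /andP[/andP[_ po] als].
by rewrite -modzMm (pstar_mod4 po) (IHs als).
Qed.

Lemma squarefree_prod_primes n : squarefree n -> \prod_(p <- primes n) p = n.
Proof.
case/andP => n0 /allP sq.
rewrite [RHS](prod_prime_decomp n0) prime_decompE big_map /=.
rewrite !big_seq; apply: eq_bigr => p pn; rewrite (_ : logn p n = 1%N) ?expn1 //.
apply/eqP; rewrite eqn_leq logn_gt0 pn andbT leqNgt.
have := sq _ pn; rewrite pfactor_dvdn //; last by move: pn; rewrite mem_primes => /and3P[].
Qed.

Lemma odd_primes_primes n : odd n -> odd_primes (primes n).
Proof.
move=> no; rewrite /odd_primes primes_uniq; apply/allP => p.
rewrite mem_primes => /and3P[pp _ pn]; rewrite pp /=.
by apply: dvdn_odd no.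
Qed.

(** The product has absolute value |k| and is 1 modulo 4, which decides between k and -k. *)
Lemma prod_pstar_primes k : odd `|k|%N -> squarefree `|k|%N ->
  \prod_(p <- primes `|k|%N) pstar p = if (k == 1 %[mod 4])%Z then k else - k.
Proof.
move=> ko sq; set P := \prod_(p <- _) _.
have P4 : (P = 1 %[mod 4])%Z by apply/prod_pstar_mod4/odd_primes_primes.
have : `|P|%N = `|k|%N.
  by have := absz_disc 1 (primes `|k|%N); rewrite /disc mul1r mul1n squarefree_prod_primes.
clearbody P; move: ko P4; case: ifP; lia.
Qed.

Lemma fundamental_disc D : fundamental_discriminant D ->
  exists e f s, [/\ even_part e f, odd_primes s & D = disc e s].
Proof.
case/orP => [/andP[D1 sq]|/and3P[D4 D2 sq]].
  have Do : odd `|D|%N by move: D1; clear; lia.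
  exists 1, (fun=> 1), (primes `|D|%N); split; first by constructor 1.
    exact: odd_primes_primes.
  by rewrite /disc prod_pstar_primes // D1 mul1r.
have [k Dk] : exists k : int, D = k * 4 by apply/dvdzP.
move: D2 sq; rewrite Dk mulzK // => /orP[] k4 sq; last first.
  have ko : odd `|k|%N by move: k4; clear; lia.
  (* Here k is 3 modulo 4, so the product of prime discriminants is -k, and the 2-part -4 restores
     the sign. The choice between 8 and -8 below has the same origin. *)
  exists (-4), chi4, (primes `|k|%N); split; first by constructor 2.
    exact: odd_primes_primes.
  by rewrite /disc prod_pstar_primes //; case: ifP; move: k4; clear; lia.
have [j kj] : exists j : int, k = j * 2 by apply/dvdzP; move: k4; clear; lia.
have jo : odd `|j|%N by move: k4; rewrite kj; clear; lia.
have sqj : squarefree `|j|%N.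
  move: sq; rewrite kj abszM /squarefree muln_gt0 => /andP[/andP[j0 _] /allP sq].
  rewrite j0; apply/allP => p pj; have := sq p; rewrite primesM // pj.
  by move=> /(_ isT); apply: contra; apply: dvdn_mulr.
have [j1|j1] := boolP (j == 1 %[mod 4])%Z.
  exists 8, chi8, (primes `|j|%N); split; first by constructor 3.
    exact: odd_primes_primes.
  by rewrite /disc prod_pstar_primes // j1 kj; ring.
exists (-8), chi8', (primes `|j|%N); split; first by constructor 4.
  exact: odd_primes_primes.
by rewrite /disc prod_pstar_primes // (negPf j1) kj; ring.
Qed.

(** Frobenius applied to the character of discriminant 8 gives chi8(p) = (8/p) = (2/p)^3 = (2/p). *)
Lemma legendre2 p : prime p -> odd p -> legendre 2 p = chi8 p.
Proof.
move=> pp po; have [qc sep e] := disc_char_chi8.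
rewrite (quad_char_frobenius qc sep e) //; last exact: (coprimeXl 3 (etrans (coprime2n p) po)).
rewrite (_ : 8 = 2 * (2 * 2)) // !legendreM // -expr2 legendre_sqr // /=.
by rewrite coprimen2 po mulr1.
Qed.

(** For n > 0 both sides are multiplicative, which leaves the primes. Those dividing D give 0, the
    other odd ones are settled by Frobenius, and 2 by the second supplementary law. *)
Lemma kronecker_disc e f s n : even_part e f -> odd_primes s -> disc e s != 1 ->
  kronecker (disc e s) n%:Z = disc_psi f s n.
Proof.
move=> ef os D1; have dc := disc_char_disc ef os.
case: (dc) => qc sep eD; set D := disc e s in D1 dc qc sep eD *.
case: (qc) => q0 p1 pM pq psq.
have psi_dvd p : prime p -> (p %| `|D|)%N -> disc_psi f s p = 0.
  move=> pp pD; apply/eqP; rewrite (quad_char_eq0 _ qc) coprime_sym.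
  by rewrite prime_coprime // pD.
rewrite /kronecker; case: eqP => [[->]|/eqP n0].
  (* If |D| = 1, then psi(0) = psi(1) = 1, and the sign condition psi(-1) |D| = D forces D = 1. *)
  have D1' : (1 < `|D|)%N.
    rewrite ltn_neqAle q0 andbT; apply: contra D1 => /eqP D1.
    have p0 : disc_psi f s 0 = 1 by rewrite -p1 -(pq 1%N) -D1 modn1.
    by rewrite -eD -D1 /= p0.
  have -> : disc_psi f s 0 = 0 by apply/eqP; rewrite (quad_char_eq0 _ qc) /coprime gcdn0 gtn_eqF.
  by rewrite gtn_eqF.
have {n0} : (0 < n)%N by rewrite lt0n.
rewrite /= mul1r => n0.
rewrite [in RHS](prod_prime_decomp n0) prime_decompE big_map /=.
rewrite (big_morph _ pM p1) !big_seq; apply: eq_bigr => p.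
rewrite mem_primes => /and3P[pp _ _].
have psiX k : disc_psi f s (p ^ k) = disc_psi f s p ^+ k.
  by elim: k => [|k IHk]; rewrite ?p1 // expnS pM IHk exprS.
rewrite psiX; congr (_ ^+ _); rewrite /kronecker_prime.
have [p2|pn2] := eqVneq p 2%N; last first.
  have po : odd p by case: (even_prime pp) pn2 => [->|].
  have [pD|pD] := boolP (p %| `|D|)%N; first by rewrite psi_dvd // /legendre dvdzE pD.
  by rewrite -(quad_char_frobenius qc sep eD) // coprime_sym prime_coprime.
case: ifP => D2; first by rewrite psi_dvd // p2 -(dvdzE 2).
have e1 : e = 1 /\ f = (fun=> 1).
  move: D2; rewrite /D dvdzE absz_disc.
  by case: ef => -[] // -> _; rewrite dvdn_mulr.
rewrite p2 /disc_psi; case: e1 => e1 ->; rewrite mul1r.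
(* Each (2/q) is [chi8 q], so the product is [chi8] of |D|. Since [chi8] is even, this agrees with
   the test whether D is 1 or 7 modulo 8. *)
rewrite /legendre_char (eq_big_seq chi8); last first.
  by move=> q qs; case/andP: os => _ /allP/(_ _ qs)/andP[qp qo]; rewrite legendre2.
have [[_ c1 cM _ _] _ _] := disc_char_chi8.
have -> : \prod_(q <- s) chi8 q = chi8 `|D|%N.
  by rewrite /D absz_disc e1 mul1n (big_morph _ cM c1).
rewrite /chi8; move: D2; clear.
have : (`|D| %% 8 < 8)%N by rewrite ltn_pmod.
case E: (`|D| %% 8)%N => [|[|[|[|[|[|[|[|]]]]]]]] //= _ D2; case: ifP; try lia.
Qed.

(** * The sign of the Gauss sum *)

Section PrimeGaussSum.
Variable p : nat.
Hypotheses (p_pr : prime p) (p_odd : odd p).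
Let m := p./2.
Let pm : p = m.*2.+1 := half_odd_prime p_odd.

Definition gauss_poly : {poly int} := \sum_(j < p) legendre_char p j *: 'X^j.
(** At exp(2 i pi / p) the factor of index k is (-1)^k.+1 * 2i * sin(pi k.+1 / p). *)
Definition sine_poly : {poly int} :=
  \prod_(k < m) ('X^(m * k.+1) * ('X^(k.+1) - 1)).

(** The quotient of X^p - 1 by X - 1 has two forms, the product over the nontrivial powers of z and
    the geometric sum; both are evaluated at 1. *)
Lemma prod_sub_prim_root (F : fieldType) (z : F) : p.-primitive_root z ->
  \prod_(1 <= k < p) (1 - z ^+ k) = p%:R.
Proof.
move=> zp; have X1 : 'X - 1%:P != 0 :> {poly F} by rewrite polyXsubC_eq0.
have := factor_Xn_sub_1 zp; rewrite big_ltn ?prime_gt0 // expr0 polyC1 subrX1 -polyC1.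
move/(mulfI X1)/(congr1 (horner^~ 1)); rewrite horner_prod horner_sum.
under eq_bigr do rewrite hornerXsubC; move=> ->.
under eq_bigr do rewrite hornerXn expr1n.
by rewrite sumr_const card_ord.
Qed.

(** Since 2m = p - 1, the square of z^(mk) is z^(-k). The squared factor of index k is therefore -(1
    - z^k)(1 - z^(-k)), and k = 1, ..., m together with p - k exhausts the nontrivial powers, whose
    product is p. *)
Lemma sine_prod_sqr (F : fieldType) (z : F) : p.-primitive_root z ->
  (\prod_(k < m) (z ^+ (m * k.+1) * (z ^+ k.+1 - 1))) ^+ 2 = (pstar p)%:~R.
Proof.
move=> zp; rewrite /pstar rmorphM rmorphXn /= rmorphN1 -/m -pmulrn.
have -> : p%:R = \prod_(k < m) (1 - z ^+ k.+1) * \prod_(k < m) (1 - z ^+ (p - k.+1)).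
  rewrite -(prod_sub_prim_root zp).
  rewrite (@big_cat_nat _ _ _ m.+1) //=; last by rewrite pm; lia.
  rewrite [in X in _ * X](@big_nat_rev _ _ _ m.+1 p) /= -(big_mkord xpredT (fun k => 1 - z ^+ k.+1)).
  rewrite -(big_mkord xpredT (fun k => 1 - z ^+ (p - k.+1))) big_add1 /=; congr (_ * _).
  rewrite -{1}[m.+1]add0n big_addn (_ : p - m.+1 = m)%N; last by rewrite [in LHS]pm; lia.
  apply: eq_big_nat => k km; congr (1 - z ^+ _).
  by move: km pm; move: m => mm; lia.
have -> : (-1) ^+ m = \prod_(k < m) (-1 : F) by rewrite prodr_const card_ord.
rewrite -!big_split /= -prodrXl; apply: eq_bigr => k _.
have kp : (k.+1 <= p)%N by rewrite pm; move: (ltn_ord k); lia.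
set w := z ^+ k.+1; set w' := z ^+ (p - k.+1).
have ww' : w * w' = 1 by rewrite -exprD subnKC // (prim_expr_order zp).
have -> : (z ^+ (m * k.+1) * (w - 1)) ^+ 2 = w' * (w - 1) ^+ 2.
  rewrite exprMn; congr (_ * _); apply: (@mulfI _ w).
    by rewrite expf_neq0 // (prim_root_eq0 zp) -lt0n prime_gt0.
  rewrite ww' -exprM -exprD (_ : k.+1 + _ = p * k.+1)%N.
    by rewrite exprM (prim_expr_order zp) expr1n.
  by rewrite [in RHS]pm; lia.
by ring: ww'.
Qed.

Lemma Cyclotomic_prime : 'Phi_p * ('X - 1) = 'X^p - 1.
Proof.
have p1 : 'Phi_1 = 'X - 1 by rewrite -['X]expr1 -prod_Cyclotomic // big_seq1.
rewrite -p1 -prod_Cyclotomic ?prime_gt0 // (perm_big [:: p; 1%N]) /=.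
  by rewrite big_cons big_seq1.
apply: uniq_perm; rewrite ?divisors_uniq //=.
  by rewrite inE gtn_eqF ?prime_gt1.
move=> d; rewrite -dvdn_divisors ?prime_gt0 // !inE orbC.
by apply/idP/idP => [|/orP[]/eqP->]; [case/primeP: p_pr => _ | exact: dvd1n | exact: dvdnn]; apply.
Qed.

Lemma root_Cyclotomic_prime (F : fieldType) (z : F) : p.-primitive_root z ->
  (map_poly intr 'Phi_p : {poly F}).[z] = 0.
Proof.
move=> zp; have z1 : z - 1 != 0.
  by rewrite subr_eq0 -[z]expr1 -(prim_order_dvd zp) dvdn1 gtn_eqF ?prime_gt1.
apply: (mulIf z1); rewrite mul0r.
have /(congr1 (fun f : {poly int} => (map_poly intr f : {poly F}).[z])) := Cyclotomic_prime.
rewrite /= !rmorphM !rmorphB /= !rmorph1 map_polyXn map_polyX hornerM !hornerE.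
by rewrite (prim_expr_order zp) subrr.
Qed.

Lemma horner_gauss_poly (F : fieldType) (z : F) :
  (map_poly intr gauss_poly).[z] = gauss (legendre_char p) p z 1.
Proof.
rewrite rmorph_sum horner_sum; apply: eq_bigr => j _ /=.
by rewrite map_polyZ map_polyXn !hornerE ?muln1.
Qed.

Lemma horner_sine_poly (F : fieldType) (z : F) :
  (map_poly intr sine_poly).[z] = \prod_(k < m) (z ^+ (m * k.+1) * (z ^+ k.+1 - 1)).
Proof.
rewrite rmorph_prod horner_prod; apply: eq_bigr => j _ /=.
by rewrite rmorphM rmorphB /= rmorph1 !map_polyXn !hornerE.
Qed.

(** At a complex primitive root the two polynomials have the same square [pstar p], hence agree up
    to a sign e. Since Phi_p is the minimal polynomial of that root and is monic, the agreement
    becomes a divisibility over the integers, which can be reduced modulo p. *)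
Lemma sine_poly_Cyclotomic : exists (e : int) (h : {poly int}),
  `|e| = 1 /\ gauss_poly - e *: sine_poly = 'Phi_p * h.
Proof.
have [z zp] := C_prim_root_exists (prime_gt0 p_pr).
have [qc sep dD] := disc_char_legendre p_pr p_odd.
have := gauss_sqr qc sep; rewrite absz_pstar => /(_ _ z zp).
rewrite absz_pstar in dD; rewrite dD -(sine_prod_sqr zp).
rewrite -horner_gauss_poly -horner_sine_poly => /eqP; rewrite eqf_sqr => gs.
have [e [e1 ge]] : exists e : int, `|e| = 1 /\
   (map_poly intr (gauss_poly - e *: sine_poly)).[z] = 0 :> algC.
  case/orP: gs => /eqP gs; [exists 1 | exists (-1)]; split => //.
    by rewrite scale1r rmorphB /= hornerD hornerN gs subrr.
  by rewrite scaleN1r opprK rmorphD /= hornerD gs addNr.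
exists e; set f := _ - _ in ge *.
suff /dvdpP_int[h fh] : 'Phi_p %| f.
  by exists h; split => //; rewrite fh zprimitive_monic ?Cyclotomic_monic.
rewrite -dvdp_rat_int; have [q [qz _] qP] := minCpolyP z.
have QtoC (g : {poly int}) : map_poly ratr (map_poly intr g : {poly rat}) = map_poly intr g :> {poly algC}.
  by rewrite -map_poly_comp; apply: eq_map_poly => x /=; rewrite ratr_int.
rewrite (_ : map_poly intr 'Phi_p = q); first by rewrite -qP QtoC; apply/rootP.
apply: (map_poly_inj (ratr : {rmorphism rat -> algC})) => /=.
by rewrite QtoC -qz (minCpoly_cyclotomic zp) -(Cintr_Cyclotomic zp).
Qed.

(** X^j is an eigenvector with eigenvalue j. Hence m iterations multiply its coefficient by j^m,
    which modulo p is the Legendre symbol by Euler's criterion. *)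
Definition euler_op (R : nzRingType) (f : {poly R}) : {poly R} := 'X * f^`().

(** Each application lowers the order of vanishing at 1 by one and multiplies the leading
    coefficient there by the current order, whence the falling factorial. *)
Lemma euler_op_Xsub1 (R : comNzRingType) n i : (i <= n)%N ->
  exists h : {poly R}, iter i (@euler_op R) (('X - 1) ^+ n) = ('X - 1) ^+ (n - i) * h /\
    h.[1] = (n ^_ i)%:R.
Proof.
elim: i => [|i IHi] ni.
  by exists 1; rewrite subn0 mulr1 ffactn0 hornerC.
have [h [eh h1]] := IHi (ltnW ni).
pose k := (n - i.+1)%N; have nik : (n - i = k.+1)%N by rewrite /k; lia.
exists ('X * (h *+ k.+1 + ('X - 1) * h^`())); split.
  rewrite iterS eh nik /euler_op derivM deriv_exp derivB derivX -polyC1 derivC subr0 mul1r /= polyC1.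
  rewrite exprS -[_ ^+ k *+ _]mulr_natr -[h *+ _]mulr_natr -/k.
  move: {-}('X : {poly R}) ('X - 1) (h^`()) (k.+1%:R) => x y h' c.
  by move: (y ^+ k) => z; ring.
by rewrite -polyC1 hornerM hornerX mul1r hornerD hornerMn h1 hornerM hornerXsubC subrr
  mul0r addr0 ffactnSr nik natrM mulr_natr.
Qed.

Lemma euler_op_sum (R : comNzRingType) n i :
  iter i (@euler_op R) (\sum_(j < n) 'X^j) = \sum_(j < n) (j%:R ^+ i) *: 'X^j.
Proof.
elim: i => [|i IHi]; first by apply: eq_bigr => j _; rewrite expr0 scale1r.
rewrite iterS IHi /euler_op linear_sum mulr_sumr; apply: eq_bigr => -[[|j] _] _ /=.
  by rewrite derivZ expr0 derivC scaler0 mulr0 exprS mul0r scale0r.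
by rewrite derivZ derivXn -scalerAr mulrnAr -exprS /= -scaler_nat scalerA -exprSr.
Qed.

(** Modulo p, Phi_p is (X - 1)^(2m), and gauss_poly is (X d/dX)^m applied to it;
    so both polynomials vanish to order exactly m at 1, and their leading
    coefficients there, m! * (-1)^m and m!, determine the sign. *)
Lemma gauss_poly_sign (e : int) (h : {poly int}) : `|e| = 1 ->
  gauss_poly - e *: sine_poly = 'Phi_p * h -> e = (-1) ^+ m.
Proof.
move=> e1 /(congr1 (map_poly (intr : int -> 'F_p))).
have m0 : (0 < m)%N by exact: half_odd_prime_gt0.
pose X1 : {poly 'F_p} := 'X - 1.
have X10 : X1 != 0 by rewrite /X1 -polyC1 polyXsubC_eq0.
have Xp : 'X^p - 1 = X1 ^+ p.
  have cp : p \in [pchar {poly 'F_p}] by rewrite pchar_poly pchar_Fp.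
  by rewrite /X1 -[RHS](pFrobenius_autE cp) rmorphB rmorph1 /= pFrobenius_autE.
have Phi : map_poly intr 'Phi_p = X1 ^+ m.*2.
  have /(congr1 (map_poly (intr : int -> 'F_p))) := Cyclotomic_prime.
  rewrite rmorphM !rmorphB /= !rmorph1 map_polyX map_polyXn => e'.
  by apply: (mulIf X10); rewrite -exprSr -pm -Xp -e'.
have S : \sum_(j < p) 'X^j = X1 ^+ m.*2.
  by apply: (mulfI X10); rewrite -subrX1 Xp -exprS -pm.
have G : map_poly intr gauss_poly = iter m (@euler_op 'F_p) (X1 ^+ m.*2).
  rewrite -S euler_op_sum rmorph_sum; apply: eq_bigr => j _ /=.
  by rewrite map_polyZ map_polyXn /= legendre_euler // -pmulrn.
have [|H [GH H1]] := @euler_op_Xsub1 'F_p m.*2 m; first by rewrite -addnn leq_addr.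
rewrite -addnn addnK in GH.
pose K : {poly 'F_p} := \prod_(k < m) ('X^(m * k.+1) * \sum_(i < k.+1) 'X^i).
have P : map_poly intr sine_poly = X1 ^+ m * K.
  rewrite -[X in X1 ^+ X](card_ord m) -prodr_const -big_split rmorph_prod.
  apply: eq_bigr => j _ /=; rewrite rmorphM rmorphB /= rmorph1 !map_polyXn subrX1.
  by rewrite mulrCA.
have K1 : K.[1] = (m`!)%:R.
  rewrite horner_prod fact_prod big_add1 /= big_mkord natr_prod; apply: eq_bigr => j _.
  rewrite hornerM horner_sum hornerXn expr1n mul1r.
  by under eq_bigr do rewrite hornerXn expr1n; rewrite sumr_const card_ord.
rewrite rmorphB rmorphM /= map_polyZ /= G P Phi -addnn GH exprD -mulrA scalerAr -mulrBr.
move/(mulfI (expf_neq0 m X10))/(congr1 (horner^~ 1)).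
rewrite hornerD hornerN hornerZ H1 K1 hornerM horner_exp !hornerE subrr expr0n gtn_eqF // mul0r.
move/eqP; rewrite subr_eq0 => /eqP.
(* The factor 2m - j equals p - (j + 1), that is -(j + 1) modulo p. *)
have -> : (m.*2 ^_ m)%:R = (-1) ^+ m * (m`!)%:R :> 'F_p.
  rewrite ffact_prod fact_prod big_add1 /= big_mkord !natr_prod.
  rewrite -[X in (-1) ^+ X](card_ord m) -prodr_const -big_split; apply: eq_bigr => j _ /=.
  have jm : (j < m.*2)%N by rewrite -addnn (leq_trans (ltn_ord j)) ?leq_addr.
  apply/eqP; rewrite mulN1r -subr_eq0 opprK -natrD -(dvdn_pcharf (pchar_Fp p_pr)).
  by rewrite addnS subnK -?pm // ltnW.
have f0 : (m`!)%:R != 0 :> 'F_p.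
  rewrite fact_prod natr_prod prodf_seq_neq0; apply/allP => i /=.
  rewrite mem_index_iota -(dvdn_pcharf (pchar_Fp p_pr)) => /andP[i0 im].
  by rewrite gtnNdvd // (leq_trans im) // [in leqRHS]pm ltnS -addnn leq_addr.
move/(mulIf f0) => em; apply: (Fp_intr_inj p_pr p_odd).
- by rewrite e1.
- by rewrite normrX normrN1 expr1n.
- by rewrite -em rmorphXn /= rmorphN1.
Qed.

(** A congruence modulo Phi_p between integer polynomials may be evaluated at a primitive p-th root
    of unity in any field. *)
Lemma gauss_legendre_prod (F : fieldType) (z : F) : p.-primitive_root z ->
  gauss (legendre_char p) p z 1 =
    (-1) ^+ m * \prod_(k < m) (z ^+ (m * k.+1) * (z ^+ k.+1 - 1)).
Proof.
move=> zp; have [e [h [e1 eh]]] := sine_poly_Cyclotomic.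
rewrite -horner_gauss_poly -horner_sine_poly.
have := congr1 (fun f : {poly int} => (map_poly intr f : {poly F}).[z]) eh.
rewrite /= rmorphB rmorphM /= map_polyZ hornerD hornerN hornerZ hornerM.
rewrite root_Cyclotomic_prime // mul0r => /eqP; rewrite subr_eq0 => /eqP ->.
by rewrite (gauss_poly_sign e1 eh) rmorphXn /= rmorphN1.
Qed.

End PrimeGaussSum.

(** * The exact value of the complex Gauss sum *)

Section ComplexGauss.
Context {R : realType}.

Definition expi (t : R) : R[i] := Complex (cos t) (sin t).

Lemma expiD s t : expi (s + t) = expi s * expi t.
Proof. by rewrite /expi cosD sinD; congr Complex; ring. Qed.

Lemma expi0 : expi 0 = 1.
Proof. by rewrite /expi cos0 sin0. Qed.

Lemma expiX t n : expi t ^+ n = expi (t *+ n).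
Proof.
by elim: n => [|n IHn]; rewrite ?mulr0n ?expi0 // exprS IHn -expiD mulrS.
Qed.

Definition zeta (q : nat) : R[i] := expi (pi *+ 2 / q%:R).

Lemma zetaX q k : zeta q ^+ k = expi (pi *+ 2 * k%:R / q%:R).
Proof. by rewrite /zeta expiX -[in LHS](mulr_natr _ k) mulrAC. Qed.

Lemma zeta_prim q : (0 < q)%N -> q.-primitive_root (zeta q).
Proof.
move=> q0; have q0' : q%:R != 0 :> R by rewrite pnatr_eq0 -lt0n.
rewrite /primitive_root_of_unity q0; apply/forallP => -[i iq] /=.
rewrite unity_rootE; apply/eqP; have [->|nq] := eqVneq i.+1 q.
  by rewrite zetaX mulfK // /expi cos2pi sin2pi eqxx.
rewrite zetaX; apply/eqP => -[] c1 _.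
have iq' : (i.+1 < q)%N by rewrite ltn_neqAle nq.
(* With t half the angle, cos(2t) = 1 would give sin t = 0, which 0 < t < pi excludes. *)
have : 0 < sin (pi * i.+1%:R / q%:R : R).
  apply: sin_gt0_pi; rewrite divr_gt0 ?mulr_gt0 ?pi_gt0 ?ltr0n //=.
  by rewrite ltr_pdivrMr ?ltr0n // ltr_pM2l ?pi_gt0 // ltr_nat.
move: c1; rewrite !mulrnAl cos_mulr2n cos2sin2 => c1.
by apply/negP; rewrite -leNgt le_eqVlt -sqrf_eq0; apply/orP; left; apply/eqP; lra.
Qed.

Definition root_disc (D : int) : R[i] :=
  if 0 <= D then (Num.sqrt D%:~R)%:C%C else 'i%C * (Num.sqrt (- D)%:~R)%:C%C.

(** The sign is i * i = -1, present exactly when both discriminants are negative; in [gauss_disc]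
    quadratic reciprocity supplies the same sign. *)
Lemma root_discM (D1 D2 : int) : D1 != 0 -> D2 != 0 ->
  root_disc (D1 * D2) = (if (D1 < 0) && (D2 < 0) then -1 else 1) *
     (root_disc D1 * root_disc D2).
Proof.
move=> D10 D20; have ii : ('i%C : R[i]) * 'i%C = -1 by rewrite -expr2 sqr_i.
have sM (a b : int) : 0 <= a ->
    (Num.sqrt (a * b)%:~R)%:C%C = (Num.sqrt a%:~R)%:C%C * (Num.sqrt b%:~R)%:C%C :> R[i].
  by move=> a0; rewrite intrM sqrtrM ?ler0z // rmorphM.
rewrite /root_disc; have [p1|n1] := ltP D1 0; have [p2|n2] := ltP D2 0; rewrite ?(lt_geF p1) ?(lt_geF p2) ?n1 ?n2 /=.
- by rewrite mulr_le0 ?(ltW p1) ?(ltW p2) // -mulrNN sM ?oppr_ge0 ?(ltW p1) //; ring: ii.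
- have h : D1 * D2 < 0 by rewrite nmulr_rlt0 // lt_neqAle eq_sym D20.
  by rewrite (lt_geF h) -mulNr sM ?oppr_ge0 ?(ltW p1) //; ring.
- have h : D1 * D2 < 0 by rewrite nmulr_llt0 // lt_neqAle eq_sym D10.
  by rewrite (lt_geF h) -mulrN sM //; ring.
- by rewrite mulr_ge0 // sM //; ring.
Qed.

Lemma root_disc_real (D : int) (t : R) : 0 <= t -> (t%:C%C) ^+ 2 = D%:~R :> R[i] ->
  t%:C%C = root_disc D.
Proof.
move=> t0; rewrite -rmorphXn /= -(rmorph_int (real_complex R)) => /complexI tD.
have D0 : 0 <= D by rewrite -(ler0z R) -tD sqr_ge0.
by rewrite /root_disc D0 -tD sqrtr_sqr ger0_norm.
Qed.

Lemma root_disc_imag (D : int) (t : R) : 0 < t -> ('i%C * t%:C%C) ^+ 2 = D%:~R :> R[i] ->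
  'i%C * t%:C%C = root_disc D.
Proof.
move=> t0; rewrite exprMn sqr_i mulN1r -rmorphXn -rmorphN /= -(rmorph_int (real_complex R)).
move=> /complexI tD.
have D0 : D < 0 by rewrite -(ltrz0 R) -tD oppr_lt0 exprn_gt0.
by rewrite /root_disc leNgt D0 /= intrN -tD opprK sqrtr_sqr ger0_norm // ltW.
Qed.

Lemma expi_sub1 (t : R) : expi (t *+ 2) - 1 = expi t * ('i%C * (2 * sin t)%:C%C).
Proof.
rewrite /expi cos_mulr2n sin_mulr2n cos2sin2; apply/eqP; rewrite eq_complex /=; apply/andP; split; apply/eqP; ring.
Qed.

Lemma expi_pi : expi pi = -1.
Proof. by rewrite /expi cospi sinpi; apply/eqP; rewrite eq_complex /= oppr0 !eqxx. Qed.

Lemma iexp_sign m : \prod_(k < m) ((-1) ^+ k * 'i%C) = (if odd m then 'i%C else 1) :> R[i].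
Proof.
have ii : ('i%C : R[i]) * 'i%C = -1 by rewrite -expr2 sqr_i.
elim: m => [|m IHm]; first by rewrite big_ord0.
rewrite big_ord_recr /= IHm -signr_odd.
by case: (odd m); rewrite /= ?expr1 ?expr0; ring: ii.
Qed.

(** Put t = pi k / p. Since 2m + 1 = p, the factor of index k is e^(i p t) * 2i sin t = (-1)^k * 2i
    sin t. All these sines are positive, so the product is a positive number T times 1 or i, and the
    known square of the Gauss sum determines T. *)
Lemma gauss_legendre_sign p : prime p -> odd p ->
  gauss (legendre_char p) p (zeta p) 1 = root_disc (pstar p).
Proof.
move=> pp po; have p0 := prime_gt0 pp; have zp := zeta_prim p0.
have p0' : p%:R != 0 :> R by rewrite pnatr_eq0 -lt0n.
have [qc sep eD] := disc_char_legendre pp po; rewrite absz_pstar in qc sep eD.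
have := gauss_sqr qc sep zp; rewrite eD gauss_legendre_prod //.
have pm := half_odd_prime po; set m := p./2 in pm *.
pose T : R := \prod_(k < m) (2 * sin (pi * k.+1%:R / p%:R)).
have T0 : 0 < T.
  apply: prodr_gt0 => k _; rewrite mulr_gt0 // sin_gt0_pi // divr_gt0 ?mulr_gt0 ?pi_gt0 ?ltr0n //=.
  rewrite ltr_pdivrMr ?ltr0n // ltr_pM2l ?pi_gt0 // ltr_nat pm.
  by move: (ltn_ord k); lia.
have -> : (-1) ^+ m * \prod_(k < m) (zeta p ^+ (m * k.+1) * (zeta p ^+ k.+1 - 1)) =
    (if odd m then 'i%C else 1) * T%:C%C.
  rewrite -iexp_sign /T rmorph_prod -[X in (-1) ^+ X](card_ord m) -prodr_const -!big_split.
  apply: eq_bigr => k _ /=; rewrite !zetaX.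
  set t := pi * k.+1%:R / p%:R : R.
  have -> : pi *+ 2 * k.+1%:R / p%:R = t *+ 2 by rewrite /t !mulrnAl.
  have -> : pi *+ 2 * (m * k.+1)%:R / p%:R = t *+ m.*2.
    by rewrite /t natrM -mul2n mulrnA -[RHS](mulr_natr _ m); ring.
  rewrite expi_sub1 (mulrA (expi (t *+ _))) -expiD -mulrSr -pm.
  have -> : t *+ p = pi *+ k.+1 by rewrite /t -[LHS]mulr_natr divfK // mulr_natr.
  by rewrite -expiX expi_pi exprS; ring.
case: (odd m); rewrite ?mul1r => e; [exact: root_disc_imag | exact/root_disc_real/e/ltW].
Qed.

Lemma cos_pi4 : 0 < cos (pi *+ 2 / 8 : R) /\ 0 < sin (pi *+ 2 / 8 : R).
Proof.
have p0 := pi_gt0 R; rewrite -mulr_natr; split.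
  by apply: cos_gt0_pihalf; apply/andP; split; lra.
by apply: sin_gt0_pi; apply/andP; split; lra.
Qed.

(** The square is known, so a sign suffices. For modulus 8, with w the inverse of [zeta 8], the
    relations z^4 = -1 and z^3 = -w reduce the sums to 2(z + w) and 2(z - w), whose signs are those
    of cos and sin at pi/4. *)
Lemma gauss_even_part_sign e f : even_part e f ->
  gauss f `|e|%N (zeta `|e|%N) 1 = root_disc e.
Proof.
move=> ef; have [qc sep eD] := disc_char_even_part ef.
have zp := zeta_prim (let: And5 q0 _ _ _ _ := qc in q0).
have := gauss_sqr qc sep zp; rewrite eD; have [c0 s0] := cos_pi4.
pose w : R[i] := expi (- (pi *+ 2 / 8)).
have zw : zeta 8 * w = 1 by rewrite -expiD subrr expi0.
have z4 : zeta 8 ^+ 4 = -1 by apply: (@prim_root_half _ 4) => //; exact: zeta_prim.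
have z3 : zeta 8 ^+ 3 = - w.
  by rewrite -[LHS]mulr1 -zw mulrA -exprSr z4 mulN1r.
have zDw : zeta 8 + w = (2 * cos (pi *+ 2 / 8))%:C%C.
  rewrite /w /zeta /expi cosN sinN; apply/eqP; rewrite eq_complex /=; apply/andP.
  by split; apply/eqP; ring.
have zBw : zeta 8 - w = 'i%C * (2 * sin (pi *+ 2 / 8))%:C%C.
  rewrite /w /zeta /expi cosN sinN; apply/eqP; rewrite eq_complex /=; apply/andP.
  by split; apply/eqP; ring.
case: ef eD zp => -[-> ->] _ zp.
- by rewrite /gauss big_ord1 expr0 mul1r /root_disc sqrtr1.
- move=> e2; suff eq : gauss chi4 4 (zeta 4) 1 = 'i%C * 2%:C%C.
    by rewrite eq in e2 *; exact: root_disc_imag.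
  have -> : zeta 4 = 'i%C.
    by rewrite /zeta (_ : pi *+ 2 / 4 = pi / 2) ?/expi ?cos_pihalf ?sin_pihalf //; field.
  have ii : ('i%C : R[i]) ^+ 2 = -1 by exact: sqr_i.
  rewrite /gauss !big_ord_recl big_ord0 /= /bump /= /chi4 /= (rmorph_nat (real_complex R)).
  ring: ii.
- move=> e2; suff eq : gauss chi8 8 (zeta 8) 1 = (4 * cos (pi *+ 2 / 8))%:C%C.
    by rewrite eq in e2 *; apply: root_disc_real e2; rewrite mulr_ge0 ?ltW.
  rewrite (_ : 4 * _ = 2 * (2 * cos (pi *+ 2 / 8))); last by ring.
  rewrite rmorphM /= -zDw (rmorph_nat (real_complex R)).
  rewrite /gauss !big_ord_recl big_ord0 /= /bump /= /chi8 /=.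
  by ring: z4 z3.
move=> e2; suff eq : gauss chi8' 8 (zeta 8) 1 = 'i%C * (4 * sin (pi *+ 2 / 8))%:C%C.
  by rewrite eq in e2 *; apply: root_disc_imag e2; rewrite mulr_gt0.
rewrite (_ : 4 * _ = 2 * (2 * sin (pi *+ 2 / 8))); last by ring.
rewrite rmorphM /= mulrCA -zBw (rmorph_nat (real_complex R)).
rewrite /gauss !big_ord_recl big_ord0 /= /bump /= /chi8' /=.
by ring: z4 z3.
Qed.

Lemma zeta_mul q1 q2 : (0 < q1)%N -> (0 < q2)%N -> zeta (q1 * q2) ^+ q2 = zeta q1.
Proof.
move=> q10 q20; rewrite zetaX /zeta natrM; congr expi.
have h1 : q1%:R != 0 :> R by rewrite pnatr_eq0 -lt0n.
have h2 : q2%:R != 0 :> R by rewrite pnatr_eq0 -lt0n.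
by field; rewrite h1.
Qed.

Lemma disc_neq0 e f s : even_part e f -> odd_primes s -> disc e s != 0.
Proof.
move=> ef os; have [[q0 _ _ _ _] _ _] := disc_char_disc ef os.
by rewrite -absz_gt0.
Qed.

(** Adjoining a prime p to D contributes through [gaussM] the factor (|D|/p) psi(p), and Frobenius
    turns psi(p) into (D/p). The product is (sgn D / p), which is -1 exactly when D < 0 and
    [pstar p] < 0, the sign in [root_discM]. *)
Lemma gauss_disc e f s : even_part e f -> odd_primes s ->
  gauss (disc_psi f s) `|disc e s|%N (zeta `|disc e s|%N) 1 = root_disc (disc e s).
Proof.
move=> ef; elim: s => [|p s IHs] os.
  rewrite /disc big_nil mulr1 -(gauss_even_part_sign ef); apply: eq_bigr => j _.
  by rewrite /disc_psi big_nil mulr1.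
have co := coprime_odd_prime ef os.
have os' : odd_primes s.
  by case/andP: os => /andP[_ us] /andP[_ als]; apply/andP.
have [pp po] : prime p /\ odd p by case/andP: os => _ /andP[/andP[]].
have {IHs} IH := IHs os'; have D0 := disc_neq0 ef os'.
have dc := disc_char_disc ef os'; case: (dc) => qc sep eD.
have dcp := disc_char_legendre pp po.
have [zp _ _] := disc_char_disc ef os; case: zp => zp _ _ _ _.
rewrite disc_cons abszM absz_pstar in zp *.
set D := disc e s in D0 dc qc sep eD co zp IH *.
have q0 : (0 < `|D|)%N by rewrite absz_gt0.
rewrite (_ : gauss _ _ _ _ = gauss (fun n => legendre_char p n * disc_psi f s n) (p * `|D|) (zeta (p * `|D|)) 1); last first.
  by apply: eq_bigr => j _; rewrite disc_psi_cons.
rewrite gaussM //; [|by case: dcp; rewrite absz_pstar|exact: zeta_prim].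
have p0' := prime_gt0 pp; rewrite zeta_mul // mulnC zeta_mul // gauss_legendre_sign // IH.
have p0 : pstar p != 0 by rewrite -absz_gt0 absz_pstar prime_gt0.
rewrite root_discM // -mulrA; congr (_ * _).
rewrite (quad_char_frobenius qc sep eD) //; last by rewrite coprime_sym.
have -> : (pstar p < 0) = odd p./2.
  rewrite /pstar -signr_odd; case: odd; rewrite ?expr0 ?expr1 ?mul1r ?mulN1r //.
  by rewrite oppr_lt0 ltz_nat prime_gt0.
have lD : legendre `|D|%N p ^+ 2 = 1 by rewrite legendre_sqr // absz_nat co.
rewrite /legendre_char; have [Dn|Dp] := ltP D 0.
  rewrite [in legendre D p](_ : D = -1 * `|D|%N%:Z); last by move: Dn; clear; lia.
  rewrite legendreM // mulrCA -expr2 lD mulr1 legendreN1 // -signr_odd andbT.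
  by case: odd; rewrite ?expr0 ?expr1 ?rmorphN1.
rewrite andbF [in legendre D p](_ : D = `|D|%N%:Z); last by move: Dp; clear; lia.
by rewrite -expr2 lD.
Qed.

Lemma kronecker_gauss (D : int) : fundamental_discriminant D -> D != 1 ->
  disc_char D (fun n : nat => kronecker D n) /\
  forall h : nat, \sum_(j < `|D|) (kronecker D j)%:~R * expi (pi *+ 2 * (j * h)%:R / `|D|%:~R) =
    (kronecker D h)%:~R * root_disc D.
Proof.
move=> fD D1; have [e [f [s [ef os De]]]] := fundamental_disc fD.
rewrite De in D1 *; have kE (n : nat) : kronecker (disc e s) n = disc_psi f s n.
  exact: kronecker_disc ef os D1.
have dc := disc_char_disc ef os; split.
  by apply: disc_char_ext dc => n; rewrite kE.
move=> h; rewrite -(gauss_disc ef os) kE.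
case: (dc) => qc sep _; case: (qc) => q0 _ _ _ _; rewrite -(sep _ _ (zeta_prim q0)).
apply: eq_bigr => j _; rewrite kE zetaX; congr (_ * expi (_ / _)).
Qed.

Lemma sum_expi n (c : nat -> R) (t : nat -> R) :
  \sum_(j < n) (c j)%:C%C * expi (t j) =
  Complex (\sum_(j < n) c j * cos (t j)) (\sum_(j < n) c j * sin (t j)).
Proof.
elim: n => [|n IHn]; first by rewrite !big_ord0.
rewrite !big_ord_recr /= IHn.
by apply/eqP; rewrite eq_complex /=; apply/andP; split; apply/eqP; ring.
Qed.

Lemma sum_intr_expi n (a : nat -> int) (t : nat -> R) :
  \sum_(j < n) (a j)%:~R * expi (t j) =
  Complex (\sum_(j < n) (a j)%:~R * cos (t j)) (\sum_(j < n) (a j)%:~R * sin (t j)).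
Proof.
by rewrite -(sum_expi n (fun j => (a j)%:~R)); apply: eq_bigr => j _; rewrite rmorph_int.
Qed.

Lemma kronecker_cos (D : int) (h : nat) : fundamental_discriminant D -> D != 1 -> 0 < D ->
  \sum_(j < `|D|) (kronecker D j)%:~R * cos (pi *+ 2 * (j * h)%:R / `|D|%:~R) =
    (kronecker D h)%:~R * Num.sqrt (`|D|%:~R : R).
Proof.
move=> fD D1 D0; have [_ /(_ h)] := kronecker_gauss fD D1.
rewrite (sum_intr_expi _ (fun n : nat => kronecker D n) (fun j => pi *+ 2 * (j * h)%:R / `|D|%:~R)).
rewrite -[in RHS](rmorph_int (real_complex R)) /root_disc (ltW D0) => /(congr1 (@complex.Re R)) /= ->.
by rewrite mul0r subr0 gtr0_norm.
Qed.

Lemma kronecker_sin (D : int) (h : nat) : fundamental_discriminant D -> D != 1 -> D < 0 ->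
  \sum_(j < `|D|) (kronecker D j)%:~R * sin (pi *+ 2 * (j * h)%:R / `|D|%:~R) =
    (kronecker D h)%:~R * Num.sqrt (`|D|%:~R : R).
Proof.
move=> fD D1 D0; have [_ /(_ h)] := kronecker_gauss fD D1.
rewrite (sum_intr_expi _ (fun n : nat => kronecker D n) (fun j => pi *+ 2 * (j * h)%:R / `|D|%:~R)).
rewrite -[in RHS](rmorph_int (real_complex R)) /root_disc (lt_geF D0) => /(congr1 (@complex.Im R)) /= ->.
by rewrite ltr0_norm //; ring.
Qed.

End ComplexGauss.

(** * Finite Poisson summation *)

Lemma sum_bin_pascal (R : pzSemiRingType) (n : nat) (F : nat -> R) :
  \sum_(i < n.+2) 'C(n.+1, i)%:R * F i =
  \sum_(i < n.+1) 'C(n, i)%:R * F i + \sum_(i < n.+1) 'C(n, i)%:R * F i.+1.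
Proof.
rewrite big_ord_recl /= bin0 [in RHS]big_ord_recl /= bin0 -addrA; congr (_ + _).
under eq_bigr do rewrite /bump /= add1n binS natrD mulrDl.
rewrite big_split /=; congr (_ + _).
by rewrite big_ord_recr /= bin_small // mul0r addr0.
Qed.

Lemma sum_dvd (V : nmodType) (k N : nat) (F : nat -> V) : (0 < k)%N ->
  \sum_(1 <= n < N.+1 | (k %| n)%N) F n = \sum_(1 <= j < (N %/ k).+1) F (k * j)%N.
Proof.
move=> k0; elim: N => [|N IHN]; first by rewrite div0n !big_geq.
rewrite big_mkcond big_nat_recr //= -big_mkcond IHN divnS //.
case: ifP => kN; last by rewrite addr0.
rewrite add1n [in RHS]big_nat_recr //=; congr (_ + F _).
have /esym := divnK kN; rewrite divnS // kN add1n => ->; exact: mulnC.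
Qed.

Lemma sum_mul_ord (V : nmodType) (q L : nat) (F : nat -> V) :
  \sum_(h < q * L) F h = \sum_(a < q) \sum_(b < L) F (a + q * b)%N.
Proof.
rewrite exchange_big /= -(big_mkord xpredT F).
elim: L => [|L IHL]; first by rewrite muln0 big_geq // big_ord0.
rewrite big_ord_recr /= -IHL mulnS addnC (@big_cat_nat _ _ _ (q * L)) ?leq_addr //=.
congr (_ + _); rewrite -{1}[(q * L)%N]add0n big_addn addKn big_mkord.
by [].
Qed.

Lemma sum_fold_center (V : nmodType) (m : nat) (H : nat -> V) :
  (forall k, (k <= m)%N -> H (m - k)%N = H (m + k)%N) ->
  \sum_(i < m.*2.+1) H i = H m + (\sum_(1 <= k < m.+1) H (m + k)%N) *+ 2.
Proof.
move=> Hs; rewrite -(big_mkord xpredT H) (@big_cat_nat _ _ _ m) //=; last by rewrite -addnn; lia.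
rewrite [X in _ + X]big_ltn; last by rewrite -addnn; lia.
rewrite addrCA; congr (_ + _); rewrite mulr2n; congr (_ + _).
  rewrite big_nat_rev /= big_add1 /=; apply: eq_big_nat => k /andP[_ km].
  by rewrite add0n Hs.
rewrite -{1}[m.+1]add1n big_addn; apply: congr_big_nat => //.
  by rewrite -addnn; lia.
by move=> k _; rewrite addnC.
Qed.

(** An index h = N/2 is its own mirror image and lies in neither half, hence the last hypothesis; in
    the applications it holds because the cosine vanishes at pi/2. *)
Lemma sum_fold_ends (V : nmodType) (N : nat) (G : nat -> V) : (0 < N)%N ->
  (forall h, (0 < h < N)%N -> G (N - h)%N = G h) ->
  (forall h, h.*2 = N -> G h = 0) ->
  \sum_(h < N) G h = G 0%N + (\sum_(1 <= h < N | (h.*2 < N)%N) G h) *+ 2.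
Proof.
move=> N0 Gs Gm; rewrite -(big_mkord xpredT G) big_ltn //; congr (_ + _).
rewrite (bigID (fun h => h.*2 < N)%N) /= mulr2n; congr (_ + _).
rewrite [in RHS]big_nat_rev /= big_nat_cond [in RHS]big_nat_cond.
rewrite (bigID (fun h => h.*2 == N)) /= big1 ?add0r; last first.
  by move=> h /andP[_ /eqP]; exact: Gm.
apply: eq_big => [h|h]; last first.
  by move=> /andP[/andP[/andP[h1 h2] h3] h4]; rewrite add1n subSS Gs ?h1.
by rewrite add1n subSS -!addnn; lia.
Qed.

Section FiniteIdentities.
Context {R : realType}.

(** This is the real part of e^(ib) (e^(ia) + e^(-ia))^n. The free phase b carries the induction,
    since Pascal's rule shifts it by a and by -a; the shift b - pi/2 gives the sine version. *)
Lemma sum_bin_cos n (a b : R) :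
  \sum_(i < n.+1) 'C(n, i)%:R * cos ((i.*2%:R - n%:R) * a + b) = (2 * cos a) ^+ n * cos b.
Proof.
elim: n b => [|n IHn] b; first by rewrite big_ord1 bin0 mul1r subrr mul0r add0r expr0 mul1r.
rewrite (sum_bin_pascal n (fun i => cos ((i.*2%:R - n.+1%:R) * a + b))).
under eq_bigr => i _.
  rewrite (_ : (i.*2%:R - n.+1%:R) * a + b = (i.*2%:R - n%:R) * a + (b - a)); last first.
    by rewrite -natr1; ring.
  over.
under [X in _ + X]eq_bigr => i _.
  rewrite (_ : (i.+1.*2%:R - n.+1%:R) * a + b = (i.*2%:R - n%:R) * a + (b + a)); last first.
    by rewrite doubleS -!natr1; ring.
  over.
by rewrite !IHn cosB cosD exprS; ring.
Qed.

Lemma sum_bin_sin n (a b : R) :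
  \sum_(i < n.+1) 'C(n, i)%:R * sin ((i.*2%:R - n%:R) * a + b) = (2 * cos a) ^+ n * sin b.
Proof.
rewrite -(cosBpihalf b) -sum_bin_cos; apply: eq_bigr => i _.
by rewrite -cosBpihalf addrA.
Qed.

Lemma sum_bin_mid_cos m (a : R) :
  'C(m.*2, m)%:R + (\sum_(1 <= k < m.+1) 'C(m.*2, m + k)%:R * cos (k%:R * (a *+ 2))) *+ 2 =
  (2 * cos a) ^+ m.*2.
Proof.
have := sum_bin_cos m.*2 a 0; rewrite cos0 mulr1 => <-.
rewrite (@sum_fold_center _ m (fun i => 'C(m.*2, i)%:R * cos ((i.*2%:R - m.*2%:R) * a + 0))).
  rewrite subrr mul0r add0r cos0 mulr1; congr (_ + _ *+ 2); apply: eq_bigr => k _.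
  by congr (_ * cos _); rewrite doubleD natrD -!muln2 !natrM; ring.
move=> k km; congr (_%:R * _); last first.
  rewrite -cosN; congr cos; rewrite doubleB doubleD natrB ?leq_double // natrD; ring.
by rewrite -bin_sub; [congr 'C(_, _)|]; rewrite -addnn; lia.
Qed.

(** This is [sum_bin_mid_cos] differentiated in a. The proof is algebraic: in the weight i - m, the
    part i is absorbed by i C(2m, i) = 2m C(2m - 1, i - 1), and the part m multiplies a sum
    proportional to sin 0. *)
Lemma sum_bin_mid_sin m (a : R) : (0 < m)%N ->
  \sum_(1 <= k < m.+1) k%:R * 'C(m.*2, m + k)%:R * sin (k%:R * (a *+ 2)) =
  m%:R * sin a * (2 * cos a) ^+ m.*2.-1.
Proof.
move=> m0; pose H i : R := (i%:R - m%:R) * 'C(m.*2, i)%:R * sin ((i.*2%:R - m.*2%:R) * a).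
have : \sum_(i < m.*2.+1) H i = m.*2%:R * ((2 * cos a) ^+ m.*2.-1 * sin a).
  have -> : \sum_(i < m.*2.+1) H i =
      \sum_(i < m.*2.+1) i%:R * ('C(m.*2, i)%:R * sin ((i.*2%:R - m.*2%:R) * a + 0)) -
      m%:R * \sum_(i < m.*2.+1) 'C(m.*2, i)%:R * sin ((i.*2%:R - m.*2%:R) * a + 0).
    by rewrite mulr_sumr -sumrB; apply: eq_bigr => i _; rewrite /H addr0; ring.
  rewrite sum_bin_sin sin0 !mulr0 subr0 big_ord_recl mul0r add0r.
  have [n en] : exists n, m.*2 = n.+1 by exists m.*2.-1; rewrite prednK // double_gt0.
  rewrite en /= -sum_bin_sin mulr_sumr; apply: eq_bigr => i _.
  rewrite /bump /= add1n mulrA mulrA -!natrM -mul_bin_diag natrM; congr (_ * sin _).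
  by rewrite doubleS -!natr1; ring.
rewrite (@sum_fold_center _ m H).
  rewrite {1}/H subrr !mul0r add0r -[_ *+ 2]mulr_natl => e; apply: (@mulfI _ 2) => //.
  transitivity (m.*2%:R * ((2 * cos a) ^+ m.*2.-1 * sin a)); last first.
    by rewrite -[in X in X * (_ * sin a)]muln2 natrM; move: (_ ^+ _) => X; ring.
  rewrite -e.
  congr (_ * _); apply: eq_bigr => k _; rewrite /H.
  rewrite natrD addrC addKr; congr (_ * sin _); rewrite doubleD natrD -!muln2 !natrM; ring.
move=> k km; rewrite /H.
rewrite (_ : (m - k).*2%:R - m.*2%:R = - ((m + k).*2%:R - m.*2%:R)); last first.
  rewrite doubleB doubleD natrB ?leq_double // natrD; ring.
rewrite mulNr sinN mulrN -!mulNr natrB // natrD; congr (_ * _%:R * _).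
  by rewrite [m%:R + _]addrC addrK addrC addKr opprK.
by rewrite -bin_sub; [congr 'C(_, _)|]; rewrite -addnn; lia.
Qed.

(** With h = a + q b, periodicity makes c independent of b, and the sum over b runs through the k-th
    powers of the L-th roots of unity. *)
Lemma sum_lattice (q L k : nat) (c : nat -> R) : (0 < q)%N -> (0 < L)%N ->
  (forall n, c (n %% q)%N = c n) ->
  \sum_(h < q * L) (c h)%:C%C * expi (pi *+ 2 * (h * k)%:R / (q * L)%:R) =
  if (L %| k)%N then
    L%:R * \sum_(a < q) (c a)%:C%C * expi (pi *+ 2 * (a * (k %/ L))%:R / q%:R)
  else 0.
Proof.
move=> q0 L0 cq.
have q0' : q%:R != 0 :> R by rewrite pnatr_eq0 -lt0n.
have L0' : L%:R != 0 :> R by rewrite pnatr_eq0 -lt0n.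
rewrite (sum_mul_ord _ _ (fun h => (c h)%:C%C * expi (pi *+ 2 * (h * k)%:R / (q * L)%:R))).
have E (a : 'I_q) : \sum_(b < L) (c (a + q * b)%N)%:C%C * expi (pi *+ 2 * ((a + q * b) * k)%:R / (q * L)%:R) =
    (c a)%:C%C * expi (pi *+ 2 * (a * k)%:R / (q * L)%:R) * (if (L %| k)%N then L%:R else 0).
  rewrite -(sum_prim_root k (zeta_prim (R := R) L0)) mulr_sumr; apply: eq_bigr => b _.
  have -> : c (a + q * b)%N = c a by rewrite -cq addnC mulnC modnMDl cq.
  rewrite -[RHS]mulrA zetaX -expiD; congr (_ * expi _).
  by rewrite !natrM natrD natrM; field; rewrite q0' L0'.
under eq_bigr do rewrite E.
case: ifP => Lk; last by rewrite big1 // => a _; rewrite mulr0.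
rewrite -mulr_suml mulrC; congr (_ * _); apply: eq_bigr => a _; congr (_ * expi _).
by rewrite -{1}(divnK Lk) !natrM; field; rewrite q0' L0'.
Qed.

End FiniteIdentities.

Section FinitePoisson.
Context {R : realType}.
Variables (q : nat) (c d : nat -> R) (g : R).
Hypotheses (q0 : (0 < q)%N) (cq : forall n, c (n %% q)%N = c n).

(** C(2m, m + k) is split into its central value and the ratio to it. With m close to s L^2,
    [bin_ratio] carries the Gaussian profile and [bin_scale] tends to a constant. *)
Definition bin_ratio (m k : nat) : R := 'C(m.*2, m + k)%:R / 'C(m.*2, m)%:R.
Definition bin_scale (m L : nat) : R := L%:R * 'C(m.*2, m)%:R / 4 ^+ m.

Lemma bin_mid_neq0 m : 'C(m.*2, m)%:R != 0 :> R.
Proof. by rewrite pnatr_eq0 -lt0n bin_gt0 -addnn leq_addr. Qed.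

Lemma bin_ratio_small m k : (m < k)%N -> bin_ratio m k = 0.
Proof. by move=> mk; rewrite /bin_ratio bin_small ?mul0r // -addnn ltn_add2l. Qed.

Lemma sum_bin_ratio (m L K : nat) (w : nat -> R) : (0 < L)%N -> (m %/ L < K)%N ->
  \sum_(1 <= k < m.+1) 'C(m.*2, m + k)%:R * (if (L %| k)%N then w (k %/ L)%N else 0) =
  'C(m.*2, m)%:R * \sum_(1 <= j < K) w j * bin_ratio m (L * j).
Proof.
move=> L0 mK; have -> : \sum_(1 <= j < K) w j * bin_ratio m (L * j) =
    \sum_(1 <= j < (m %/ L).+1) w j * bin_ratio m (L * j).
  rewrite (@big_cat_nat _ _ _ (m %/ L).+1) //= [X in _ + X]big_nat [X in _ + X]big1 ?addr0 //.
  move=> j /andP[mj _]; rewrite bin_ratio_small ?mulr0 //.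
  by rewrite mulnC -ltn_divLR.
under eq_bigr do rewrite (fun_if (fun y => _ * y)) mulr0.
rewrite -big_mkcond sum_dvd // mulr_sumr; apply: eq_bigr => j _.
by rewrite mulKn // [RHS]mulrC /bin_ratio -mulrA divfK ?bin_mid_neq0 // mulrC.
Qed.

Lemma cos_pi_half_mult (h N : nat) : (0 < N)%N -> h.*2 = N -> cos (pi * h%:R / N%:R) = 0 :> R.
Proof.
move=> N0 hN; rewrite -hN -muln2 natrM (_ : _ / _ = pi / 2) ?cos_pihalf //.
have h0 : h%:R != 0 :> R by rewrite pnatr_eq0 -lt0n; move: N0; rewrite -hN double_gt0.
by field.
Qed.

Lemma cos_pi_refl (h N : nat) : (0 < h < N)%N ->
  cos (pi * (N - h)%:R / N%:R) = - cos (pi * h%:R / N%:R) :> R.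
Proof.
move=> /andP[h0 hN]; have N0 : N%:R != 0 :> R by rewrite pnatr_eq0; lia.
rewrite natrB ?(ltnW hN) // (_ : _ / _ = - (pi * h%:R / N%:R) + pi); last by field.
by rewrite cosDpi cosN.
Qed.

Lemma sin_pi_refl (h N : nat) : (0 < h < N)%N ->
  sin (pi * (N - h)%:R / N%:R) = sin (pi * h%:R / N%:R) :> R.
Proof.
move=> /andP[h0 hN]; have N0 : N%:R != 0 :> R by rewrite pnatr_eq0; lia.
rewrite natrB ?(ltnW hN) // (_ : _ / _ = - (pi * h%:R / N%:R) + pi); last by field.
by rewrite sinDpi sinN opprK.
Qed.

(** The data c, d, g abstract a character, its finite Fourier transform and its Gauss sum. This
    generality includes q = 1 with c = d = 1, the case that later determines [beta]. *)
Lemma finite_poisson_cos (m L K : nat) : (0 < m)%N -> (0 < L)%N -> (m %/ L < K)%N ->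
  (forall a b, (q %| a + b)%N -> c a = c b) ->
  (forall k, \sum_(a < q) c a * cos (pi *+ 2 * (a * k)%:R / q%:R) = g * d k) ->
  c 0 + (\sum_(1 <= h < q * L | (h.*2 < q * L)%N) c h * cos (pi * h%:R / (q * L)%:R) ^+ m.*2) *+ 2 =
  g * bin_scale m L * (d 0 + (\sum_(1 <= j < K) d j * bin_ratio m (L * j)) *+ 2).
Proof.
move=> m0 L0 mK ceven cd; set N := (q * L)%N.
have N0 : (0 < N)%N by rewrite muln_gt0 q0.
have lat k : \sum_(h < N) c h * cos (k%:R * ((pi * h%:R / N%:R) *+ 2)) =
    if (L %| k)%N then L%:R * (g * d (k %/ L)%N) else 0.
  have := sum_lattice k q0 L0 cq.
  rewrite (sum_expi N c (fun h => pi *+ 2 * (h * k)%:R / N%:R)).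
  rewrite (sum_expi q c (fun h => pi *+ 2 * (h * (k %/ L))%:R / q%:R)).
  rewrite -(rmorph_nat (real_complex R)) => /(congr1 (@complex.Re R)) /= e.
  rewrite (eq_bigr (fun h : 'I_N => c h * cos (pi *+ 2 * (h * k)%:R / N%:R))).
    by rewrite e; case: ifP => //= _; rewrite mul0r subr0 cd.
  by move=> h _; congr (_ * cos _); rewrite natrM; ring.
have Nh h : (0 < h < N)%N -> c (N - h)%N = c h.
  by move=> /andP[_ hN]; apply: ceven; rewrite subnK ?(ltnW hN) // dvdn_mulr.
have F := @sum_fold_ends _ N (fun h => c h * cos (pi * h%:R / N%:R) ^+ m.*2) N0.
have {F} := F _ _; rewrite mulr0 mul0r cos0 expr1n mulr1 => <-; first last.
- by move=> h hN; rewrite cos_pi_half_mult // expr0n double_eq0 gtn_eqF // mulr0.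
- move=> h hN; rewrite Nh // cos_pi_refl // -mul2n !exprM sqrrN //.
have e4 : (4 ^+ m : R) != 0 by rewrite expf_neq0.
apply: (mulfI e4).
rewrite (_ : 4 ^+ m * (g * bin_scale m L * _) =
   g * L%:R * ('C(m.*2, m)%:R * d 0 + ('C(m.*2, m)%:R * \sum_(1 <= j < K) d j * bin_ratio m (L * j)) *+ 2)); last first.
  by rewrite /bin_scale; move: (bigop _ _ _) => S; field.
rewrite -(sum_bin_ratio _ L0 mK) mulr_sumr.
under eq_bigr => h _.
  rewrite (_ : 4 ^+ m * _ = c h * (2 * cos (pi * h%:R / N%:R)) ^+ m.*2); last first.
    by rewrite exprMn mulrCA; congr (_ * (_ * _)); rewrite -mul2n exprM expr2; congr (_ ^+ _); ring.
  rewrite -sum_bin_mid_cos mulrDr [c h * (_ *+ 2)]mulrnAr mulr_sumr; over.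
rewrite big_split /= -mulr_suml sumrMnl exchange_big /=.
have l0 := lat 0%N; rewrite dvdn0 div0n in l0.
rewrite (_ : \sum_(i < N) c i = L%:R * (g * d 0)); last first.
  by rewrite -l0; apply: eq_bigr => h _; rewrite mul0r cos0 mulr1.
rewrite mulrDr; congr (_ + _); first by ring.
rewrite [RHS]mulrnAr mulr_sumr; congr (_ *+ 2); apply: eq_bigr => k _.
under eq_bigr do rewrite mulrCA.
by rewrite -mulr_sumr lat; case: ifP => _; ring.
Qed.

(** The division by L makes m/L * sin(pi h / (qL)) converge, to s pi h / q, and reduces the weight k
    = L j to j on the dual side. The odd power of the cosine changes sign under h -> N - h exactly
    as c does, so the two halves of the sum agree. *)
Lemma finite_poisson_sin (m L K : nat) : (0 < m)%N -> (0 < L)%N -> (m %/ L < K)%N ->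
  (forall a b, (q %| a + b)%N -> c a = - c b) ->
  (forall k, \sum_(a < q) c a * sin (pi *+ 2 * (a * k)%:R / q%:R) = g * d k) ->
  \sum_(1 <= h < q * L | (h.*2 < q * L)%N)
    c h * (m%:R / L%:R * sin (pi * h%:R / (q * L)%:R)) * cos (pi * h%:R / (q * L)%:R) ^+ m.*2.-1 =
  g * bin_scale m L * \sum_(1 <= j < K) j%:R * d j * bin_ratio m (L * j).
Proof.
move=> m0 L0 mK codd cd; set N := (q * L)%N.
have N0 : (0 < N)%N by rewrite muln_gt0 q0.
have L0' : L%:R != 0 :> R by rewrite pnatr_eq0 -lt0n.
have [n en] : exists n, m.*2 = n.+1 by exists m.*2.-1; rewrite prednK // double_gt0.
have lat k : \sum_(h < N) c h * sin (k%:R * ((pi * h%:R / N%:R) *+ 2)) =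
    if (L %| k)%N then L%:R * (g * d (k %/ L)%N) else 0.
  have := sum_lattice k q0 L0 cq.
  rewrite (sum_expi N c (fun h => pi *+ 2 * (h * k)%:R / N%:R)).
  rewrite (sum_expi q c (fun h => pi *+ 2 * (h * (k %/ L))%:R / q%:R)).
  rewrite -(rmorph_nat (real_complex R)) => /(congr1 (@complex.Im R)) /= e.
  rewrite (eq_bigr (fun h : 'I_N => c h * sin (pi *+ 2 * (h * k)%:R / N%:R))).
    by rewrite e; case: ifP => //= _; rewrite mul0r addr0 cd.
  by move=> h _; congr (_ * sin _); rewrite natrM; ring.
have Nh h : (0 < h < N)%N -> c (N - h)%N = - c h.
  by move=> /andP[_ hN]; apply: codd; rewrite subnK ?(ltnW hN) // dvdn_mulr.
have F := @sum_fold_ends _ N (fun h => c h * (m%:R * sin (pi * h%:R / N%:R) * (2 * cos (pi * h%:R / N%:R)) ^+ n)) N0.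
have {F} F := F _ _; rewrite mulr0 mul0r sin0 mulr0 mul0r mulr0 add0r in F.
have e4 : (4 ^+ m * L%:R : R) != 0 by rewrite mulf_neq0 // expf_neq0.
apply: (mulfI e4); rewrite en /=.
transitivity (\sum_(h < N) c h * (m%:R * sin (pi * h%:R / N%:R) * (2 * cos (pi * h%:R / N%:R)) ^+ n)).
  rewrite F; first last.
  - move=> h hN; rewrite cos_pi_half_mult // mulr0; case: n en {F} => [|n'] en; last by rewrite exprS mul0r !mulr0.
    by move: en; clear; lia.
  - move=> h hN; rewrite Nh // cos_pi_refl // sin_pi_refl // mulrN exprNn -signr_odd.
    have -> : odd n by move: (odd_double m); rewrite en /= => /negbFE.
    by rewrite expr1; ring.
  rewrite -[RHS]mulr_natl !mulr_sumr; apply: eq_bigr => h _.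
  rewrite exprMn (_ : 4 ^+ m = 2 * 2 ^+ n :> R); last first.
    by rewrite -exprS -en -mul2n exprM expr2; congr (_ ^+ _); ring.
  by move: (2 ^+ n) (cos _ ^+ n) => X Y; field.
transitivity (L%:R * L%:R * g * ('C(m.*2, m)%:R * \sum_(1 <= j < K) j%:R * d j * bin_ratio m (L * j))); last first.
  by rewrite /bin_scale; move: (bigop _ _ _) => S; field; rewrite expf_neq0.
have nE : n = m.*2.-1 by rewrite en.
rewrite -(sum_bin_ratio (fun j => j%:R * d j) L0 mK).
rewrite [LHS](eq_bigr (fun h : 'I_N => \sum_(1 <= k < m.+1) c h *
    (k%:R * 'C(m.*2, m + k)%:R * sin (k%:R * ((pi * h%:R / N%:R) *+ 2))))); last first.
  by move=> h _; rewrite nE -sum_bin_mid_sin // mulr_sumr.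
rewrite exchange_big /= mulr_sumr; apply: eq_bigr => k _.
rewrite (eq_bigr (fun h : 'I_N => k%:R * 'C(m.*2, m + k)%:R * (c h * sin (k%:R * ((pi * h%:R / N%:R) *+ 2))))); last first.
  by move=> h _; ring.
rewrite -mulr_sumr lat; case: ifP => Lk; last by rewrite !mulr0.
have {1}-> : k%:R = (k %/ L)%:R * L%:R :> R by rewrite -natrM divnK.
by ring.
Qed.

End FinitePoisson.

(** * Passage to the limit *)

Section ElementaryBounds.
Context {R : realType}.
Implicit Types (f : R -> R) (x y b : R).

Lemma derive_ge0_le f (f' : R -> R) b y : (forall x, is_derive x 1 f (f' x)) ->
  (forall x, 0 < x < b -> 0 <= f' x) -> 0 <= y <= b -> f 0 <= f y.
Proof.
move=> df f'0 /andP[y0 yb].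
have fD x : derivable f x 1 by case: (df x).
apply: (@ger0_derive1_ndecr R f 0 b (fun x _ => fD x) _ _ 0 y) => //.
  move=> x; rewrite in_itv /= => xb.
  by case: (df x) => _ e; rewrite derive1E e f'0.
by apply: derivable_within_continuous => x _; exact: fD.
Qed.

Lemma sin_le_id y : 0 <= y -> sin y <= y.
Proof.
move=> y0; rewrite -subr_ge0; have := @derive_ge0_le (fun x => x - sin x) (fun x => 1 - cos x) y y.
rewrite sin0 subr0; apply; rewrite ?lexx ?y0 //.
Qed.

Lemma norm_sin_le y : 0 <= y -> `|sin y| <= y.
Proof.
move=> y0; rewrite ler_norml sin_le_id // andbT lerNl -subr_ge0 opprK.
have := @derive_ge0_le (fun x => x + sin x) (fun x => 1 + cos x) y y.
rewrite sin0 addr0; apply; rewrite ?lexx ?y0 //.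
Qed.

Lemma mul_cos_le_sin y : 0 <= y <= pi -> y * cos y <= sin y.
Proof.
move=> y0; rewrite -subr_ge0; have := @derive_ge0_le (fun x => sin x - x * cos x) (fun x => x * sin x) pi y.
rewrite sin0 mul0r subr0; apply => //.
  by move=> x; apply: is_derive_eq; rewrite /GRing.scale /=; ring.
by move=> x /andP[x0 xp]; rewrite mulr_ge0 ?(ltW x0) // sin_ge0_pi // !ltW.
Qed.

(** The function cos y * e^(y^2/2) decreases on [0, pi], because its derivative has the sign of y
    cos y - sin y. *)
Lemma cos_le_expR y : 0 <= y <= pi -> cos y <= expR (- (y ^+ 2 / 2)).
Proof.
move=> y0; have := @derive_ge0_le (fun x => - (cos x * expR (x ^+ 2 / 2)))
  (fun x => (sin x - x * cos x) * expR (x ^+ 2 / 2)) pi y.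
rewrite cos0 expr0n mul0r expR0 mul1r lerN2 expRN => H.
rewrite -[leRHS]mul1r ler_pdivlMr ?expR_gt0 //; apply: H => //.
  move=> x; apply: is_derive_eq; rewrite /GRing.scale /=.
  by field.
move=> x /andP[x0 xp]; rewrite mulr_ge0 ?expR_ge0 // subr_ge0 mul_cos_le_sin //.
by rewrite !ltW.
Qed.

(** This is 1 + t <= e^t at t = y / (1 - y), where 1 + t = 1 / (1 - y), after inversion. *)
Lemma expR_le_1B y : y < 1 -> expR (- (y / (1 - y))) <= 1 - y.
Proof.
move=> y1; have y1' : 0 < 1 - y by rewrite subr_gt0.
rewrite expRN -[leRHS]invrK lef_pV2 ?posrE ?expR_gt0 ?invr_gt0 //.
apply: le_trans (expR_ge1Dx _); rewrite le_eqVlt; apply/orP; left; apply/eqP.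
by field; rewrite gt_eqF.
Qed.

Lemma cos_ge_1B y : 0 <= y -> 1 - y ^+ 2 / 2 <= cos y.
Proof.
move=> y0; rewrite -subr_ge0.
have := @derive_ge0_le (fun x => cos x - (1 - x ^+ 2 / 2)) (fun x => x - sin x) y y.
rewrite cos0 expr0n mul0r subr0 subrr; apply; rewrite ?lexx ?y0 //.
  move=> x; apply: is_derive_eq; rewrite /GRing.scale /=; by field.
by move=> x /andP[x0 _]; rewrite subr_ge0 sin_le_id // ltW.
Qed.

End ElementaryBounds.

(** * Gaussian bounds for binomial coefficients *)

Section BinomialBounds.
Context {R : realType}.

Lemma bin_ratio0 m : bin_ratio m 0 = 1 :> R.
Proof. by rewrite /bin_ratio addn0 divff // bin_mid_neq0. Qed.

(** Telescoping k^2 = sum of the first k odd numbers gives the Gaussian bounds below. *)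
Lemma bin_ratioS m k : (k <= m)%N ->
  bin_ratio m k.+1 = bin_ratio m k * (1 - k.*2.+1%:R / (m + k.+1)%:R) :> R.
Proof.
move=> km; have C0 := bin_mid_neq0 (R := R) m.
have mk0 : (m + k.+1)%:R != 0 :> R by rewrite pnatr_eq0 addnS.
have := mul_bin_left m.*2 (m + k); rewrite (_ : m.*2 - (m + k) = m - k)%N; last by rewrite -addnn subnDl.
move/(congr1 (fun n => n%:R : R)); rewrite !natrM -addnS => e.
rewrite /bin_ratio mulrAC; congr (_ / _); apply: (mulfI mk0); rewrite e natrB //.
rewrite mulrCA mulrBr mulr1 mulrCA divff // mulr1 mulrC; congr (_ * _).
by rewrite natrD -addnn -!natr1 natrD; ring.
Qed.

Lemma opp_sqrS_div (j : nat) (c : R) :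
  - (j.+1%:R ^+ 2 / c) = - (j%:R ^+ 2 / c) + - (j.*2.+1%:R / c).
Proof.
by rewrite -opprD -mulrDl; congr (- (_ / _)); rewrite -addnn -!natr1 natrD; ring.
Qed.

Lemma bin_ratio_ge0 m k : 0 <= bin_ratio m k :> R.
Proof. by rewrite /bin_ratio divr_ge0. Qed.

Lemma bin_ratio_le m k : (0 < m)%N -> (k <= m)%N ->
  bin_ratio m k <= expR (- (k%:R ^+ 2 / (m + k)%:R)) :> R.
Proof.
(* The denominator is frozen at its largest value m + k while j grows, so that the exponents of the
   successive factors add up. *)
move=> m0 km; suff H j : (j <= k)%N -> bin_ratio m j <= expR (- (j%:R ^+ 2 / (m + k)%:R)) :> R by exact: H.
elim: j => [|j IHj] jk; first by rewrite bin_ratio0 expr0n mul0r oppr0 expR0.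
rewrite bin_ratioS; last by rewrite (leq_trans _ km) // ltnW.
rewrite opp_sqrS_div.
rewrite expRD ler_pM ?bin_ratio_ge0 ?IHj ?(ltnW jk) //.
  rewrite subr_ge0 ler_pdivrMr ?ltr0n ?addnS // mul1r ler_nat.
  by move: jk km; rewrite -addnn; clear; lia.
apply: le_trans (expR_ge1Dx _); rewrite lerD2l lerN2.
by rewrite ler_wpM2l // lef_pV2 ?posrE ?ltr0n ?addnS ?addn_gt0 ?m0 // ler_nat -addnS leq_add2l.
Qed.

Lemma bin_ratio_ge m k : (0 < m)%N -> (k <= m)%N ->
  expR (- (k%:R ^+ 2 / (m.+1 - k)%:R)) <= bin_ratio m k :> R.
Proof.
move=> m0 km; have mk0 : (0 < m.+1 - k)%N by rewrite subn_gt0.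
suff H j : (j <= k)%N -> expR (- (j%:R ^+ 2 / (m.+1 - k)%:R)) <= bin_ratio m j :> R by exact: H.
elim: j => [|j IHj] jk; first by rewrite bin_ratio0 expr0n mul0r oppr0 expR0.
have jm : (j < m)%N by exact: leq_trans km.
rewrite bin_ratioS ?(ltnW jm) //.
rewrite opp_sqrS_div.
rewrite expRD ler_pM ?expR_ge0 ?IHj ?(ltnW jk) //.
have d0 : (m + j.+1)%:R != 0 :> R by rewrite pnatr_eq0 addnS.
have y1 : j.*2.+1%:R / (m + j.+1)%:R < 1 :> R.
  by rewrite ltr_pdivrMr ?ltr0n ?addnS // mul1r ltr_nat ltnS -addnn ltn_add2r.
apply: le_trans (expR_le_1B y1); rewrite ler_expR lerN2.
rewrite (_ : _ / (1 - _) = j.*2.+1%:R / (m - j)%:R); last first.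
  have -> : (m - j)%:R = (m + j.+1)%:R - j.*2.+1%:R :> R.
    by rewrite natrB ?(ltnW jm) // -addnn natrD -!natr1 natrD; ring.
  move: y1 d0; move: (m + j.+1)%:R (j.*2.+1%:R) => X Y y1 d0.
  field; rewrite d0 /= andbT; apply/negP => /eqP e.
  by move: y1; rewrite (_ : Y = X) ?divff ?ltxx //; lra.
rewrite ler_wpM2l // lef_pV2 ?posrE ?ltr0n ?subn_gt0 // ler_nat.
by lia.
Qed.

Definition central m : R := 'C(m.*2, m)%:R / 4 ^+ m.

Lemma centralS m : central m.+1 = central m * (m.*2.+1%:R / m.+1.*2%:R).
Proof.
have b1 : (m.+1 * 'C(m.+1.*2, m.+1) = m.+1.*2 * 'C(m.*2.+1, m.+1))%N.
  rewrite -mul_bin_diag /= doubleS /=; congr (_ * _)%N.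
  by rewrite -bin_sub; [congr 'C(_, _)|]; rewrite -addnn; lia.
have b2 : (m.+1 * 'C(m.*2.+1, m.+1) = m.*2.+1 * 'C(m.*2, m))%N.
  by rewrite -mul_bin_diag.
move/(congr1 (fun n => n%:R : R)): b2; move/(congr1 (fun n => n%:R : R)): b1.
rewrite !natrM -!muln2 !natrM => b1 b2.
have n0 : m.+1%:R != 0 :> R by rewrite pnatr_eq0.
have e4 : 4 ^+ m != 0 :> R by rewrite expf_neq0.
rewrite /central -!muln2 exprS.
have -> : 'C(m.+1 * 2, m.+1)%:R = 2 * ((m * 2).+1%:R * 'C(m * 2, m)%:R / m.+1%:R) :> R.
  by apply: (mulfI n0); rewrite b1 -b2; field.
clear b1 b2; move: (m.+1%:R) n0 (4 ^+ m) e4 => X n0 Y e4.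
by field; rewrite n0 e4.
Qed.

End BinomialBounds.

(** * Dominated convergence for series *)

Section Tannery.
Local Open Scope classical_set_scope.
Context {R : realType}.

Lemma cvg_sum_nat (u : nat -> nat -> R) (v : nat -> R) (N : nat) :
  (forall n, (0 < n)%N -> (fun L => u L n) @ \oo --> v n) ->
  (fun L => \sum_(1 <= n < N) u L n) @ \oo --> \sum_(1 <= n < N) v n.
Proof.
move=> uv; elim: N => [|[|N] IHN].
- under eq_fun do rewrite big_geq //; rewrite big_geq //; exact: cvg_cst.
- under eq_fun do rewrite big_geq //; rewrite big_geq //; exact: cvg_cst.
under eq_fun do rewrite big_nat_recr //=; rewrite big_nat_recr //=.
by apply: cvgD => //; exact: uv.
Qed.

Lemma sum1_series (v : nat -> R) :
  (fun N => \sum_(1 <= n < N) v n) = series (fun n => if n is 0%N then 0 else v n).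
Proof.
apply/funext => -[|N]; rewrite /series /=; first by rewrite !big_geq.
rewrite [RHS]big_ltn // add0r; apply: eq_big_nat => n /andP[n1 _].
by case: n n1.
Qed.

Lemma is_cvg_sum1_le (v b : nat -> R) :
  cvgn (fun N => \sum_(1 <= n < N) b n) ->
  (forall n, (0 < n)%N -> `|v n| <= b n) ->
  cvgn (fun N => \sum_(1 <= n < N) v n).
Proof.
rewrite !sum1_series => cb vb; apply: normed_cvg.
apply: series_le_cvg cb; first by move=> n; exact: normr_ge0.
  by case=> [|n] //=; apply: le_trans (normr_ge0 _) (vb _ _).
by case=> [|n] /=; [rewrite normr0 | exact: vb].
Qed.

(** The range of summation may grow with L, as it does in the finite identities; [L <= K L] makes it
    eventually contain any fixed M. For M with tail of b at most e/4, the two tails and the finite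
    part each contribute at most e/4. *)
Lemma tannery (u : nat -> nat -> R) (v b : nat -> R) (K : nat -> nat) :
  (forall L, (L <= K L)%N) ->
  cvgn (fun N => \sum_(1 <= n < N) b n) ->
  (\forall L \near \oo, forall n, (0 < n)%N -> `|u L n| <= b n) ->
  (forall n, (0 < n)%N -> (fun L => u L n) @ \oo --> v n) ->
  (fun L => \sum_(1 <= n < K L) u L n) @ \oo --> limn (fun N => \sum_(1 <= n < N) v n).
Proof.
move=> LK cb ub uv.
have b0 n : (0 < n)%N -> 0 <= b n.
  move=> n0; near \oo => L; apply: le_trans (normr_ge0 (u L n)) _.
  by move: n n0; near: L.
have vb n : (0 < n)%N -> `|v n| <= b n.
  move=> n0; apply: (@cvgr_to_le nat \oo _ R (fun L => `|u L n|)); first by apply: cvg_norm; apply: uv.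
  by apply: filterS ub => L; apply.
have tail (w : nat -> R) M N : (0 < M <= N)%N -> (forall n, (0 < n)%N -> `|w n| <= b n) ->
   `|\sum_(1 <= n < N) w n - \sum_(1 <= n < M) w n| <= \sum_(1 <= n < N) b n - \sum_(1 <= n < M) b n.
  move=> /andP[M0 MN] wb; rewrite !(@big_cat_nat _ _ _ M 1 N) //= !(addrC (\sum_(1 <= _ < M) _)) !addrK.
  apply: le_trans (ler_norm_sum _ _ _) _; rewrite !big_nat; apply: ler_sum => n /andP[Mn _].
  by apply: wb; apply: leq_trans Mn.
pose B := limn (fun N => \sum_(1 <= n < N) b n).
have bmono : {homo (fun N => \sum_(1 <= n < N) b n) : n m / (n <= m)%N >-> n <= m}.
  move=> n m nm; have [n0|n0] := posnP n.
    rewrite n0 [leLHS]big_geq // big_nat; apply: sumr_ge0 => i /andP[i0 _]; exact: b0.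
  rewrite (@big_cat_nat _ _ _ n 1 m) //= lerDl big_nat; apply: sumr_ge0 => i /andP[i0 _].
  by apply: b0; apply: leq_trans i0.
have bB N : \sum_(1 <= n < N) b n <= B by exact: (nondecreasing_cvgn_le bmono cb).
have cv : cvgn (fun N => \sum_(1 <= n < N) v n).
  exact: is_cvg_sum1_le cb vb.
apply/cvgrPdist_le => e e0.
have e4 : 0 < e / 4 by rewrite divr_gt0.
have [M [M0 BM]] : exists M, (0 < M)%N /\ B - \sum_(1 <= n < M) b n <= e / 4.
  near \oo => M; exists M; split; first by near: M; exact: nbhs_infty_gt.
  apply: le_trans (ler_norm _) _; near: M.
  exact: (cvgr_dist_le _ _ cb _ e4).
have vM : `|limn (fun N => \sum_(1 <= n < N) v n) - \sum_(1 <= n < M) v n| <= e / 4.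
  apply: (@cvgr_to_le nat \oo _ R (fun N => `|\sum_(1 <= n < N) v n - \sum_(1 <= n < M) v n|)).
    by apply: cvg_norm; apply: cvgB => //; exact: cvg_cst.
  near=> N; apply: le_trans (tail v M N _ vb) _.
    by rewrite M0; near: N; exact: nbhs_infty_ge.
  by apply: le_trans BM; rewrite lerD2r.
have uM := cvgr_dist_le _ _ (cvg_sum_nat (N := M) uv) _ e4.
near=> L.
have KM : (M <= K L)%N by apply: leq_trans (LK L); near: L; exact: nbhs_infty_ge.
have uL n : (0 < n)%N -> `|u L n| <= b n by move: n; near: L.
have h1 : `|\sum_(1 <= n < K L) u L n - \sum_(1 <= n < M) u L n| <= e / 4.
  apply: le_trans (tail (u L) M (K L) _ uL) _; first by rewrite M0.
  by apply: le_trans BM; rewrite lerD2r.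
have h2 : `|\sum_(1 <= n < M) v n - \sum_(1 <= n < M) u L n| <= e / 4 by near: L; exact: uM.
rewrite (_ : _ - _ = (limn (fun N => \sum_(1 <= n < N) v n) - \sum_(1 <= n < M) v n)
   + (\sum_(1 <= n < M) v n - \sum_(1 <= n < M) u L n)
   - (\sum_(1 <= n < K L) u L n - \sum_(1 <= n < M) u L n)); last by ring.
apply: le_trans (ler_normB _ _) _.
have h3 := ler_normD (limn (fun N => \sum_(1 <= n < N) v n) - \sum_(1 <= n < M) v n)
  (\sum_(1 <= n < M) v n - \sum_(1 <= n < M) u L n).
by lra.
Unshelve. all: by end_near.
Qed.

End Tannery.

(** * Limits of scaled binomial coefficients and powers of the cosine *)

Section Limits.
Local Open Scope classical_set_scope.
Context {R : realType}.

Lemma central_bound m : (m.*2.+1)%:R * central m ^+ 2 <= 1 :> R.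
Proof.
elim: m => [|m IHm]; first by rewrite /central bin0 divr1 expr1n mulr1.
apply: le_trans IHm; rewrite centralS exprMn [leLHS]mulrCA [leRHS]mulrC ler_wpM2l ?sqr_ge0 //.
rewrite -!muln2 expr_div_n mulrA ler_pdivrMr ?exprn_gt0 ?ltr0n // -!natrX -!natrM ler_nat.
by rewrite !expnS !expn0; nia.
Qed.

(** Wallis' product in disguise: the sequence increases, is bounded by [central_bound], and is
    already positive at m = 1. *)
Lemma central_cvg : exists2 beta : R, 0 < beta &
  (fun m => m%:R * central m ^+ 2) @ \oo --> beta.
Proof.
have mono : {homo (fun m => m%:R * central m ^+ 2 : R) : n m / (n <= m)%N >-> n <= m}.
  apply/nondecreasing_seqP => m /=; rewrite centralS [(central m * _) ^+ 2]exprMn.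
  rewrite [leLHS]mulrC [leRHS]mulrCA ler_wpM2l ?sqr_ge0 //.
  rewrite -!muln2 expr_div_n mulrA ler_pdivlMr ?exprn_gt0 ?ltr0n // -!natrX -!natrM ler_nat.
  by rewrite !expnS !expn0; nia.
have cv : cvgn (fun m => m%:R * central m ^+ 2 : R).
  apply: nondecreasing_is_cvgn mono _; exists 1 => _ [m _ <-].
  apply: le_trans (central_bound m); rewrite ler_wpM2r ?sqr_ge0 // ler_nat -addnn.
  by rewrite -addSn leq_addl.
exists (limn (fun m => m%:R * central m ^+ 2 : R)) => //.
apply: lt_le_trans (nondecreasing_cvgn_le mono cv 1%N).
by rewrite mul1r exprn_gt0 // divr_gt0 // ltr0n.
Qed.

Lemma cvg_expRN (f : nat -> R) (l : R) :
  f @ \oo --> l -> (fun L => expR (- f L)) @ \oo --> expR (- l).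
Proof. by move=> fl; apply: continuous_cvg; [exact: continuous_expR | exact: cvgN]. Qed.

Lemma invn_cvg : (fun L : nat => (L%:R : R)^-1) @ \oo --> 0.
Proof. by rewrite -cvg_shiftS; exact: cvg_harmonic. Qed.

Variable s : R.
Hypothesis s0 : 0 < s.

Definition sqscale (L : nat) : nat := Num.truncn (s * L%:R ^+ 2).

Lemma sqscale_le L : (sqscale L)%:R <= s * L%:R ^+ 2.
Proof. by have /andP[] := truncn_itv (mulr_ge0 (ltW s0) (sqr_ge0 (L%:R : R))). Qed.

Lemma sqscale_gt L : s * L%:R ^+ 2 < (sqscale L).+1%:R.
Proof. by have /andP[] := truncn_itv (mulr_ge0 (ltW s0) (sqr_ge0 (L%:R : R))). Qed.

Lemma near_posn : \forall L \near \oo, (0 < L)%N.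
Proof. exact: nbhs_infty_gt. Qed.

Lemma sqscale_cvg : (fun L => (sqscale L)%:R / L%:R ^+ 2 : R) @ \oo --> s.
Proof.
apply: (@squeeze_cvgr _ _ _ _ (fun L => s - L%:R^-1 * L%:R^-1) (fun=> s)); last exact: cvg_cst.
  near=> L; have L0 : (0 < L)%N by near: L; exact: near_posn.
  have L2 : 0 < L%:R ^+ 2 :> R by rewrite exprn_gt0 // ltr0n.
  rewrite ler_pdivrMr // sqscale_le andbT ler_pdivlMr // mulrBl -expr2 exprVn mulVf ?gt_eqF //.
  by rewrite lerBlDr natr1 ltW // sqscale_gt.
rewrite -[X in _ --> X]subr0 -[X in _ - X](mulr0 0); apply: cvgB; first exact: cvg_cst.
by apply: cvgM; exact: invn_cvg.
Unshelve. all: by end_near.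
Qed.

Lemma sqscale_infty : sqscale @ \oo --> \oo.
Proof.
apply/cvgnyPge => A; near=> L.
have := sqscale_gt L; rewrite -ltnS -(ltr_nat R); apply: le_lt_trans.
rewrite -ler_pdivrMl //; near: L.
have : \forall L \near \oo, s^-1 * A%:R <= L%:R :> R by exact: nbhs_infty_ger.
apply: filterS2 near_posn => L L0 h; apply: le_trans h _.
by rewrite expr2 ler_peMr // ler1n.
Unshelve. all: by end_near.
Qed.

(** [bin_scale m L] is L * [central m], the square root of m [central m]^2 divided by m / L^2; the
    numerator tends to beta and the denominator to s. *)
Lemma bin_scale_cvg (beta : R) : (fun m => m%:R * central m ^+ 2) @ \oo --> beta ->
  (fun L => bin_scale (sqscale L) L) @ \oo --> Num.sqrt (beta / s).
Proof.
move=> cb; have cm := cvg_comp _ _ sqscale_infty cb.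
have sn0 : s != 0 by rewrite gt_eqF.
have h := cvgM cm (cvgV sn0 sqscale_cvg).
have : (fun L => Num.sqrt ((sqscale L)%:R * central (sqscale L) ^+ 2 * ((sqscale L)%:R / L%:R ^+ 2)^-1)) @ \oo
    --> Num.sqrt (beta / s).
  by apply: continuous_cvg; [exact: sqrt_continuous | exact: h].
apply: cvg_trans; apply: near_eq_cvg; near=> L.
have L0 : (0 < L)%N by near: L; exact: near_posn.
have m0 : (0 < sqscale L)%N.
  near: L; have /cvgnyPge/(_ 1%N) := sqscale_infty; exact.
rewrite /= (_ : bin_scale _ _ = L%:R * central (sqscale L)); last by rewrite /bin_scale /central mulrA.
have c0 : 0 <= central (sqscale L) :> R by rewrite divr_ge0 ?exprn_ge0.
rewrite -[RHS]ger0_norm ?mulr_ge0 // -sqrtr_sqr; congr Num.sqrt.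
by move: (central _) c0 => c c0; field; rewrite !pnatr_eq0 -!lt0n L0 m0.
Unshelve. all: by end_near.
Qed.

(** The two Gaussian bounds at k = L j, with numerator and denominator divided by L^2, have
    denominators m/L^2 + 1/L^2 - j/L and m/L^2 + j/L, both tending to s. *)
Lemma bin_ratio_cvg (j : nat) : (fun L => bin_ratio (sqscale L) (L * j)) @ \oo --> expR (- (j%:R ^+ 2 / s)).
Proof.
have jL : (fun L => j%:R * (L%:R : R)^-1) @ \oo --> 0.
  by rewrite -(mulr0 j%:R); apply: cvgM; [exact: cvg_cst | exact: invn_cvg].
have LL : (fun L => (L%:R : R)^-1 * L%:R^-1) @ \oo --> 0.
  by rewrite -[X in _ --> X](mulr0 0); apply: cvgM; exact: invn_cvg.
apply: (@squeeze_cvgr _ _ _ _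
   (fun L => expR (- (j%:R ^+ 2 / ((sqscale L)%:R / L%:R ^+ 2 + L%:R^-1 * L%:R^-1 - j%:R * L%:R^-1))))
   (fun L => expR (- (j%:R ^+ 2 / ((sqscale L)%:R / L%:R ^+ 2 + j%:R * L%:R^-1))))); first last.
- apply: cvg_expRN; apply: cvgM; first exact: cvg_cst.
  apply: cvgV; first by rewrite gt_eqF.
  by rewrite -[X in _ --> X]addr0; apply: cvgD => //; exact: sqscale_cvg.
- apply: cvg_expRN; apply: cvgM; first exact: cvg_cst.
  apply: cvgV; first by rewrite gt_eqF.
  rewrite -[X in _ --> X]subr0; apply: cvgB => //.
  by rewrite -[X in _ --> X]addr0; apply: cvgD => //; exact: sqscale_cvg.
near=> L.
have L0 : (0 < L)%N by near: L; exact: near_posn.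
have L0' : L%:R != 0 :> R by rewrite pnatr_eq0 -lt0n.
have m0 : (0 < sqscale L)%N.
  near: L; have /cvgnyPge/(_ 1%N) := sqscale_infty; exact.
have jm : (L * j <= sqscale L)%N.
  have h : j%:R * L%:R^-1 < (sqscale L)%:R / L%:R ^+ 2 :> R.
    rewrite -subr_gt0; near: L; apply: (cvgr_gt s) => //.
    by rewrite -[X in _ --> X]subr0; apply: cvgB => //; exact: sqscale_cvg.
  rewrite -(ler_nat R) ltW //; move: h; rewrite ltr_pdivlMr ?exprn_gt0 ?ltr0n // natrM.
  by rewrite (_ : _ * _ * _ = L%:R * j%:R :> R) //; field.
rewrite (le_trans _ (bin_ratio_ge m0 jm)) ?(le_trans (bin_ratio_le m0 jm)) //.
  rewrite ler_expR lerN2 le_eqVlt natrD natrM; apply/orP; left; apply/eqP.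
  have d0 : (sqscale L)%:R + L%:R * j%:R != 0 :> R.
    by rewrite -natrM -natrD pnatr_eq0 addn_eq0 negb_and -lt0n m0.
  by field; rewrite L0' d0.
rewrite ler_expR lerN2 le_eqVlt natrB ?(leq_trans jm) // natrM -natr1; apply/orP; left; apply/eqP.
have d0 : (sqscale L)%:R + 1 - L%:R * j%:R != 0 :> R.
  by rewrite natr1 -natrM -natrB ?(leq_trans jm) // pnatr_eq0 -lt0n subn_gt0.
by field; rewrite L0' /= mulNr [j%:R * _]mulrC d0.
Unshelve. all: by end_near.
Qed.


(** For L j <= m the denominator m + L j is at most 2m <= 2 s L^2, which gives half of the limiting
    rate 1/s; beyond m the ratio is 0. *)
Lemma bin_ratio_dom (L j : nat) : (0 < L)%N -> (0 < sqscale L)%N ->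
  `|bin_ratio (sqscale L) (L * j)| <= expR (- (j%:R ^+ 2 / (s *+ 2))) :> R.
Proof.
move=> L0 m0; rewrite ger0_norm ?bin_ratio_ge0 //.
have [jm|jm] := leqP (L * j) (sqscale L); last by rewrite bin_ratio_small // expR_ge0.
apply: le_trans (bin_ratio_le m0 jm) _; rewrite ler_expR lerN2.
rewrite ler_pdivrMr ?mulrn_wgt0 // mulrAC ler_pdivlMr ?ltr0n ?addn_gt0 ?m0 //.
rewrite (_ : _ * (s *+ 2) = j%:R ^+ 2 * (L%:R ^+ 2 * (s *+ 2))); last by rewrite natrM; ring.
rewrite ler_wpM2l ?sqr_ge0 //.
apply: (@le_trans _ _ ((sqscale L)%:R *+ 2)).
  by rewrite mulr2n natrD lerD2l ler_nat.
by rewrite mulrnAr ler_wMn2r // mulrC sqscale_le.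
Qed.

Lemma cos_expn_le (y : R) (p : nat) : 0 <= y <= pi / 2 ->
  0 <= cos y ^+ p <= expR (- (p%:R * (y ^+ 2 / 2))).
Proof.
move=> /andP[y0 yp]; have p0 := pi_gt0 R.
have c0 : 0 <= cos y by rewrite cos_ge0_pihalf //; apply/andP; split; lra.
rewrite exprn_ge0 //= -mulrN mulrC expRM_natr lerXn2r ?nnegrE ?expR_ge0 //.
by apply: cos_le_expR; apply/andP; split; lra.
Qed.

(** With y = k / L, the squeeze is between (1 - y^2/2)^p, bounded below through [expR_le_1B], and
    e^(-p y^2/2). *)
Lemma cos_expn_cvg (k : R) (p : nat -> nat) (t : R) : 0 <= k ->
  (fun L => (p L)%:R / L%:R ^+ 2 : R) @ \oo --> t ->
  (fun L => cos (k / L%:R) ^+ p L) @ \oo --> expR (- (t * (k ^+ 2 / 2))).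
Proof.
move=> k0 pt.
have kL : (fun L => k * (L%:R : R)^-1) @ \oo --> 0.
  by rewrite -(mulr0 k); apply: cvgM; [exact: cvg_cst | exact: invn_cvg].
have kL2 : (fun L => (k / L%:R) ^+ 2 / 2) @ \oo --> (0 : R).
  have h : (fun L : nat => k / L%:R * (k / L%:R) * 2^-1) @ \oo --> (0 * 0 * 2^-1 : R).
    by apply: cvgM; [exact: cvgM | exact: cvg_cst].
  by rewrite !mul0r in h.
apply: (@squeeze_cvgr _ _ _ _
   (fun L => expR (- ((p L)%:R / L%:R ^+ 2 * (k ^+ 2 / 2) / (1 - (k / L%:R) ^+ 2 / 2))))
   (fun L => expR (- ((p L)%:R / L%:R ^+ 2 * (k ^+ 2 / 2))))); first last.
- by apply: cvg_expRN; apply: cvgM => //; exact: cvg_cst.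
- apply: cvg_expRN; rewrite (_ : t * _ = t * (k ^+ 2 / 2) * 1^-1); last by rewrite invr1 mulr1.
  apply: cvgM.
    by apply: cvgM => //; exact: cvg_cst.
  apply: cvgV; first exact: oner_neq0.
  by rewrite -[X in _ --> X]subr0; apply: cvgB => //; exact: cvg_cst.
near=> L.
have L0 : (0 < L)%N by near: L; exact: near_posn.
have L0' : L%:R != 0 :> R by rewrite pnatr_eq0 -lt0n.
have y0 : 0 <= k / L%:R by rewrite divr_ge0.
have p0 := pi_gt0 R.
have yp : k / L%:R <= pi / 2 by near: L; apply: (cvgr_le 0); [exact: kL | rewrite divr_gt0 ?pi_gt0].
have y1 : (k / L%:R) ^+ 2 / 2 < 1 by near: L; apply: (cvgr_lt 0); [exact: kL2 | exact: ltr01].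
have /andP[_ ub] := cos_expn_le (p L) (introT andP (conj y0 yp)).
have pE : (p L)%:R * ((k / L%:R) ^+ 2 / 2) = (p L)%:R / L%:R ^+ 2 * (k ^+ 2 / 2).
  by field.
rewrite -pE ub andbT -mulrA -mulrN mulrC expRM_natr.
apply: lerXn2r; rewrite ?nnegrE ?expR_ge0 ?cos_ge0_pihalf //.
  by apply/andP; split; lra.
exact: le_trans (expR_le_1B y1) (cos_ge_1B y0).
Unshelve. all: by end_near.
Qed.

Lemma sin_div_cvg (k : R) : 0 <= k -> (fun L : nat => L%:R * sin (k / L%:R)) @ \oo --> k.
Proof.
move=> k0.
have kL : (fun L => k * (L%:R : R)^-1) @ \oo --> 0.
  by rewrite -(mulr0 k); apply: cvgM; [exact: cvg_cst | exact: invn_cvg].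
apply: (@squeeze_cvgr _ _ _ _ (fun L => k * cos (k / L%:R)) (fun=> k)); last exact: cvg_cst.
  near=> L.
  have L0 : (0 < L)%N by near: L; exact: near_posn.
  have L0' : L%:R != 0 :> R by rewrite pnatr_eq0 -lt0n.
  have y0 : 0 <= k / L%:R by rewrite divr_ge0.
  have yp : k / L%:R <= pi by near: L; apply: (cvgr_le 0); [exact: kL | exact: pi_gt0].
  have kE : k = L%:R * (k / L%:R) by field.
  rewrite {1}kE -mulrA {5}kE !ler_wpM2l ?sin_le_id //.
  by apply: mul_cos_le_sin; rewrite y0.
rewrite -[X in _ --> X]mulr1 -[X in _ * X](@cos0 R); apply: cvgM; first exact: cvg_cst.
by apply: continuous_cvg => //; exact: continuous_cos.
Unshelve. all: by end_near.
Qed.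

End Limits.

(** * Limits of the two finite Poisson formulas *)

Section PoissonLimit.
Local Open Scope classical_set_scope.
Context {R : realType}.

Definition gauss_series (w : nat -> R) (t : R) : R :=
  limn (fun N => \sum_(1 <= n < N) w n * expR (- (t * n%:R ^+ 2))).

Lemma gauss_majorant_cvg (C t : R) (e : nat) : (e <= 1)%N -> 0 < t ->
  cvgn (fun N => \sum_(1 <= n < N) C * n%:R ^+ e * expR (- (t * n%:R ^+ 2)) : R).
Proof. by move=> e1 t0; apply: (gauss_cvg (a := fun=> C) (M := `|C|)). Qed.

Variable s : R.
Hypothesis s0 : 0 < s.

(** The cutoff [(sqscale s L + L).+1] exceeds L, as [tannery] asks, and also m / L, as the finite
    identities ask. *)
Lemma bin_side_cvg (w : nat -> R) (C : R) (e : nat) : (e <= 1)%N ->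
  (forall j, `|w j| <= C * j%:R ^+ e) ->
  (fun L => \sum_(1 <= j < (sqscale s L + L).+1) w j * bin_ratio (sqscale s L) (L * j)) @ \oo
    --> gauss_series w s^-1.
Proof.
move=> e1 wC; apply: (tannery (K := fun L => (sqscale s L + L).+1)
    (b := fun j => C * j%:R ^+ e * expR (- ((s *+ 2)^-1 * j%:R ^+ 2)))).
- by move=> L; rewrite leqW // leq_addl.
- by apply: gauss_majorant_cvg => //; rewrite invr_gt0 mulrn_wgt0.
- near=> L => j j0.
  have L0 : (0 < L)%N by near: L; exact: near_posn.
  have m0 : (0 < sqscale s L)%N.
    by near: L; have /cvgnyPge/(_ 1%N) := sqscale_infty s0; exact.
  by rewrite normrM ler_pM // mulrC bin_ratio_dom.
- move=> j j0; apply: cvgM; first exact: cvg_cst.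
  by rewrite mulrC; exact: bin_ratio_cvg.
Unshelve. all: by end_near.
Qed.

(** The restriction 2h < qL keeps the angle in [0, pi/2], where the Gaussian bound for the cosine
    applies; once p >= s L^2, half of the limiting rate dominates. The exponent p covers both 2m and
    2m - 1, and w depends on L because of the sine factor. *)
Lemma cos_side_cvg (q : nat) (p : nat -> nat) (w : nat -> nat -> R) (v : nat -> R) (C : R) (e : nat) :
  (0 < q)%N -> (e <= 1)%N ->
  (fun L => (p L)%:R / L%:R ^+ 2 : R) @ \oo --> s *+ 2 ->
  (forall L h, (0 < L)%N -> `|w L h| <= C * h%:R ^+ e) ->
  (forall h, (fun L => w L h) @ \oo --> v h) ->
  (fun L => \sum_(1 <= h < q * L | (h.*2 < q * L)%N) w L h * cos (pi * h%:R / (q * L)%:R) ^+ p L) @ \oo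
    --> gauss_series v (s * (pi / q%:R) ^+ 2).
Proof.
move=> q0 e1 ps wC wv; under eq_fun do rewrite big_mkcond.
have q0' : 0 < q%:R :> R by rewrite ltr0n.
have pi0 := pi_gt0 R.
apply: (tannery (u := fun L h => if (h.*2 < q * L)%N then w L h * cos (pi * h%:R / (q * L)%:R) ^+ p L else 0)
    (K := fun L => (q * L)%N)
    (b := fun h => C * h%:R ^+ e * expR (- (s * (pi / q%:R) ^+ 2 / 2 * h%:R ^+ 2)))).
- by move=> L; rewrite leq_pmull.
- by apply: gauss_majorant_cvg => //; rewrite divr_gt0 // mulr_gt0 // exprn_gt0 // divr_gt0.
- near=> L => h h0.
  have L0 : (0 < L)%N by near: L; exact: near_posn.
  have L0' : L%:R != 0 :> R by rewrite pnatr_eq0 -lt0n.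
  have psL : s <= (p L)%:R / L%:R ^+ 2.
    by near: L; apply: (cvgr_ge (s *+ 2)) => //; rewrite mulr2n ltrDl.
  case: ifP => hq; last first.
    by rewrite normr0 mulr_ge0 ?expR_ge0 // (le_trans (normr_ge0 _) (wC L h L0)).
  rewrite normrM ler_pM //; first exact: wC.
  have qL0 : 0 < (q * L)%:R :> R by rewrite ltr0n muln_gt0 q0.
  have yb : 0 <= (pi : R) * h%:R / (q * L)%:R <= pi / 2.
    rewrite divr_ge0 ?mulr_ge0 ?(ltW pi0) //= ler_pdivrMr // mulrAC ler_pdivlMr //.
    by rewrite -mulrA ler_pM2l // -natrM ler_nat muln2 ltnW.
  have /andP[c0 cle] := cos_expn_le (p L) yb.
  rewrite ger0_norm //; apply: le_trans cle _; rewrite ler_expR lerN2.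
  rewrite [leRHS](_ : _ = (p L)%:R / L%:R ^+ 2 * ((pi / q%:R) ^+ 2 / 2 * h%:R ^+ 2)).
    rewrite [leLHS](_ : _ = s * ((pi / q%:R) ^+ 2 / 2 * h%:R ^+ 2)); last by ring.
    apply: ler_wpM2r => //.
    by rewrite mulr_ge0 ?sqr_ge0 // divr_ge0 ?sqr_ge0.
  by rewrite natrM; field; rewrite L0' gt_eqF.
- move=> h h0.
  have k0 : 0 <= pi / q%:R * h%:R :> R by rewrite mulr_ge0 // divr_ge0 // ltW.
  have hc : (fun L => w L h * cos (pi / q%:R * h%:R / L%:R) ^+ p L) @ \oo -->
      v h * expR (- (s *+ 2 * ((pi / q%:R * h%:R) ^+ 2 / 2))).
    exact: (cvgM (wv h) (cos_expn_cvg k0 ps)).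
  rewrite (_ : s *+ 2 * _ = s * (pi / q%:R) ^+ 2 * h%:R ^+ 2) in hc; last by field; rewrite gt_eqF.
  apply: cvg_trans hc; apply: near_eq_cvg; near=> L.
  have L0 : (0 < L)%N by near: L; exact: near_posn.
  have L0' : L%:R != 0 :> R by rewrite pnatr_eq0 -lt0n.
  rewrite ifT /=; last first.
    by rewrite (@leq_trans L) ?leq_pmull //; near: L; exact: nbhs_infty_gt.
  by congr (_ * cos _ ^+ _); rewrite natrM; field; rewrite L0' gt_eqF.
Unshelve. all: by end_near.
Qed.

Variable beta : R.
Hypothesis betaP : (fun m => m%:R * central m ^+ 2 : R) @ \oo --> beta.

Section Character.
Variables (q : nat) (c d : nat -> R) (g : R).
Hypotheses (q0 : (0 < q)%N) (cq : forall n, c (n %% q)%N = c n).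
Hypotheses (c1 : forall n, `|c n| <= 1) (d1 : forall n, `|d n| <= 1).

Lemma poisson_cos :
  (forall a b, (q %| a + b)%N -> c a = c b) ->
  (forall k, \sum_(a < q) c a * cos (pi *+ 2 * (a * k)%:R / q%:R) = g * d k) ->
  c 0 + gauss_series c (s * (pi / q%:R) ^+ 2) *+ 2 =
  g * Num.sqrt (beta / s) * (d 0 + gauss_series d s^-1 *+ 2).
Proof.
move=> ceven cd.
have mn2 : (fun L => (sqscale s L).*2%:R / L%:R ^+ 2 : R) @ \oo --> s *+ 2.
  under eq_fun do rewrite -muln2 natrM mulr_natr mulrnAl.
  by apply: cvgMn; exact: sqscale_cvg.
have l1 : (fun L => c 0 + (\sum_(1 <= h < q * L | (h.*2 < q * L)%N)
      c h * cos (pi * h%:R / (q * L)%:R) ^+ (sqscale s L).*2) *+ 2)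
    @ \oo --> c 0 + gauss_series c (s * (pi / q%:R) ^+ 2) *+ 2.
  apply: cvgD; first exact: cvg_cst.
  apply: cvgMn; apply: (@cos_side_cvg q _ (fun=> c) c 1 0) => //.
    by move=> _ h _; rewrite expr0 mulr1.
  by move=> h; exact: cvg_cst.
have l2 : (fun L => g * bin_scale (sqscale s L) L *
      (d 0 + (\sum_(1 <= j < (sqscale s L + L).+1) d j * bin_ratio (sqscale s L) (L * j)) *+ 2))
    @ \oo --> g * Num.sqrt (beta / s) * (d 0 + gauss_series d s^-1 *+ 2).
  apply: cvgM.
    by apply: cvgM; [exact: cvg_cst | exact: bin_scale_cvg].
  apply: cvgD; first exact: cvg_cst.
  apply: cvgMn; apply: (@bin_side_cvg _ 1 0) => // j.
  by rewrite expr0 mulr1.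
apply: (cvg_unique _ l1) => //; apply: cvg_trans l2; apply: near_eq_cvg; near=> L.
have L0 : (0 < L)%N by near: L; exact: near_posn.
have m0 : (0 < sqscale s L)%N.
  by near: L; have /cvgnyPge/(_ 1%N) := sqscale_infty s0; exact.
rewrite -(@finite_poisson_cos R q c d g q0 cq) //.
by rewrite ltnS (leq_trans (leq_div _ _)) // leq_addr.
Unshelve. all: by end_near.
Qed.

Lemma poisson_sin :
  (forall a b, (q %| a + b)%N -> c a = - c b) ->
  (forall k, \sum_(a < q) c a * sin (pi *+ 2 * (a * k)%:R / q%:R) = g * d k) ->
  gauss_series (fun n => c n * (s * (pi / q%:R * n%:R))) (s * (pi / q%:R) ^+ 2) =
  g * Num.sqrt (beta / s) * gauss_series (fun n => n%:R * d n) s^-1.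
Proof.
move=> codd cd; have pi0 := pi_gt0 R.
have q0' : 0 < q%:R :> R by rewrite ltr0n.
have mn2 : (fun L => (sqscale s L).*2.-1%:R / L%:R ^+ 2 : R) @ \oo --> s *+ 2.
  have h : (fun L => (sqscale s L)%:R / L%:R ^+ 2 *+ 2 - L%:R^-1 * L%:R^-1 : R) @ \oo --> s *+ 2 - 0 * 0.
    by apply: cvgB; [apply: cvgMn; exact: sqscale_cvg | apply: cvgM; exact: invn_cvg].
  rewrite mulr0 subr0 in h; apply: cvg_trans h; apply: near_eq_cvg; near=> L.
  have m0 : (0 < sqscale s L)%N.
    by near: L; have /cvgnyPge/(_ 1%N) := sqscale_infty s0; exact.
  have L0 : L%:R != 0 :> R by rewrite pnatr_eq0 -lt0n; near: L; exact: near_posn.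
  by rewrite -subn1 natrB ?double_gt0 // -muln2 natrM; field.
have kE (h : nat) : 0 <= pi / q%:R * h%:R :> R by rewrite mulr_ge0 // divr_ge0 // ltW.
have yE h L : (0 < L)%N -> pi * h%:R / (q * L)%:R = pi / q%:R * h%:R / L%:R :> R.
  by move=> L0; rewrite natrM; field; rewrite pnatr_eq0 -lt0n L0 gt_eqF.
have l1 : (fun L => \sum_(1 <= h < q * L | (h.*2 < q * L)%N)
      c h * ((sqscale s L)%:R / L%:R * sin (pi * h%:R / (q * L)%:R)) *
      cos (pi * h%:R / (q * L)%:R) ^+ (sqscale s L).*2.-1)
    @ \oo --> gauss_series (fun n => c n * (s * (pi / q%:R * n%:R))) (s * (pi / q%:R) ^+ 2).
  apply: (@cos_side_cvg q _
    (fun L h => c h * ((sqscale s L)%:R / L%:R * sin (pi * h%:R / (q * L)%:R)))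
    _ (s * (pi / q%:R)) 1) => //.
    move=> L h L0; rewrite yE // normrM -[leRHS]mul1r ler_pM // expr1 normrM.
    have L0' : 0 < L%:R :> R by rewrite ltr0n.
    apply: (@le_trans _ _ ((sqscale s L)%:R / L%:R * (pi / q%:R * h%:R / L%:R))).
      by rewrite ger0_norm ?divr_ge0 // ler_wpM2l ?divr_ge0 // norm_sin_le // divr_ge0.
    rewrite (_ : _ * _ = (sqscale s L)%:R / L%:R ^+ 2 * (pi / q%:R * h%:R)); last by field; rewrite !gt_eqF.
    by rewrite -[leRHS]mulrA ler_wpM2r // ler_pdivrMr ?exprn_gt0 // sqscale_le.
  move=> h; apply: cvgM; first exact: cvg_cst.
  have hc : (fun L => (sqscale s L)%:R / L%:R ^+ 2 * (L%:R * sin (pi / q%:R * h%:R / L%:R))) @ \oo -->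
      s * (pi / q%:R * h%:R).
    exact: (cvgM (sqscale_cvg s0) (sin_div_cvg (kE h))).
  apply: cvg_trans hc; apply: near_eq_cvg; near=> L.
  have L0 : (0 < L)%N by near: L; exact: near_posn.
  by rewrite /= yE //; field; rewrite pnatr_eq0 -lt0n.
have l2 : (fun L => g * bin_scale (sqscale s L) L *
      \sum_(1 <= j < (sqscale s L + L).+1) j%:R * d j * bin_ratio (sqscale s L) (L * j))
    @ \oo --> g * Num.sqrt (beta / s) * gauss_series (fun n => n%:R * d n) s^-1.
  apply: cvgM.
    by apply: cvgM; [exact: cvg_cst | exact: bin_scale_cvg].
  apply: (@bin_side_cvg _ 1 1) => // j.
  by rewrite expr1 mul1r normrM normr_nat ler_piMr.
apply: (cvg_unique _ l1) => //; apply: cvg_trans l2; apply: near_eq_cvg; near=> L.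
have L0 : (0 < L)%N by near: L; exact: near_posn.
have m0 : (0 < sqscale s L)%N.
  by near: L; have /cvgnyPge/(_ 1%N) := sqscale_infty s0; exact.
rewrite -(@finite_poisson_sin R q c d g q0 cq) //.
by rewrite ltnS (leq_trans (leq_div _ _)) // leq_addr.
Unshelve. all: by end_near.
Qed.
End Character.

End PoissonLimit.

(** * The functional equation of theta *)

Section ThetaEquation.
Local Open Scope classical_set_scope.
Context {R : realType}.

Lemma gauss_series_ge0 (t : R) : 0 < t -> 0 <= gauss_series (fun=> 1) t.
Proof.
move=> t0; apply: limr_ge.
  have := @gauss_majorant_cvg R 1 t 0 isT t0.
  by under eq_fun do under eq_bigr do rewrite expr0 mulr1.
by apply: nearW => N; apply: sumr_ge0 => n _; rewrite mul1r expR_ge0.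
Qed.

(** The identity poisson_cos with q = 1 and s = 1 / pi is self-dual. *)
Lemma central_cvg_inv_pi : (fun m => m%:R * central m ^+ 2 : R) @ \oo --> (pi : R)^-1.
Proof.
have [beta b0 hb] := @central_cvg R; have pi0 := pi_gt0 R.
suff <- : beta = pi^-1 by [].
have s0 : 0 < (pi : R)^-1 by rewrite invr_gt0.
have pE : pi^-1 * (pi / 1%:R) ^+ 2 = pi :> R by rewrite divr1 expr2 mulKf ?gt_eqF.
have H : (1 : R) + gauss_series (fun=> 1) (pi^-1 * (pi / 1%:R) ^+ 2) *+ 2 =
    1 * Num.sqrt (beta / pi^-1) * (1 + gauss_series (fun=> 1) (pi^-1)^-1 *+ 2).
  apply: (@poisson_cos R _ s0 _ hb 1 (fun=> 1) (fun=> 1) 1) => //.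
  - by move=> n; rewrite normr1.
  - by move=> n; rewrite normr1.
  by move=> k; rewrite big_ord1 !mul0n mulr0 mul0r cos0.
rewrite pE mul1r !invrK in H.
have X0 : 1 + gauss_series (fun=> 1) (pi : R) *+ 2 != 0.
  by rewrite gt_eqF // ltr_pwDl // mulrn_wge0 // gauss_series_ge0.
have /(mulIf X0) e : 1 * (1 + gauss_series (fun=> 1) (pi : R) *+ 2) =
    Num.sqrt (beta * pi) * (1 + gauss_series (fun=> 1) pi *+ 2).
  by rewrite mul1r -H.
apply: (mulIf (lt0r_neq0 pi0)); rewrite mulVf ?gt_eqF //.
by rewrite -[LHS]sqr_sqrtr ?mulr_ge0 ?ltW // -e expr1n.
Qed.

Lemma gauss_seriesZ (k C t : R) (e : nat) (w : nat -> R) : (e <= 1)%N -> 0 < t ->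
  (forall n, `|w n| <= C * n%:R ^+ e) ->
  gauss_series (fun n => k * w n) t = k * gauss_series w t.
Proof.
move=> e1 t0 wC; have wcv : cvgn (fun N => \sum_(1 <= n < N) w n * expR (- (t * n%:R ^+ 2))).
  have bcv := @gauss_majorant_cvg R C t e e1 t0.
  apply: (@is_cvg_sum1_le R (fun n => w n * expR (- (t * n%:R ^+ 2))) _ bcv) => n _.
  by rewrite normrM (ger0_norm (expR_ge0 _)) ler_wpM2r ?expR_ge0.
apply: cvg_lim => //; rewrite (_ : (fun N => _) =
    (fun N => k * \sum_(1 <= n < N) w n * expR (- (t * n%:R ^+ 2)))).
  by apply: cvgM; [exact: cvg_cst | exact: wcv].
by apply/funext => N; rewrite mulr_sumr; apply: eq_bigr => n _; rewrite mulrA.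
Qed.

Lemma theta_gauss_series (D : int) (x : R) :
  theta D x = gauss_series (fun n => (kronecker D n)%:~R * n%:R ^+ delta D) (pi * x).
Proof.
rewrite /theta /gauss_series; congr (limn _); apply/funext => N; apply: eq_bigr => n _.
by rewrite (mulrAC pi).
Qed.

Lemma delta_lt0 (D : int) : delta D = (D < 0).
Proof. by rewrite /delta /kronecker /= big_nil mulr1; case: ifP. Qed.

(** Modulo |D|, a is (|D| - 1) b, and the character at |D| - 1 is the sign of D by [disc_char]. *)
Lemma kronecker_opp (D : int) (a b : nat) : disc_char D (fun n : nat => kronecker D n) ->
  (`|D| %| a + b)%N -> kronecker D a = (-1) ^+ delta D * kronecker D b.
Proof.
move=> [[q0 p1 pM pq _] _ eD] ab; rewrite delta_lt0.
have Dpos : 0 < `|D|%N%:Z by rewrite ltz_nat.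
have -> : (-1) ^+ (D < 0)%R = kronecker D `|D|.-1.
  apply: (mulIf (lt0r_neq0 Dpos)); rewrite eD; case: ltP => D0.
    by rewrite expr1 mulN1r; move: D0; clear; lia.
  by rewrite expr0 mul1r; move: D0; clear; lia.
rewrite -pM -[LHS]pq -[RHS]pq; congr (kronecker D _%:Z).
apply/eqP; rewrite -(eqn_modDr b) -mulSnr prednK // modnMr.
by rewrite -/(dvdn _ _).
Qed.

Lemma theta_equation (D : int) (x : R) : fundamental_discriminant D -> D != 1 -> 0 < x ->
  theta D x = ((`|D|%:~R * x) `^ ((delta D)%:R + 2^-1))^-1 * theta D (D%:~R ^+ 2 * x)^-1.
Proof.
move=> fD D1 x0; have [dc _] := @kronecker_gauss R D fD D1.
have pi0 := pi_gt0 R.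
case: (dc) => -[q0 p1 pM pq _] _ _.
(* The parameter of the limit formulas is s = 1/(pi x): then 1/s = pi x, s (pi/|D|)^2 = pi / (D^2
   x), and beta/s = x. *)
have s0 : 0 < (pi * x)^-1 by rewrite invr_gt0 mulr_gt0.
have q0' : 0 < `|D|%:~R :> R by rewrite ltr0z normr_gt0 -absz_gt0.
have qE : `|D|%N%:R = `|D|%:~R :> R by rewrite -abszE.
have le1 (n : nat) : `|(kronecker D n)%:~R| <= 1 :> R by rewrite -intr_norm lerz1 kronecker_le1.
have per (n : nat) : (kronecker D (n %% `|D|)%N)%:~R = (kronecker D n)%:~R :> R by rewrite pq.
have bE : pi^-1 / (pi * x)^-1 = x by rewrite invrK mulrA mulVf ?mul1r ?gt_eqF.
have sE : (pi * x)^-1 * (pi / `|D|%N%:R) ^+ 2 = pi * (D%:~R ^+ 2 * x)^-1.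
  have -> : (D%:~R : R) ^+ 2 = `|D|%:~R ^+ 2 by rewrite intr_norm real_normK ?num_real.
  rewrite qE; move: (pi : R) pi0 (`|D|%:~R : R) q0' => P P0 Q Q0.
  by field; rewrite !gt_eqF.
rewrite !theta_gauss_series -sE.
have powE : (`|D|%:~R * x) `^ ((delta D)%:R + 2^-1) = (`|D|%:~R * x) ^+ delta D * Num.sqrt (`|D|%:~R * x).
  rewrite powRD ?powR_mulrn ?powR12_sqrt //; [by rewrite mulr_ge0 // ltW|by rewrite mulr_ge0 // ltW|].
  by rewrite gt_eqF ?implybT // mulr_gt0.
rewrite powE; have opp := @kronecker_opp D.
have [D0|D0] := ltP D 0.
- have dD : delta D = 1%N by rewrite delta_lt0 D0.
  have codd a b : (`|D| %| a + b)%N -> (kronecker D a)%:~R = - (kronecker D b)%:~R :> R.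
    by move=> /(opp _ _ dc) ->; rewrite dD expr1 mulN1r rmorphN.
  have H : gauss_series (fun n => (kronecker D n)%:~R * ((pi * x)^-1 * (pi / `|D|%N%:R * n%:R)))
        ((pi * x)^-1 * (pi / `|D|%N%:R) ^+ 2) =
      Num.sqrt `|D|%:~R * Num.sqrt (pi^-1 / (pi * x)^-1) *
        gauss_series (fun n => n%:R * (kronecker D n)%:~R) (pi * x)^-1^-1.
    apply: (poisson_sin s0 central_cvg_inv_pi q0 per le1 le1 codd) => k.
    by rewrite mulrC -kronecker_sin // qE.
  (* The limit of the sine factor is n/(x |D|); this extra 1/(|D| x) turns the exponent 1/2 into
     3/2. *)
  have e1 : (fun n : nat => (kronecker D n)%:~R * ((pi * x)^-1 * (pi / `|D|%N%:R * n%:R))) =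
     (fun n : nat => (x * `|D|%:~R)^-1 * ((kronecker D n)%:~R * n%:R ^+ delta D)).
    apply/funext => n; rewrite dD expr1 qE; move: (pi : R) pi0 (`|D|%:~R : R) q0' => P P0 Q Q0.
    by field; rewrite !gt_eqF.
  have e2 : (fun n : nat => n%:R * (kronecker D n)%:~R) =
      (fun n : nat => (kronecker D n)%:~R * n%:R ^+ delta D) :> (nat -> R).
    by apply/funext => n; rewrite dD expr1 mulrC.
  rewrite e1 e2 bE invrK (@gauss_seriesZ _ 1 _ 1) // in H; last 2 first.
  - by rewrite sE mulr_gt0 // invr_gt0 mulr_gt0 // exprn_even_gt0 //= intr_eq0 -absz_gt0.
  - by move=> n; rewrite dD normrM expr1 normr_nat ler_wpM2r.
  have H2 : forall A T : R, (x * `|D|%:~R)^-1 * A = Num.sqrt `|D|%:~R * Num.sqrt x * T ->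
      T = ((`|D|%:~R * x) ^+ 1 * Num.sqrt (`|D|%:~R * x))^-1 * A.
    move=> A T e; rewrite expr1 sqrtrM ?(ltW q0') //.
    have xq0 : `|D|%:~R * x != 0 by rewrite gt_eqF // mulr_gt0.
    by rewrite invfM mulrAC (mulrC `|D|%:~R x) e mulrAC mulfV ?mul1r // gt_eqF // mulr_gt0 // sqrtr_gt0.
  by rewrite [in X in _ ^+ X]dD; exact: H2.
have dD : delta D = 0%N by rewrite delta_lt0 ltNge D0.
have ceven a b : (`|D| %| a + b)%N -> (kronecker D a)%:~R = (kronecker D b)%:~R :> R.
  by move=> /(opp _ _ dc) ->; rewrite dD expr0 mul1r.
have D0' : 0 < D by rewrite lt_neqAle D0 andbT eq_sym -absz_gt0.
(* The constant terms on both sides vanish, because D > 0 and D != 1 give |D| > 1. *)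
have chi0 : (kronecker D 0%N)%:~R = 0 :> R.
  rewrite /kronecker /= gtn_eqF // ltn_neqAle q0 andbT.
  by apply: contra D1; move: D0'; clear; lia.
have H : (kronecker D 0%N)%:~R +
      gauss_series (fun n => (kronecker D n)%:~R) ((pi * x)^-1 * (pi / `|D|%N%:R) ^+ 2) *+ 2 =
    Num.sqrt `|D|%:~R * Num.sqrt (pi^-1 / (pi * x)^-1) *
      ((kronecker D 0%N)%:~R + gauss_series (fun n => (kronecker D n)%:~R) (pi * x)^-1^-1 *+ 2).
  apply: (poisson_cos s0 central_cvg_inv_pi q0 per le1 le1 ceven) => k.
  by rewrite mulrC -kronecker_cos // qE.
have e1 : (fun n : nat => (kronecker D n)%:~R * n%:R ^+ delta D) =
    (fun n : nat => (kronecker D n)%:~R) :> (nat -> R).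
  by apply/funext => n; rewrite dD expr0 mulr1.
rewrite chi0 !add0r bE invrK mulrnAr in H.
have h2 (a b : R) : a *+ 2 = b *+ 2 -> a = b by lra.
rewrite e1; move/h2: H => ->.
by rewrite dD expr0 mul1r sqrtrM ?ltW // mulKf // gt_eqF // mulr_gt0 // sqrtr_gt0.
Qed.

End ThetaEquation.

(** * The theta series of a non-fundamental discriminant *)

Section Moebius.

Lemma perm_primes_mul (p d : nat) : prime p -> (0 < d)%N -> ~~ (p %| d)%N ->
  perm_eq (primes (p * d)) (p :: primes d).
Proof.
move=> pp d0 pd; apply: uniq_perm; rewrite ?primes_uniq //=.
  by rewrite primes_uniq mem_primes pp d0 (negPf pd).
by move=> q; rewrite primesM ?(prime_gt0 pp) // primes_prime // !inE.
Qed.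

Lemma moebius_mul_prime (p d : nat) : prime p -> (0 < d)%N -> ~~ (p %| d)%N ->
  moebius (p * d) = - moebius d.
Proof.
move=> pp d0 pd; have perm := perm_primes_mul pp d0 pd.
rewrite /moebius (perm_size perm) /squarefree muln_gt0 (prime_gt0 pp) d0 (perm_all _ perm) /=.
have -> : (p ^ 2 %| p * d)%N = false by rewrite -mulnn dvdn_pmul2l ?(prime_gt0 pp) // (negPf pd).
rewrite /= [all _ _](eq_in_all (a2 := fun q => ~~ (q ^ 2 %| d)%N)) //.
  by case: ifP => _; rewrite ?oppr0 // exprS mulN1r.
move=> q; rewrite mem_primes => /and3P[qp _ qd]; rewrite Gauss_dvdr //.
rewrite coprimeXl // prime_coprime // dvdn_prime2 //.
by apply: contraNneq pd => <-.
Qed.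

Lemma moebius_mul_dvd (p d : nat) : prime p -> (p %| d)%N -> moebius (p * d) = 0.
Proof.
move=> pp pd; rewrite /moebius ifF //; apply/negP => /andP[pd0 /allP/(_ p)].
rewrite mem_primes pp pd0 dvdn_mulr // -mulnn dvdn_pmul2l ?(prime_gt0 pp) // pd => /(_ isT).
by [].
Qed.

(** Write n = p m with p prime. The divisors prime to p are those of m prime to p, and they cancel
    against their multiples by p; the remaining divisors are p d with p | d and contribute 0. *)
Lemma sum_moebius (n : nat) : (0 < n)%N -> \sum_(d <- divisors n) moebius d = (n == 1%N)%:R.
Proof.
move=> n0; have [->|n1] := eqVneq n 1%N.
  by rewrite (_ : divisors 1 = [:: 1%N]) // big_seq1.
have n1' : (1 < n)%N by rewrite ltn_neqAle eq_sym n1.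
have pp := pdiv_prime n1'; set p := pdiv n in pp.
have [m nm] : exists m, n = (p * m)%N.
  by exists (n %/ p)%N; rewrite mulnC divnK // pdiv_dvd.
have m0 : (0 < m)%N by move: n0; rewrite nm muln_gt0 => /andP[].
rewrite (bigID (fun d => p %| d)%N) /= -[X in X + _]big_filter -[X in _ + X]big_filter.
have -> : \sum_(d <- [seq d <- divisors n | (p %| d)%N]) moebius d =
    \sum_(d <- divisors m) moebius (p * d).
  rewrite -(big_map (fun d => p * d)%N xpredT moebius); apply: perm_big; apply: uniq_perm.
  - by rewrite filter_uniq // divisors_uniq.
  - rewrite map_inj_uniq ?divisors_uniq // => a b /eqP.
    by rewrite eqn_pmul2l ?(prime_gt0 pp) // => /eqP.
  move=> d; rewrite mem_filter -dvdn_divisors //; apply/andP/mapP.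
    case=> /dvdnP[k ->]; rewrite nm [(k * p)%N]mulnC dvdn_pmul2l ?(prime_gt0 pp) // => km.
    by exists k; rewrite -?dvdn_divisors.
  case=> k; rewrite -dvdn_divisors // => km ->.
  by rewrite dvdn_mulr // nm dvdn_pmul2l ?(prime_gt0 pp).
have -> : \sum_(d <- [seq d <- divisors n | ~~ (p %| d)%N]) moebius d =
    \sum_(d <- divisors m | ~~ (p %| d)%N) moebius d.
  rewrite -[RHS]big_filter; apply: perm_big; apply: uniq_perm; rewrite ?filter_uniq ?divisors_uniq //.
  move=> d; rewrite !mem_filter -!dvdn_divisors //; case: (boolP (p %| d)%N) => //= pd.
  by rewrite nm Gauss_dvdr // coprime_sym prime_coprime.
rewrite [X in X + _](bigID (fun d => p %| d)%N) /= [X in X + _ + _]big1 ?add0r; last first.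
  by move=> d pd; exact: moebius_mul_dvd.
rewrite -big_split big_seq_cond big1 //= => d /andP[dm pd].
rewrite moebius_mul_prime ?addNr //; move: dm; rewrite -dvdn_divisors // => dm.
exact: dvdn_gt0 m0 dm.
Qed.

Lemma sum_divisors (V : nmodType) (m N : nat) (F : nat -> V) : (0 < m < N)%N ->
  \sum_(u <- divisors m) F u = \sum_(1 <= u < N | (u %| m)%N) F u.
Proof.
move=> /andP[m0 mN]; rewrite -[RHS]big_filter; apply: perm_big; apply: uniq_perm.
- exact: divisors_uniq.
- by rewrite filter_uniq // iota_uniq.
move=> d; rewrite mem_filter mem_index_iota -dvdn_divisors //; apply/idP/andP => [dm|[]//].
by rewrite dm (dvdn_gt0 m0 dm) /= (leq_ltn_trans (dvdn_leq m0 dm)).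
Qed.

(** The substitution r = u v: both sides run over the pairs with u v | l. *)
Lemma sum_divisors_swap (V : nmodType) (l : nat) (f : nat -> nat -> V) : (0 < l)%N ->
  \sum_(r <- divisors l) \sum_(u <- divisors r) f (r %/ u)%N u =
  \sum_(v <- divisors l) \sum_(u <- divisors (l %/ v)) f v u.
Proof.
move=> l0.
transitivity (\sum_(1 <= u < l.+1) \sum_(1 <= v < l.+1 | (u * v %| l)%N) f v u).
  rewrite (@sum_divisors _ l l.+1) ?l0 //=.
  rewrite big_nat_cond (eq_bigr (fun r => \sum_(1 <= u < l.+1 | (u %| r)%N) f (r %/ u)%N u)); last first.
    by move=> r /andP[/andP[r0 rl] _]; rewrite (@sum_divisors _ r l.+1) // r0.
  rewrite -big_nat_cond (exchange_big_dep_nat xpredT) //=.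
  apply: eq_big_nat => u /andP[u0 _].
  rewrite (eq_bigl (fun r => (u %| r)%N && (r %| l)%N)) => [|r]; last by rewrite andbC.
  rewrite big_mkcondr sum_dvd //= -big_mkcond.
  rewrite [RHS](@big_cat_nat _ _ _ (l %/ u).+1) //=; last by rewrite ltnS leq_div.
  rewrite [X in _ + X]big_nat_cond [X in _ + X]big1 ?addr0; last first.
    move=> v /andP[/andP[lv _] /(dvdn_leq l0)]; rewrite leqNgt => /negP[].
    by rewrite mulnC -ltn_divLR.
  by apply: eq_bigr => v _; rewrite mulKn.
rewrite (@sum_divisors _ l l.+1) ?l0 //= [RHS]big_nat_cond.
rewrite [RHS](eq_bigr (fun v => \sum_(1 <= u < l.+1 | (u * v %| l)%N) f v u)); last first.
  move=> v /andP[/andP[v0 vl] dv]; rewrite (@sum_divisors _ _ l.+1) ?divn_gt0 //.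
    by apply: eq_bigl => u; rewrite dvdn_divRL.
  by rewrite (dvdn_leq l0 dv) ltnS leq_div.
rewrite -big_nat_cond (exchange_big_dep_nat (fun v => v %| l)%N) //= => u v _ _ _.
by apply: dvdn_trans; exact: dvdn_mull.
Qed.
End Moebius.

Lemma sum_vcond (V : nmodType) (n l : nat) (F : nat -> V) : (0 < n)%N -> (0 < l)%N ->
  \sum_(v <- divisors l | vcond n l v) F v = if vnl n l == 0%N then 0 else F (vnl n l).
Proof.
move=> n0 l0; rewrite -big_filter /vnl.
have : uniq [seq v <- divisors l | vcond n l v] by rewrite filter_uniq ?divisors_uniq.
have : {in [seq v <- divisors l | vcond n l v], forall v, vcond n l v}.
  by move=> v; rewrite mem_filter => /andP[].
case: [seq _ <- _ | _] => [|v [|w t]] /= vs; first by rewrite big_nil.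
  have vc : vcond n l v by apply: vs; rewrite mem_head.
  rewrite big_seq1 ifF //; apply/negP => /eqP v0; move: vc.
  by rewrite v0 /vcond dvd0n gtn_eqF.
rewrite inE negb_or => /andP[/andP[/eqP vw _] _]; case: vw.
by apply: (vcond_uniq n0 l0); apply: vs; rewrite !inE eqxx ?orbT.
Qed.

(** For u v^2 | n, complete multiplicativity collapses chi(u) chi(n / (u v^2)) to chi(n / v^2),
    which is free of u. The inner sum is then that of the Moebius function over the divisors of a
    gcd. *)
Lemma vnl_coef (chi : nat -> int) (n l : nat) : (0 < n)%N -> (0 < l)%N ->
  {morph chi : a b / (a * b)%N >-> a * b} ->
  \sum_(v <- divisors l) \sum_(u <- divisors (l %/ v))
    v%:Z * moebius u * (if (u * v ^ 2 %| n)%N then chi u * chi (n %/ (u * v ^ 2))%N else 0) =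
  (vnl n l)%:Z * chi (n %/ vnl n l ^ 2)%N.
Proof.
move=> n0 l0 cM.
transitivity (\sum_(v <- divisors l | vcond n l v) v%:Z * chi (n %/ v ^ 2)%N); last first.
  (* If no v exists, [vnl n l] is 0, and as a factor it cancels the value of chi at the quotient by
     0. *)
  by rewrite (sum_vcond (fun v => v%:Z * chi (n %/ v ^ 2)%N)) //; case: eqP => // ->; rewrite mul0r.
rewrite [RHS]big_mkcond big_seq [RHS]big_seq; apply: eq_bigr => v.
rewrite -dvdn_divisors // => vl; have v0 := dvdn_gt0 l0 vl.
have a0 : (0 < l %/ v)%N by rewrite divn_gt0 // dvdn_leq.
have v20 : (0 < v ^ 2)%N by rewrite expn_gt0 v0.
rewrite /vcond vl /=; have [vn|vn] /= := boolP (v ^ 2 %| n)%N; last first.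
  by rewrite big1 // => u _; rewrite ifF ?mulr0 //; apply: contraNF vn; apply: dvdn_trans; exact: dvdn_mull.
have b0 : (0 < n %/ v ^ 2)%N by rewrite divn_gt0 // dvdn_leq.
have E u : v%:Z * moebius u * (if (u * v ^ 2 %| n)%N then chi u * chi (n %/ (u * v ^ 2))%N else 0) =
    if (u %| n %/ v ^ 2)%N then v%:Z * chi (n %/ v ^ 2)%N * moebius u else 0.
  rewrite dvdn_divRL //; case: ifP => un; last by rewrite mulr0.
  have -> : (n %/ v ^ 2 = u * (n %/ (u * v ^ 2)))%N.
    by rewrite [(u * v ^ 2)%N]mulnC divnMA mulnC divnK // dvdn_divRL.
  by rewrite cM; ring.
under eq_bigr do rewrite E.
rewrite -big_mkcond -mulr_sumr.
have -> : \sum_(u <- divisors (l %/ v) | (u %| n %/ v ^ 2)%N) moebius u =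
    (coprime (l %/ v) (n %/ v ^ 2))%:R.
  rewrite -sum_moebius ?gcdn_gt0 ?a0 // -big_filter; apply: perm_big.
  apply: uniq_perm; rewrite ?filter_uniq ?divisors_uniq // => u.
  by rewrite mem_filter -!dvdn_divisors ?gcdn_gt0 ?a0 // dvdn_gcd andbC.
by case: coprime; rewrite ?mulr1 ?mulr0.
Qed.

(** * Assembly of the dilated theta series *)

Section Assembly.
Local Open Scope classical_set_scope.
Context {R : realType}.

Lemma cvg_sum_seq (s : seq nat) (u : nat -> nat -> R) (v : nat -> R) :
  (forall i, i \in s -> u i @ \oo --> v i) ->
  (fun N => \sum_(i <- s) u i N) @ \oo --> \sum_(i <- s) v i.
Proof.
elim: s => [|a s IHs] uv.
  by under eq_fun do rewrite big_nil; rewrite big_nil; exact: cvg_cst.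
under eq_fun do rewrite big_cons; rewrite big_cons; apply: cvgD.
  by apply: uv; rewrite mem_head.
by apply: IHs => i si; apply: uv; rewrite inE si orbT.
Qed.

(** With n = k j, the partial sum below N is a partial sum of the theta series over j <= (N - 1)/k,
    a range that tends to infinity with N. *)
Lemma theta_dilate (D : int) (k : nat) (Y : R) : (0 < k)%N -> 0 < Y ->
  (fun N => \sum_(1 <= n < N) (if (k %| n)%N then kronecker D (n %/ k)%N else 0)%:~R *
     n%:R ^+ delta D * expR (- (pi * n%:R ^+ 2 / Y)) : R) @ \oo -->
  k%:R ^+ delta D * theta D (k%:R ^+ 2 / Y).
Proof.
move=> k0 Y0; have y0 : 0 < k%:R ^+ 2 / Y by rewrite divr_gt0 ?exprn_gt0 ?ltr0n.
have h : (fun N : nat => (N.-1 %/ k).+1) @ \oo --> \oo.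
  apply/cvgnyPge => A; near=> N.
  rewrite ltnW // ltnS leq_divRL // -ltnS (@leq_trans N) //; last exact: leqSpred.
  by near: N; exact: nbhs_infty_gt.
have := cvg_comp _ _ h (@theta_cvg R D _ y0).
move/(cvgM (cvg_cst (k%:R ^+ delta D : R))); rewrite -/(theta D _) => hc.
apply: cvg_trans hc; apply: near_eq_cvg; near=> N.
have N0 : (0 < N)%N by near: N; exact: nbhs_infty_gt.
have [M ->] : exists M, N = M.+1 by exists N.-1; rewrite prednK.
rewrite /= mulr_sumr; symmetry.
rewrite (eq_bigr (fun n => if (k %| n)%N then (kronecker D (n %/ k)%N)%:~R *
     n%:R ^+ delta D * expR (- (pi * n%:R ^+ 2 / Y)) else 0)); last first.
  by move=> n _; case: ifP => _ //; rewrite mulr0z !mul0r.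
rewrite -big_mkcond sum_dvd //; apply: eq_bigr => j _.
rewrite mulKn // natrM !exprMn (_ : pi * _ / Y = pi * j%:R ^+ 2 * (k%:R ^+ 2 / Y)).
  by move: (expR _) (k%:R ^+ delta D) (j%:R ^+ delta D) => a b c; ring.
by rewrite [X in pi * X / _]mulrC !mulrA.
Unshelve. all: by end_near.
Qed.


(** Twice the exponent e + 1/2 is the integer 2e + 1, so a square leaves the real power as a natural
    one, ready to meet (l/r)^(2 delta + 1). *)
Lemma powR_shift (a c : R) (e : nat) : 0 <= a -> 0 < c ->
  (c ^+ 2 * a) `^ (e%:R + 2^-1) = c ^+ (2 * e + 1) * a `^ (e%:R + 2^-1).
Proof.
move=> a0 c0; rewrite powRM ?sqr_ge0 //; congr (_ * _).
rewrite -powR_mulrn ?ltW // -powRrM -powR_mulrn ?ltW //; congr (_ `^ _).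
by rewrite natrD natrM mulrDr divff.
Qed.

Lemma fundamental_discriminant_neq0 (D : int) : fundamental_discriminant D -> D != 0.
Proof. by apply: contraTneq => ->. Qed.

(** [T v u] is the contribution of r = u v to [vartheta] after the functional equation, up to the
    common constant, and [S v u] is a partial sum converging to it. The rearrangement is done at
    fixed N, where all sums are finite, and only then does N tend to infinity. *)
Lemma dual_theta_cvg_vartheta (D : int) (l : nat) (x : R) :
  fundamental_discriminant D -> D != 1 -> (0 < l)%N -> 0 < x ->
  (fun N : nat => \sum_(1 <= n < N)
    (vnl n l)%:R * (kronecker D (n %/ vnl n l ^ 2)%N%:Z)%:~R *
    n%:R ^+ delta D *
    expR (- (pi * n%:R ^+ 2 / (D%:~R ^+ 2 * l%:R ^+ 4 * x)))) @ \oo -->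
  (`|D|%:~R * l%:R ^+ 2 * x) `^ ((delta D)%:R + 2^-1) * vartheta D l x.
Proof.
move=> hD hD1 hl hx; have [[[q0 p1 pM _ _] _ _] _] := @kronecker_gauss R D hD hD1.
have D0 := fundamental_discriminant_neq0 hD.
have l0 : 0 < l%:R :> R by rewrite ltr0n.
have q0' : 0 < `|D|%:~R :> R by rewrite ltr0z normr_gt0.
have D20 : 0 < D%:~R ^+ 2 :> R by rewrite exprn_even_gt0 //= intr_eq0.
pose Y : R := D%:~R ^+ 2 * l%:R ^+ 4 * x.
have Y0 : 0 < Y by rewrite mulr_gt0 // mulr_gt0 // exprn_gt0.
have a0 : 0 < `|D|%:~R * l%:R ^+ 2 * x by rewrite mulr_gt0 // mulr_gt0 // exprn_gt0.
set C := _ `^ _; have C0 : C != 0 by rewrite gt_eqF // powR_gt0.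
pose S v u (N : nat) : R := \sum_(1 <= n < N)
  (v%:Z * moebius u * (if (u * v ^ 2 %| n)%N then kronecker D u * kronecker D (n %/ (u * v ^ 2))%N else 0))%:~R *
    n%:R ^+ delta D * expR (- (pi * n%:R ^+ 2 / Y)).
pose T v u : R := v%:R * (moebius u)%:~R * (kronecker D u)%:~R *
   ((u * v ^ 2)%:R ^+ delta D * theta D ((u * v ^ 2)%:R ^+ 2 / Y)).
have ST v u : (0 < u)%N -> (0 < v)%N -> S v u @ \oo --> T v u.
  move=> u0 v0; have k0 : (0 < u * v ^ 2)%N by rewrite muln_gt0 u0 expn_gt0 v0.
  have h : (fun N => v%:R * (moebius u)%:~R * (kronecker D u)%:~R *
      \sum_(1 <= n < N) (if (u * v ^ 2 %| n)%N then kronecker D (n %/ (u * v ^ 2))%N else 0)%:~R *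
        n%:R ^+ delta D * expR (- (pi * n%:R ^+ 2 / Y)) : R) @ \oo --> T v u.
    by apply: cvgM; [exact: cvg_cst | exact: theta_dilate].
  apply: cvg_trans h; apply: near_eq_cvg; near=> N.
  rewrite mulr_sumr; apply: eq_bigr => n _.
  by case: ifP => _; rewrite ?mulr0 ?intrM ?mulr0z; ring.
have term r u : (r %| l)%N -> (u %| r)%N ->
    (l%:R / r%:R) ^+ (2 * delta D + 1) * ((moebius u)%:~R * u%:R ^+ delta D * (kronecker D u)%:~R *
      theta D (u%:R ^+ 2 * l%:R ^+ 4 * x / r%:R ^+ 4)) = C^-1 * T (r %/ u)%N u.
  move=> rl ur; set v := (r %/ u)%N.
  have r0 : (0 < r)%N by exact: dvdn_gt0 rl.
  have u0 : (0 < u)%N by exact: dvdn_gt0 ur.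
  have v0 : (0 < v)%N by rewrite divn_gt0 // dvdn_leq.
  have u0' : 0 < u%:R :> R by rewrite ltr0n.
  have v0' : 0 < v%:R :> R by rewrite ltr0n.
  have -> : r%:R = u%:R * v%:R :> R by rewrite -natrM mulnC divnK.
  clearbody v.
  rewrite theta_equation //; last first.
    by rewrite divr_gt0 ?exprn_gt0 ?mulr_gt0 // mulr_gt0 ?exprn_gt0.
  (* With r = u v the argument of theta is l^4 x / (u^2 v^4). A square is extracted so that the rest
     is the base of the constant [C], and the dual argument becomes (u v^2)^2 / Y. *)
  rewrite (_ : `|D|%:~R * _ = (l%:R / (u%:R * v%:R ^+ 2)) ^+ 2 * (`|D|%:~R * l%:R ^+ 2 * x)); last first.
    by field; rewrite !gt_eqF.
  rewrite powR_shift ?(ltW a0) ?divr_gt0 ?mulr_gt0 ?exprn_gt0 // -/C.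
  rewrite (_ : (_ * (_ / _))^-1 = (u * v ^ 2)%:R ^+ 2 / Y); last first.
    have Dn : D%:~R != 0 :> R by rewrite intr_eq0.
    by rewrite /Y natrM natrX; field; rewrite Dn !gt_eqF.
  rewrite /T natrM natrX; move: (theta D _) => t; move: (delta D) => e.
  (* The two prefactors leave v^(2 delta + 1): one v is the coefficient, and v^(2 delta) completes
     u^delta to the dilation factor (u v^2)^delta. *)
  have K : (l%:R / (u%:R * v%:R)) ^+ (2 * e + 1) /
      (l%:R / (u%:R * v%:R ^+ 2)) ^+ (2 * e + 1) = (v%:R ^+ 2) ^+ e * v%:R :> R.
    rewrite -expr_div_n -exprM -exprSr addn1 (_ : l%:R / _ / _ = v%:R) //.
    by field; rewrite !gt_eqF.
  move: K; rewrite [(_ * C)^-1]invfM [(u%:R * _) ^+ e]exprMn.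
  move: (_ ^+ (2 * e + 1)) ((_ ^+ (2 * e + 1))^-1) (u%:R ^+ e) ((v%:R ^+ 2) ^+ e) => A B U V K.
  rewrite (_ : A * _ = A * B * (C^-1 * ((moebius u)%:~R * U * (kronecker D u)%:~R * t))); last by ring.
  by rewrite K; ring.
have vE : vartheta D l x = C^-1 * \sum_(v <- divisors l) \sum_(u <- divisors (l %/ v)) T v u.
  rewrite -(sum_divisors_swap T) // /vartheta mulr_sumr big_seq [RHS]big_seq; apply: eq_bigr => r.
  rewrite -dvdn_divisors // => rl; have r0 : (0 < r)%N by exact: dvdn_gt0 rl.
  rewrite !mulr_sumr big_seq [RHS]big_seq; apply: eq_bigr => u.
  by rewrite -dvdn_divisors // => ur; rewrite term.
rewrite vE mulVKf //.
have h : (fun N => \sum_(v <- divisors l) \sum_(u <- divisors (l %/ v)) S v u N) @ \oo -->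
    \sum_(v <- divisors l) \sum_(u <- divisors (l %/ v)) T v u.
  apply: (cvg_sum_seq (u := fun v N => \sum_(u <- divisors (l %/ v)) S v u N)) => v.
  rewrite -dvdn_divisors // => vl; have v0 := dvdn_gt0 hl vl.
  apply: (cvg_sum_seq (u := fun u N => S v u N)) => u.
  rewrite -dvdn_divisors ?divn_gt0 ?(dvdn_leq hl) // => ul.
  by apply: ST => //; apply: dvdn_gt0 ul; rewrite divn_gt0 // dvdn_leq.
apply: cvg_trans h; apply: near_eq_cvg; near=> N.
under eq_bigr do rewrite exchange_big /=; rewrite exchange_big /= big_nat [RHS]big_nat.
apply: eq_bigr => n /andP[n0 _].
under eq_bigr => v _ do rewrite -mulr_suml -mulr_suml -rmorph_sum.
rewrite -mulr_suml -mulr_suml -rmorph_sum /= (vnl_coef (chi := fun n : nat => kronecker D n)) //.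
by rewrite intrM.
Unshelve. all: by end_near.
Qed.

End Assembly.

Theorem theorem7p5 (R : realType) (D : int) (l : nat) (x : R)
  (hD : fundamental_discriminant D) (hD1 : D != 1) (hl : (1 <= l)%N)
  (hx : 0 < x) :
  vartheta D l x =
  ((`|D|%:~R * l%:R ^+ 2 * x) `^ ((delta D)%:R + 2^-1))^-1 *
  limn (fun N : nat => \sum_(1 <= n < N)
    (vnl n l)%:R * (kronecker D (n %/ vnl n l ^ 2)%N%:Z)%:~R *
    n%:R ^+ delta D *
    expR (- (pi * n%:R ^+ 2 / (D%:~R ^+ 2 * l%:R ^+ 4 * x)))).
Proof.
rewrite (cvg_lim _ (dual_theta_cvg_vartheta hD hD1 hl hx)) // mulKf // gt_eqF //.
apply/powR_gt0/mulr_gt0 => //; apply: mulr_gt0; last by rewrite exprn_gt0 ?ltr0n.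
by rewrite ltr0z normr_gt0 fundamental_discriminant_neq0.
Qed.
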